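(* Let $M\subset\mathbb{C}^2$ be a real-analytic hypersurface which is not Levi-flat near a point $p\in M$. Then there exists an integer $k$ such that if $H^1$ and $H^2$ are germs at $p$ of local biholomorphisms of $\mathbb{C}^2$ sending $M$ into itself with $j^k_p H^1=j^k_p H^2$, then $H^1\equiv H^2$.
   Context: A real-analytic hypersurface $M\subset\mathbb{C}^N$, locally given by $\{\rho=0\}$ with $\rho$ real-analytic, real-valued and $d\rho\neq 0$, is called Levi-flat if its Levi form $L(\xi)=\sum_{k,j}\frac{\partial^2\rho}{\partial z_k\partial\bar z_j}\xi_k\bar\xi_j$ vanishes identically on the complex tangent space $T^c_qM=T_qM\cap iT_qM$ for every $q\in M$; ''not Levi-flat near $p$'' means that no neighborhood of $p$ in $M$ is Levi-flat. A germ at $p$ of a local biholomorphism $H$ of $\mathbb{C}^2$ sends $M$ into itself if $H(M\cap U)\subset M$ for a sufficiently small neighborhood $U$ of $p$ in $\mathbb{C}^2$ (it is not required that $H(p)=p$). $j^k_pH$ denotes the $k$-jet of $H$ at $p$, i.e. the collection of all partial derivatives of $H$ at $p$ of order at most $k$ (including the value $H(p)$). *)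

(* Defs.v *)
From HB Require Import structures.
From mathcomp Require Import all_boot all_order all_algebra finmap.
From mathcomp Require Import complex.
From mathcomp Require Import all_classical all_reals all_analysis.
From mathcomp.analysis.showcase Require Import summability.

Set Implicit Arguments.
Unset Strict Implicit.
Unset Printing Implicit Defensive.

Import Order.TTheory GRing.Theory Num.Theory.
Import numFieldNormedType.Exports.

Local Open Scope classical_set_scope.
Local Open Scope ring_scope.
Local Open Scope complex_scope.

(* The complex numbers, packed as a numFieldType so that MathComp-Analysis
   supplies the topology of C and of C^N = 'rV[Cplx R]_N. *)
Definition Cplx (R : realType) : numFieldType := R[i].

(* f is, near q, the sum of a multiple power series centred at q; the family of
   all monomials is summed unconditionally (equivalently, absolutely), along the
   filter of finite sets of multi-indices. *)
Definition analytic_at (K : numFieldType) (n : nat) (f : 'rV[K]_n -> K)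
    (q : 'rV[K]_n) : Prop :=
  exists a : {ffun 'I_n -> nat} -> K,
    nbhs q [set x : 'rV[K]_n |
      partial_sum (fun al : {ffun 'I_n -> nat} =>
        a al * \prod_(i < n) (x 0 i - q 0 i) ^+ al i) @ totally --> f x].

(* A map is holomorphic if its components are locally sums of convergent power
   series in the complex coordinates. *)
Definition holomorphic_on (R : realType) (N m : nat) (U : set 'rV[Cplx R]_N)
    (F : 'rV[Cplx R]_N -> 'rV[Cplx R]_m) : Prop :=
  forall z, U z -> forall j : 'I_m, analytic_at (fun w => F w 0 j) z.

(* Underlying real coordinates (x_1, .., x_N, y_1, .., y_N) of C^N = R^(2N). *)
Definition to_real (R : realType) (N : nat) (z : 'rV[Cplx R]_N) :
    'rV[R]_(N + N) :=
  row_mx (\row_j complex.Re (z 0 j)) (\row_j complex.Im (z 0 j)).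

Definition of_real (R : realType) (N : nat) (x : 'rV[R]_(N + N)) :
    'rV[Cplx R]_N :=
  \row_j (x 0 (lshift N j) +i* x 0 (rshift N j)).

Definition real_analytic_at (R : realType) (N : nat) (f : 'rV[Cplx R]_N -> R)
    (q : 'rV[Cplx R]_N) : Prop :=
  analytic_at (f \o @of_real R N) (to_real q).

(* df_q(v) : real directional derivative of a real-valued f on C^N. *)
Definition rderive (R : realType) (N : nat) (v : 'rV[Cplx R]_N)
    (f : 'rV[Cplx R]_N -> R) (q : 'rV[Cplx R]_N) : R :=
  derive1 (fun t : R => f (q + (t%:C : Cplx R) *: v)) 0.

(* The same for complex-valued f, through real and imaginary parts. *)
Definition cderive (R : realType) (N : nat) (v : 'rV[Cplx R]_N)
    (f : 'rV[Cplx R]_N -> Cplx R) (q : 'rV[Cplx R]_N) : Cplx R :=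
  rderive v (fun z => complex.Re (f z)) q
    +i* rderive v (fun z => complex.Im (f z)) q.

Definition imag (R : realType) : Cplx R := 0 +i* 1.

(* Wirtinger derivatives d/dz_k and d/dzbar_k. *)
Definition ddz (R : realType) (N : nat) (k : 'I_N)
    (f : 'rV[Cplx R]_N -> Cplx R) (q : 'rV[Cplx R]_N) : Cplx R :=
  2^-1 * (cderive (delta_mx 0 k) f q
          - imag R * cderive (imag R *: delta_mx 0 k) f q).

Definition ddzbar (R : realType) (N : nat) (k : 'I_N)
    (f : 'rV[Cplx R]_N -> Cplx R) (q : 'rV[Cplx R]_N) : Cplx R :=
  2^-1 * (cderive (delta_mx 0 k) f q
          + imag R * cderive (imag R *: delta_mx 0 k) f q).

Definition levi_form (R : realType) (N : nat) (rho : 'rV[Cplx R]_N -> R)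
    (q xi : 'rV[Cplx R]_N) : Cplx R :=
  \sum_(k < N) \sum_(j < N)
    ddz k (ddzbar j (fun z => (rho z)%:C)) q * xi 0 k * conjc (xi 0 j).

Definition local_defining (R : realType) (N : nat) (M U : set 'rV[Cplx R]_N)
    (rho : 'rV[Cplx R]_N -> R) : Prop :=
  [/\ open U,
      forall z, U z -> real_analytic_at rho z,
      forall z, U z -> exists v, rderive v rho z != 0 &
      M `&` U = U `&` [set z | rho z = 0]].

Definition real_analytic_hypersurface (R : realType) (N : nat)
    (M : set 'rV[Cplx R]_N) : Prop :=
  forall q, M q -> exists U rho, U q /\ local_defining M U rho.

(* T_qM and T^c_qM for M = {rho = 0} near q. *)
Definition tangent (R : realType) (N : nat) (rho : 'rV[Cplx R]_N -> R)
    (q : 'rV[Cplx R]_N) : set 'rV[Cplx R]_N :=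
  [set v | rderive v rho q = 0].

Definition ctangent (R : realType) (N : nat) (rho : 'rV[Cplx R]_N -> R)
    (q : 'rV[Cplx R]_N) : set 'rV[Cplx R]_N :=
  tangent rho q `&` [set imag R *: v | v in tangent rho q].

(* For a real-analytic hypersurface, vanishing of the Levi form on T^c_qM does
   not depend on the local defining function, so all of them are required. *)
Definition levi_flat (R : realType) (N : nat) (M : set 'rV[Cplx R]_N) : Prop :=
  forall U rho, local_defining M U rho ->
  forall q, M q -> U q ->
  forall xi, ctangent rho q xi -> levi_form rho q xi = 0.

Definition not_levi_flat_near (R : realType) (N : nat) (M : set 'rV[Cplx R]_N)
    (p : 'rV[Cplx R]_N) : Prop :=
  ~ exists U : set 'rV[Cplx R]_N, open_nbhs p U /\ levi_flat (M `&` U).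

(* Germs at p are represented by total maps whose values away from p are
   irrelevant. *)
Definition local_biholomorphism_at (R : realType) (N : nat)
    (H : 'rV[Cplx R]_N -> 'rV[Cplx R]_N) (p : 'rV[Cplx R]_N) : Prop :=
  exists (U V : set 'rV[Cplx R]_N) (G : 'rV[Cplx R]_N -> 'rV[Cplx R]_N),
    [/\ open_nbhs p U /\ open V, set_bij U V H, {in U, cancel H G},
        holomorphic_on U H & holomorphic_on V G].

Definition sends_into_itself_at (R : realType) (N : nat)
    (M : set 'rV[Cplx R]_N) (H : 'rV[Cplx R]_N -> 'rV[Cplx R]_N)
    (p : 'rV[Cplx R]_N) : Prop :=
  \forall z \near p, M z -> M (H z).

Definition germ_eq (R : realType) (N : nat) (p : 'rV[Cplx R]_N)
    (H1 H2 : 'rV[Cplx R]_N -> 'rV[Cplx R]_N) : Prop :=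
  \forall z \near p, H1 z = H2 z.

Definition iter_partial (R : realType) (N : nat) (s : seq 'I_N)
    (H : 'rV[Cplx R]_N -> 'rV[Cplx R]_N) : 'rV[Cplx R]_N -> 'rV[Cplx R]_N :=
  foldr (fun (j : 'I_N) F => 'D_(delta_mx 0 j) F) H s.

(* The k-jet at p: all iterated partial derivatives d/dz_(j_1) .. d/dz_(j_l) at
   p with l <= k; the empty sequence gives the value at p. *)
Definition jet (R : realType) (N k : nat) (p : 'rV[Cplx R]_N)
    (H : 'rV[Cplx R]_N -> 'rV[Cplx R]_N) : k.-bseq 'I_N -> 'rV[Cplx R]_N :=
  fun s => iter_partial s H p.

Arguments jet {R N} k p H s.

(* Main.v *)
From HB Require Import structures.
From mathcomp Require Import all_boot all_order all_algebra finmap.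
From mathcomp Require Import generic_quotient complex ring lra zify.
From mathcomp Require Import all_classical all_reals all_analysis.
From mathcomp.analysis.showcase Require Import summability.
Require Import Defs.

(** Why the theorem holds. Suppose that H1 and H2 have the same k-jet at p and
    map M into itself. Then F = H2^-1 o H1 agrees with the identity at p to
    order k and maps M near p into M; here H2^-1 preserves M because the
    hypersurface through H2(p) pulls back under H2 to a hypersurface that
    contains M near p, hence equals it (map_onto). It remains to show that, for
    large k, such an F is the identity (map_rigid).

    Choose coordinates in which M near p is the graph w = Q(z, zbar, wbar) of a
    convergent power series (implicit, graphP), treat z, zbar, wbar as
    independent variables, and write F = (f, g). The points (z, zbar, wbar) of M
    form a maximally totally real submanifold of C^3, so a series in these
    variables that vanishes on M is zero (graph_vanish), and the invariance of M
    becomes the identity of formal power series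
      Q (f(z, Q), conj f(zbar, wbar), conj g(zbar, wbar)) = g(z, Q).
    If the determinant Q_zbar Q_zwbar - Q_wbar Q_zzbar were zero as a series, M
    would be Levi-flat near p (levi_degenerate).

    The rest is algebra (formal_rigidity). Let h be the automorphism of the ring
    of series in z, zbar, wbar with z |-> f(z, Q), zbar |-> conj f and
    wbar |-> conj g. It is tangent to the identity, so it has a logarithm L,
    which is a derivation (sublogM). Since h preserves the kernels of d/dz and
    of Q_wbar d/dzbar - Q_zbar d/dwbar, so does L, and
    u = Q_zbar L(zbar) + Q_wbar L(wbar) solves two linear equations of second
    order, one for each of these two derivations x and y. With t = [x, y], the
    solutions are governed by the eight functions
      u, x u, y u, y x u, t u, x t u, y t u, t t u,
    whose span over the fraction field is closed under x and y
    (dbasis_closed). A Wronskian argument shows that the solutions form a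
    vector space of dimension at most 8 over C, so there is an order k0 beyond
    which no nonzero solution vanishes (symmetry_determined). If F is tangent
    to the identity to order k0 + 2 then u = 0, hence L(zbar) = L(wbar) = 0 as
    the determinant is not zero, and f(z, w) = z, g(z, w) = w by conjugation.

    The analytic part translates between real-analytic or holomorphic functions
    and convergent series (analytic_series, real_rep, hol_rep): the norm box of
    finite parts of a series controls evaluation, composition and Taylor's
    formula. The vanishing of differentials along M comes from tangent_at,
    proved with the intermediate value theorem. *)

Set Implicit Arguments.
Unset Strict Implicit.
Unset Printing Implicit Defensive.

Import Order.TTheory GRing.Theory Num.Theory.
Import numFieldNormedType.Exports.

Local Open Scope ring_scope.

(** * Formal power series in one variable *)

Definition ps (A : Type) : Type := nat -> A.

HB.instance Definition _ (A : Type) := gen_eqMixin (ps A).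
HB.instance Definition _ (A : Type) := gen_choiceMixin (ps A).

Lemma psP (A : Type) (f g : ps A) : (forall i, f i = g i) -> f = g.
Proof. by move=> h; apply/funext. Qed.

Section PsRing.
Variable A : comNzRingType.
Implicit Types f g h : ps A.

Definition ps_zero : ps A := fun=> 0.
Definition ps_opp f : ps A := fun i => - f i.
Definition ps_add f g : ps A := fun i => f i + g i.
Definition psC (a : A) : ps A := fun i => if i == 0%N then a else 0.
Definition ps_mul f g : ps A := fun n => \sum_(i < n.+1) f i * g (n - i)%N.

Lemma ps_addA : associative ps_add.
Proof. by move=> f g h; apply: psP => i; rewrite /ps_add addrA. Qed.
Lemma ps_addC : commutative ps_add.
Proof. by move=> f g; apply: psP => i; rewrite /ps_add addrC. Qed.
Lemma ps_add0 : left_id ps_zero ps_add.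
Proof. by move=> f; apply: psP => i; rewrite /ps_add add0r. Qed.
Lemma ps_addN : left_inverse ps_zero ps_opp ps_add.
Proof. by move=> f; apply: psP => i; rewrite /ps_add addNr. Qed.

HB.instance Definition _ :=
  GRing.isZmodule.Build (ps A) ps_addA ps_addC ps_add0 ps_addN.

Definition ptrunc (N : nat) f : {poly A} := \poly_(i < N) f i.

Lemma coef_ptrunc N f i : (ptrunc N f)`_i = if (i < N)%N then f i else 0.
Proof. by rewrite coef_poly. Qed.

(** Below degree N the product is that of the truncated polynomials, from
    which the ring laws are transported. *)
Lemma ps_mulE N f g n : (n < N)%N ->
  ps_mul f g n = (ptrunc N f * ptrunc N g)`_n.
Proof.
move=> nN; rewrite coefM; apply: eq_bigr => i _; rewrite !coef_ptrunc.
by rewrite (leq_ltn_trans (leq_ord i) nN) (leq_ltn_trans (leq_subr _ _) nN).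
Qed.

Lemma ps_mulA : associative ps_mul.
Proof.
move=> f g h; apply: psP => n.
transitivity ((ptrunc n.+1 f * ptrunc n.+1 g * ptrunc n.+1 h)`_n).
  rewrite -mulrA coefM; apply: eq_bigr => i _.
  rewrite coef_ptrunc ltn_ord; congr (_ * _).
  by rewrite (@ps_mulE n.+1) // ltnS leq_subr.
rewrite coefM; apply: eq_bigr => i _; rewrite coef_ptrunc ltnS leq_subr.
by rewrite (@ps_mulE n.+1).
Qed.

Lemma ps_mulC : commutative ps_mul.
Proof. by move=> f g; apply: psP => n; rewrite !(@ps_mulE n.+1) // mulrC. Qed.

Lemma ps_mul1 : left_id (psC 1) ps_mul.
Proof.
move=> f; apply: psP => n; rewrite /ps_mul big_ord_recl /= mul1r subn0.
by rewrite big1 ?addr0 // => i _; rewrite mul0r.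
Qed.

Lemma ps_mulDl : left_distributive ps_mul ps_add.
Proof.
move=> f g h; apply: psP => n; rewrite /ps_mul /ps_add -big_split /=.
by apply: eq_bigr => i _; rewrite mulrDl.
Qed.

Lemma ps_1neq0 : psC 1 != 0 :> ps A.
Proof. by apply/eqP => /(congr1 (fun f => f 0%N)) /eqP; rewrite oner_eq0. Qed.

HB.instance Definition _ := GRing.Zmodule_isComNzRing.Build (ps A)
  ps_mulA ps_mulC ps_mul1 ps_mulDl ps_1neq0.

Definition ps_unit f := `[< exists g, g * f = 1 >].
Definition ps_inv f : ps A :=
  if pselect (exists g, g * f = 1) is left h then projT1 (cid h) else f.

Lemma ps_mulVf : {in ps_unit, left_inverse 1 ps_inv *%R}.
Proof.
move=> f; rewrite unfold_in => /asboolP h; rewrite /ps_inv.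
by case: pselect => // h'; case: (cid h').
Qed.
Lemma ps_unitPl f g : g * f = 1 -> f \in ps_unit.
Proof. by move=> h; rewrite unfold_in; apply/asboolP; exists g. Qed.
Lemma ps_inv_out : {in [predC ps_unit], ps_inv =1 id}.
Proof.
move=> f; rewrite inE unfold_in => /asboolPn h; rewrite /ps_inv.
by case: pselect.
Qed.

HB.instance Definition _ := GRing.ComNzRing_hasMulInverse.Build (ps A)
  ps_mulVf ps_unitPl ps_inv_out.

Lemma psD f g i : (f + g) i = f i + g i. Proof. by []. Qed.
Lemma psB f g i : (f - g) i = f i - g i. Proof. by []. Qed.
Lemma psM f g n : (f * g) n = \sum_(i < n.+1) f i * g (n - i)%N.
Proof. by []. Qed.
Lemma ps0 i : (0 : ps A) i = 0. Proof. by []. Qed.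
Lemma ps1 i : (1 : ps A) i = if i == 0%N then 1 else 0. Proof. by []. Qed.
Lemma ps_sum (I : Type) (r : seq I) (P : pred I) (F : I -> ps A) i :
  (\sum_(k <- r | P k) F k) i = \sum_(k <- r | P k) F k i.
Proof. by elim/big_ind2: _ => // x1 x2 y1 y2 <- <-. Qed.

Lemma psC_is_zmod_morphism : zmod_morphism psC.
Proof. by move=> a b; apply: psP => -[|i] //=; rewrite psB /= subr0. Qed.
Lemma psCM_aux a f n : (psC a * f) n = a * f n.
Proof.
rewrite psM big_ord_recl /= subn0 big1 ?addr0 // => i _.
by rewrite mul0r.
Qed.
Lemma psC_is_monoid_morphism : monoid_morphism psC.
Proof.
split=> // a b; apply: psP => n; rewrite psCM_aux /psC.
by case: eqP; rewrite ?mulr0.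
Qed.
HB.instance Definition _ := GRing.isZmodMorphism.Build A (ps A) psC
  psC_is_zmod_morphism.
HB.instance Definition _ := GRing.isMonoidMorphism.Build A (ps A) psC
  psC_is_monoid_morphism.

Definition psX : ps A := fun i => if i == 1%N then 1 else 0.

Lemma psXM f n : (psX * f) n = if n is m.+1 then f m else 0.
Proof.
rewrite psM; case: n => [|n]; first by rewrite big_ord_recl big_ord0 /= mul0r addr0.
rewrite big_ord_recl /= mul0r add0r big_ord_recl /= mul1r subSS subn0.
by rewrite big1 ?addr0 // => i _; rewrite mul0r.
Qed.

Lemma psXnM k f n : (psX ^+ k * f) n = if (k <= n)%N then f (n - k)%N else 0.
Proof.
elim: k f n => [|k IH] f n; first by rewrite expr0 mul1r subn0.
rewrite exprS -mulrA psXM; by case: n => [|n] //=.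
Qed.

Definition pstail (N : nat) f : ps A := fun i => f (N + i)%N.

(** Taylor expansion up to order N, with remainder; it reduces statements
    about morphisms and derivations on series to polynomials in psX, up to
    order N. *)
Lemma ps_split N f :
  f = \sum_(i < N) psC (f i) * psX ^+ i + psX ^+ N * pstail N f.
Proof.
apply: psP => n; rewrite psD ps_sum psXnM /pstail.
have coefE (i : 'I_N) : (psC (f i) * psX ^+ i) n = if n == i :> nat then f i else 0.
  rewrite psCM_aux -[X in f i * X](congr1 (fun g : ps A => g n) (mulr1 _)) psXnM ps1.
  rewrite subn_eq0; case: (ltngtP n i) => [h|h|h]; rewrite ?mulr0 ?mulr1 //.
rewrite (eq_bigr _ (fun i _ => coefE i)); case: leqP => h.
  rewrite subnKC // big1 ?add0r // => i _.
  by case: eqP => // e; have := ltn_ord i; rewrite -e ltnNge h.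
rewrite addr0 (bigD1 (Ordinal h)) //= eqxx big1 ?addr0 // => i /eqP hi.
by case: eqP => // e; case: hi; apply: val_inj.
Qed.

End PsRing.

Section PsDomain.
Variable A : idomainType.

Lemma ps_neq0 (f : ps A) : f != 0 ->
  exists m, f m != 0 /\ forall i, (i < m)%N -> f i = 0.
Proof.
move=> /eqP f0.
have ex : exists m, f m != 0.
  apply: contrapT => h; apply: f0; apply: psP => i; apply/eqP/negP => /negP hi.
  by apply: h; exists i.
exists (ex_minn ex); case: ex_minnP => m fm mmin; split=> // i im.
by apply/eqP/negP => /negP /mmin; rewrite leqNgt im.
Qed.

(** Leading coefficients multiply, which makes the ring a domain. *)
Lemma ps_lead (f g : ps A) m n :
  (forall i, (i < m)%N -> f i = 0) -> (forall i, (i < n)%N -> g i = 0) ->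
  (f * g) (m + n)%N = f m * g n.
Proof.
move=> hf hg; rewrite psM.
have mlt : (m < (m + n).+1)%N by rewrite ltnS leq_addr.
rewrite (bigD1 (Ordinal mlt)) //= addKn big1 ?addr0 // => i /eqP hi.
case: (ltngtP i m) => h; first by rewrite hf // mul0r.
  by rewrite hg ?mulr0 //; move: h (ltn_ord i); lia.
by case: hi; apply: val_inj.
Qed.

Lemma ps_integral (f g : ps A) : f * g = 0 -> (f == 0) || (g == 0).
Proof.
move=> fg; apply/orP; apply: contrapT => /not_orP [/negP /ps_neq0 [m [fm hm]]].
move=> /negP /ps_neq0 [n [gn hn]].
have := ps_lead hm hn; rewrite fg ps0 => /esym/eqP.
by rewrite mulf_eq0 (negbTE fm) (negbTE gn).
Qed.
HB.instance Definition _ := GRing.ComUnitRing_isIntegral.Build (ps A) ps_integral.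
End PsDomain.

(** * The tower of power series rings in n variables *)

Section Tower.
Variable F : numFieldType.

(** Iterating one-variable series turns every construction in n variables
    into a recursion on n. The variables are numbered from 0, the last one
    being outermost, and scalars form level 0 of the tower. *)
Fixpoint B (n : nat) : idomainType :=
  if n is m.+1 then ps (B m) else F.

(** The coefficient of the monomial with exponents al; the values of al
    from n on are ignored. *)
Fixpoint cf n (al : nat -> nat) : B n -> F :=
  if n is m.+1 then fun f => cf al (f (al m)) else fun c => c.

Fixpoint cst n (c : F) : B n := if n is m.+1 then psC (cst m c) else c.

Fixpoint var n (i : nat) : B n :=
  if n is m.+1 then (if i == m then psX (B m) else psC (var m i)) else 0.

(** Membership in the d-th power of the ideal of series without constant
    term. This filtration replaces a topology in the formal arguments. *)
Fixpoint ord n (d : nat) : B n -> Prop :=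
  if n is m.+1 then fun f => forall i, ord (d - i) (f i)
  else fun c => (0 < d)%N -> c = 0.

Lemma cst_zmod n : zmod_morphism (cst n).
Proof. by elim: n => [|n IH] a b //=; rewrite IH rmorphB. Qed.
Lemma cst_monoid n : monoid_morphism (cst n).
Proof.
elim: n => [|n [IH1 IHM]]; first by split.
by split=> [|a b] /=; [rewrite IH1 rmorph1 | rewrite IHM rmorphM].
Qed.
HB.instance Definition _ n := GRing.isZmodMorphism.Build F (B n) (cst n)
  (cst_zmod n).
HB.instance Definition _ n := GRing.isMonoidMorphism.Build F (B n) (cst n)
  (cst_monoid n).

Lemma ord_ge0 n (f : B n) : ord 0 f.
Proof. by elim: n f => [|n IH] f //= i; rewrite sub0n. Qed.
Lemma ordz n d : ord d (0 : B n).
Proof. by elim: n d => [|n IH] d //= i; exact: IH. Qed.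
Lemma ord_le n d e (f : B n) : (e <= d)%N -> ord d f -> ord e f.
Proof.
elim: n d e f => [|n IH] d e f /= ed; first by move=> h e0; apply: h; lia.
by move=> h i; apply: IH (h i); lia.
Qed.
Lemma ordD n d (f g : B n) : ord d f -> ord d g -> ord d (f + g).
Proof.
elim: n d f g => [|n IH] d f g /=.
  by move=> hf hg d0; rewrite hf ?hg ?addr0.
by move=> hf hg i; exact: IH.
Qed.
Lemma ordN n d (f : B n) : ord d f -> ord d (- f).
Proof.
elim: n d f => [|n IH] d f /=; first by move=> hf d0; rewrite hf ?oppr0.
by move=> hf i; exact: IH.
Qed.
Lemma ordB n d (f g : B n) : ord d f -> ord d g -> ord d (f - g).
Proof. by move=> hf hg; apply: ordD => //; apply: ordN. Qed.
Lemma ord_sum n d (I : Type) (r : seq I) (P : pred I) (G : I -> B n) :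
  (forall i, P i -> ord d (G i)) -> ord d (\sum_(i <- r | P i) G i).
Proof. by move=> h; elim/big_ind: _; [exact: ordz|move=> *; exact: ordD|]. Qed.
Lemma ordM n a b (f g : B n) : ord a f -> ord b g -> ord (a + b) (f * g).
Proof.
elim: n a b f g => [|n IH] a b f g /=.
  move=> hf hg; case: (posnP a) => [->|a0]; last by rewrite hf ?mul0r.
  by rewrite add0n => b0; rewrite hg ?mulr0.
move=> hf hg i; rewrite psM; apply: ord_sum => j _.
by apply: ord_le (IH _ _ _ _ (hf j) (hg (i - j)%N)); have := ltn_ord j; lia.
Qed.
Lemma ordMl n d (f g : B n) : ord d g -> ord d (f * g).
Proof. by move=> h; have := ordM (ord_ge0 f) h. Qed.
Lemma ordMr n d (f g : B n) : ord d f -> ord d (f * g).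
Proof. by rewrite mulrC; exact: ordMl. Qed.
Lemma ordX n d k (f : B n) : ord d f -> ord (k * d) (f ^+ k).
Proof.
move=> h; elim: k => [|k IH]; first by rewrite mul0n; exact: ord_ge0.
by rewrite exprS mulSn; exact: ordM.
Qed.
Lemma ord1X n k (f : B n) : ord 1 f -> ord k (f ^+ k).
Proof. by move=> /(ordX k); rewrite muln1. Qed.
Lemma ord_var n i : ord 1 (var n i).
Proof.
elim: n i => [|n IH] i //=; case: eqP => _ j; rewrite /psX /psC.
  by case: j => [|[|j]] /=; [exact: ordz|exact: ord_ge0|exact: ord_ge0].
by case: j => [|j] /=; [exact: IH|exact: ordz].
Qed.

Lemma ord_eq0 n (f : B n) : (forall d, ord d f) -> f = 0.
Proof.
elim: n f => [|n IH] f /= h; first exact: (h 1%N).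
by apply: psP => i; apply: IH => d; have := h (d + i)%N i; rewrite addnK.
Qed.

Lemma ord_cf n d (f : B n) :
  ord d f <-> forall al : nat -> nat, (\sum_(i < n) al i < d)%N -> cf al f = 0.
Proof.
elim: n d f => [|n IH] d f /=.
  by split=> [h al|h d0]; [rewrite big_ord0 => /h|apply: (h (fun=> 0%N)); rewrite big_ord0].
split=> [h al|h i].
  by rewrite big_ord_recr /= => hal; by apply: (proj1 (IH _ _) (h (al n))); rewrite ltn_subRL addnC.
apply/IH => al hal.
have := h (fun k => if k == n then i else al k); rewrite big_ord_recr /= eqxx.
rewrite (eq_bigr (fun k : 'I_n => al k)); last first.
  by move=> k _; rewrite ltn_eqF.
have -> : cf (fun k => if k == n then i else al k) (f i) = cf al (f i).
  move: (f i) => g {IH h f hal}.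
  have : forall m (g : B m), (m <= n)%N ->
     cf (fun k => if k == n then i else al k) g = cf al g.
    elim=> [|m IHm] g' mn //=; rewrite ltn_eqF //; apply: IHm; lia.
  exact.
by apply; rewrite addnC -ltn_subRL.
Qed.

Lemma cf_zmod n al : zmod_morphism (@cf n al).
Proof. by elim: n => [|n IH] a b //=; rewrite psB IH. Qed.
HB.instance Definition _ n al := GRing.isZmodMorphism.Build (B n) F (@cf n al)
  (@cf_zmod n al).
Lemma cf_cst n al c (f : B n) : cf al (cst n c * f) = c * cf al f.
Proof. by elim: n f => [|n IH] f //=; rewrite psCM_aux IH. Qed.

Lemma ord_sep n (f g : B n) : (forall N, ord N (f - g)) -> f = g.
Proof. by move=> h; apply/eqP; rewrite -subr_eq0; apply/eqP/ord_eq0. Qed.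

Lemma big_nat_shift (V : nmodType) (j N : nat) (u : nat -> V) :
  \sum_(j <= i < N) u i = \sum_(0 <= i < N - j) u (i + j)%N.
Proof. by rewrite -{1}[j]add0n big_addn. Qed.

(** The coefficient of degree j in the last variable is the finite sum over
    the terms of index less than j plus a sum of terms of increasing order
    in the remaining variables. *)
Lemma isum_ex n (u : nat -> B n) : (forall i, ord i (u i)) ->
  exists s, forall N, ord N (s - \sum_(i < N) u i).
Proof.
elim: n u => [|n IH] u hu /=.
  exists (u 0%N) => -[|N] // _; rewrite big_ord_recl big1 ?addr0 ?subrr // => i _.
  exact: (hu (bump 0 i)).
have hv j : forall i, ord i (u (j + i)%N j).
  by move=> i; have := hu (j + i)%N j; rewrite addKn.
pose s : B n.+1 := fun j => \sum_(i < j) u i j + projT1 (cid (IH _ (hv j))).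
exists s => N j; rewrite psB ps_sum /s; case: cid => t /= ht.
case: (leqP N j) => Nj; first by rewrite (eqP (_ : N - j == 0)%N) ?subn_eq0 //; exact: ord_ge0.
have -> : \sum_(i < N) u i j = \sum_(i < j) u i j + \sum_(i < N - j) u (j + i)%N j.
  rewrite -(big_mkord xpredT (fun i => u i j)) (big_cat_nat (leq0n j) (ltnW Nj)) /=.
  rewrite big_mkord; congr (_ + _).
  by rewrite big_nat_shift big_mkord; apply: eq_bigr => i _; rewrite addnC.
rewrite opprD addrACA subrr add0r; exact: ht.
Qed.

Definition isum n (u : nat -> B n) : B n :=
  xget 0 [set s | forall N, ord N (s - \sum_(i < N) u i)]%classic.

Lemma isumP n (u : nat -> B n) : (forall i, ord i (u i)) ->
  forall N, ord N (isum u - \sum_(i < N) u i).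
Proof.
by move=> /isum_ex [s hs]; rewrite /isum; case: xgetP => [t -> //|/(_ s)].
Qed.

Lemma isum_uniq n (u : nat -> B n) s : 
  (forall N, exists2 M, (N <= M)%N & ord N (s - \sum_(i < M) u i)) ->
  (forall i, ord i (u i)) -> isum u = s.
Proof.
move=> hs hu; apply: ord_sep => N; have [M NM hM] := hs N.
have -> : isum u - s = (isum u - \sum_(i < M) u i) - (s - \sum_(i < M) u i) by ring.
by apply: ordB => //; apply: ord_le NM _; exact: isumP.
Qed.

End Tower.

(** * Derivations and substitution *)

Section PsDer.
Variable A : comNzRingType.
Definition psder (f : ps A) : ps A := fun k => f k.+1 *+ k.+1.

Lemma psderE (f : ps A) N k : (k.+1 < N)%N -> psder f k = ((ptrunc N f)^`())`_k.
Proof. by move=> h; rewrite coef_deriv coef_ptrunc h. Qed.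

Lemma psderD (f g : ps A) : psder (f + g) = psder f + psder g.
Proof. by apply: psP => i; rewrite /psder !psD mulrnDl. Qed.

Lemma psderM (f g : ps A) : psder (f * g) = psder f * g + f * psder g.
Proof.
apply: psP => k; rewrite psD !psM.
transitivity (((ptrunc k.+2 f * ptrunc k.+2 g)^`())`_k).
  by rewrite coef_deriv -(@ps_mulE A k.+2).
rewrite derivM coefD !coefM; congr (_ + _); apply: eq_bigr => i _.
  have ik : (i.+1 < k.+2)%N by rewrite ltnS ltn_ord.
  have ik' : (k - i < k.+2)%N by rewrite ltnS leqW ?leq_subr.
  by rewrite (psderE f ik) coef_ptrunc ik'.
have ik : (i < k.+2)%N by rewrite ltnW // ltnS ltn_ord.
have ik' : ((k - i).+1 < k.+2)%N by rewrite !ltnS leq_subr.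
by rewrite coef_ptrunc ik (psderE g ik').
Qed.
End PsDer.

Section Sub.
Variable F : numFieldType.
Local Notation B := (B F).
Implicit Types n m : nat.

(** Such a derivation kills polynomials in the last variable, and it maps
    multiples of psX ^+ N to elements of order N because psi does.
    Uniqueness of morphisms and the chain rule follow. *)
Lemma tder_eq0 n m (phi psi : {rmorphism B n -> B m}) (D : B n -> B m) :
  (forall f g, D (f + g) = D f + D g) ->
  (forall f g, D (f * g) = D f * phi g + psi f * D g) ->
  (forall c, D (cst n c) = 0) ->
  (forall i, (i < n)%N -> D (var F n i) = 0) ->
  (forall i, (i < n)%N -> ord 1 (psi (var F n i))) ->
  forall f, D f = 0.
Proof.
elim: n phi psi D => [|n IH] phi psi D DD DM Dc Dv ov f; first exact: (Dc f).
have DC a : D (psC a) = 0.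
  apply: (IH (phi \o @psC (B n)) (psi \o @psC (B n)) (D \o @psC (B n))).
  - by move=> u v /=; rewrite raddfD DD.
  - by move=> u v /=; rewrite rmorphM DM.
  - exact: Dc.
  - by move=> i ni /=; have := Dv i (ltnW ni); rewrite /= ltn_eqF.
  - by move=> i ni /=; have := ov i (ltnW ni); rewrite /= ltn_eqF.
have DX : D (psX (B n)) = 0 by have := Dv n (ltnSn n); rewrite /= eqxx.
have oX : ord 1 (psi (psX (B n))) by have := ov n (ltnSn n); rewrite /= eqxx.
have D1 : D 1 = 0 by rewrite -(Dc 1) rmorph1.
have DXk k : D (psX (B n) ^+ k) = 0.
  elim: k => [|k IHk]; first by rewrite expr0.
  by rewrite exprS DM IHk DX mul0r mulr0 addr0.
have D0 : D 0 = 0 by rewrite -(Dc 0) rmorph0.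
apply: ord_eq0 => N; rewrite (ps_split N f) DD.
have -> : D (\sum_(i < N) psC (f i) * psX (B n) ^+ i) = 0.
  elim/big_ind: _ => // [x y hx hy|i _]; first by rewrite DD hx hy addr0.
  by rewrite DM DC DXk mul0r mulr0 addr0.
rewrite add0r DM DXk mul0r add0r rmorphXn; apply: ordMr; exact: ord1X.
Qed.

Lemma hom_eq n m (phi psi : {rmorphism B n -> B m}) :
  (forall c, phi (cst n c) = psi (cst n c)) ->
  (forall i, (i < n)%N -> phi (var F n i) = psi (var F n i)) ->
  (forall i, (i < n)%N -> ord 1 (psi (var F n i))) ->
  forall f, phi f = psi f.
Proof.
move=> hc hv ov f; apply/eqP; rewrite -subr_eq0; apply/eqP.
apply: (@tder_eq0 n m phi psi (fun f => phi f - psi f)) => //.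
- by move=> u v; rewrite !raddfD /=; ring.
- by move=> u v; rewrite !rmorphM /=; ring.
- by move=> c; rewrite hc subrr.
- by move=> i ni; rewrite hv ?subrr.
Qed.

(** The series that may be substituted for the variables are those without
    constant term. *)
Definition adm n m (g : nat -> B m) := forall i, (i < n)%N -> ord 1 (g i).

Fixpoint sub m (g : nat -> B m) n : B n -> B m :=
  if n is k.+1 then fun f => isum (fun i => @sub m g k (f i) * g k ^+ i)
  else fun c => cst m c.

Lemma admS n m (g : nat -> B m) : adm n.+1 g -> adm n g.
Proof. by move=> h i ni; apply: h; exact: ltnW. Qed.

Section SubLemmas.
Variables (m : nat) (g : nat -> B m).

Lemma subE n (f : B n.+1) :
  sub g f = isum (fun i => sub g (f i) * g n ^+ i).
Proof. by []. Qed.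

Lemma sub_approx n (f : B n.+1) N : adm n.+1 g ->
  ord N (sub g f - \sum_(i < N) sub g (f i) * g n ^+ i).
Proof.
move=> hg; apply: isumP => i; apply: ordMl; apply: ord1X; exact: hg.
Qed.

Lemma sub_zmod n : adm n g -> zmod_morphism (@sub m g n).
Proof.
elim: n => [|n IH] hg f h; first exact: rmorphB.
apply: ord_sep => N.
have -> : sub g (f - h) - (sub g f - sub g h) =
    (sub g (f - h) - \sum_(i < N) sub g ((f - h) i) * g n ^+ i)
    - (sub g f - \sum_(i < N) sub g (f i) * g n ^+ i)
    + (sub g h - \sum_(i < N) sub g (h i) * g n ^+ i).
  have -> : \sum_(i < N) sub g ((f - h) i) * g n ^+ i =
     \sum_(i < N) sub g (f i) * g n ^+ i - \sum_(i < N) sub g (h i) * g n ^+ i.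
    rewrite -sumrB; apply: eq_bigr => i _.
    by rewrite psB IH; [rewrite mulrBl|exact: admS].
  ring.
by apply: ordD; first apply: ordB; exact: sub_approx.
Qed.

Lemma sub_lift n (f : B n) : adm n.+1 g -> sub g (psC f : B n.+1) = sub g f.
Proof.
move=> hg; rewrite subE; apply: isum_uniq => [N|i]; last first.
  by apply: ordMl; apply: ord1X; exact: hg.
exists N.+1; rewrite ?leqnSn // big_ord_recl /= expr0 mulr1 big1 ?addr0 ?subrr.
  exact: ordz.
move=> i _; have h0 := sub_zmod (admS hg) 0 0; rewrite subrr subrr in h0.
by rewrite h0 mul0r.
Qed.

Lemma sub_cst n c : adm n g -> sub g (cst n c) = cst m c.
Proof.
by elim: n => [|n IH] // hg; rewrite [cst _ _]/= sub_lift // IH //; exact: admS.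
Qed.

Lemma sub_monoid n : adm n g -> monoid_morphism (@sub m g n).
Proof.
move=> hg; split; first by have := sub_cst 1 hg; rewrite !rmorph1.
elim: n hg => [|n IH] hg f h; first exact: rmorphM.
have hg' := admS hg.
pose P (f : B n.+1) N : {poly B m} := \poly_(i < N) sub g (f i).
have PE f' N : (P f' N).[g n] = \sum_(i < N) sub g (f' i) * g n ^+ i.
  by rewrite horner_poly.
have on : ord 1 (g n) by exact: hg.
have sub_sum I (r : seq I) (G : I -> B n) :
    sub g (\sum_(i <- r) G i) = \sum_(i <- r) sub g (G i).
  elim: r => [|i r IHr].
    by rewrite !big_nil; have := sub_cst 0 hg'; rewrite !rmorph0.
  rewrite !big_cons -IHr; have := sub_zmod hg' (G i + \sum_(j <- r) G j) (\sum_(j <- r) G j).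
  by rewrite addrK => ->; rewrite subrK.
apply: ord_sep => N.
have tk : take_poly N (P f N * P h N) = P (f * h) N.
  apply/polyP => k; rewrite coef_take_poly coef_poly; case: leqP => // kN.
  rewrite coefM psM sub_sum; apply: eq_bigr => i _; rewrite !coef_poly IH //.
  by rewrite (leq_ltn_trans (leq_ord i) kN) (leq_ltn_trans (leq_subr _ _) kN).
have -> : sub g (f * h) - sub g f * sub g h =
  (sub g (f * h) - (P (f * h) N).[g n]) - (sub g f - (P f N).[g n]) * sub g h
  - (P f N).[g n] * (sub g h - (P h N).[g n])
  - (drop_poly N (P f N * P h N)).[g n] * g n ^+ N.
  have := congr1 (fun p => p.[g n]) (poly_take_drop N (P f N * P h N)).
  rewrite /= hornerD !hornerM hornerXn tk => e.
  have {e} -> : (drop_poly N (P f N * P h N)).[g n] * g n ^+ N =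
     (P f N).[g n] * (P h N).[g n] - (P (f * h) N).[g n] by rewrite -e; ring.
  ring.
apply: ordB; [apply: ordB; [apply: ordB|]|].
- by rewrite PE; exact: sub_approx.
- by apply: ordMr; rewrite PE; exact: sub_approx.
- by apply: ordMl; rewrite PE; exact: sub_approx.
- by apply: ordMl; exact: ord1X.
Qed.

Definition subm n (hg : adm n g) : {rmorphism B n -> B m} :=
  HB.pack (@sub m g n) (GRing.isZmodMorphism.Build _ _ _ (sub_zmod hg))
    (GRing.isMonoidMorphism.Build _ _ _ (sub_monoid hg)).

Lemma sub_var n i : adm n g -> (i < n)%N -> sub g (var F n i) = g i.
Proof.
elim: n => [|n IH] // hg; rewrite ltnS [var _ _ _]/=; case: eqP => [-> _|/eqP ni il].
  have h0 : sub g (0 : B n) = 0 by have := raddf0 (subm (admS hg)).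
  have h1 : sub g (1 : B n) = 1 by have := rmorph1 (subm (admS hg)).
  rewrite subE; apply: isum_uniq => [N|k]; last by apply: ordMl; apply: ord1X; exact: hg.
  have hX k : sub g (psX (B n) k) = (k == 1%N)%:R.
    by case: k => [|[|k]]; [exact: h0|exact: h1|exact: h0].
  exists N.+2; rewrite ?leqW // (bigD1 (Ordinal (isT : 1 < N.+2)%N)) // big1.
    by rewrite hX /= mul1r addr0 subrr; exact: ordz.
  move=> j /eqP j1; rewrite hX; case: eqP => [e|]; last by rewrite mul0r.
  by case: j1; apply: val_inj.
have hi : (i < n)%N by rewrite ltn_neqAle ni.
by rewrite sub_lift // IH //; exact: admS.
Qed.

Lemma sub_ord n d (f : B n) : adm n g -> ord d f -> ord d (sub g f).
Proof.
elim: n d f => [|n IH] d f hg hf.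
  case: (posnP d) => [->|d0]; first exact: ord_ge0.
  by change (ord d (cst m f)); rewrite (hf d0) rmorph0; exact: ordz.
rewrite -[sub g f](subrK (\sum_(i < d) sub g (f i) * g n ^+ i)).
apply: ordD; first exact: sub_approx.
apply: ord_sum => i _.
have /(ord1X i) oi := hg n (ltnSn n).
by apply: ord_le (ordM (IH _ _ (admS hg) (hf i)) oi); lia.
Qed.

End SubLemmas.

Lemma expr_diff_ord m e i (a b : B m) k : ord 1 a -> ord 1 b ->
  ord e (a - b) -> (k <= (e + i).-1)%N -> ord k (a ^+ i - b ^+ i).
Proof.
move=> oa ob ab ke.
case: i ke => [|i] ke; first by rewrite subrr; exact: ordz.
rewrite subrXX; apply: (@ord_le _ _ (e + i)); first by move: ke; rewrite addnS.
apply: ordM => //; apply: ord_sum => j _.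
by apply: ord_le (ordM (ord1X _ oa) (ord1X _ ob)); have := ltn_ord j; lia.
Qed.

Lemma sub_diff n m (g g' : nat -> B m) d (f : B n) : adm n g -> adm n g' ->
  (forall i, (i < n)%N -> ord d (g i - g' i)) -> ord d (sub g f - sub g' f).
Proof.
move=> + + hd; elim: n f hd => [|n IH] f hd hg hg'; first by rewrite subrr; exact: ordz.
have -> : sub g f - sub g' f = (sub g f - \sum_(i < d) sub g (f i) * g n ^+ i)
   - (sub g' f - \sum_(i < d) sub g' (f i) * g' n ^+ i)
   + \sum_(i < d) (sub g (f i) * g n ^+ i - sub g' (f i) * g' n ^+ i).
  rewrite sumrB; ring.
apply: ordD; first by apply: ordB; exact: sub_approx.
apply: ord_sum => i _.
have -> : sub g (f i) * g n ^+ i - sub g' (f i) * g' n ^+ i =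
  (sub g (f i) - sub g' (f i)) * g n ^+ i + sub g' (f i) * (g n ^+ i - g' n ^+ i) by ring.
apply: ordD; [apply: ordMr|apply: ordMl].
  by apply: IH => [j jn| |]; [apply: hd; exact: ltnW|exact: admS|exact: admS].
case: (posnP i) => [->|i0]; first by rewrite !expr0 subrr; exact: ordz.
apply: expr_diff_ord (hd n (ltnSn n)) _; [exact: hg|exact: hg'|lia].
Qed.

Lemma adm_var n : adm n (var F n).
Proof. by move=> i _; exact: ord_var. Qed.

Lemma sub_id n (f : B n) : sub (var F n) f = f.
Proof.
apply: (@hom_eq n n (subm (@adm_var n)) idfun) => [c|i ni|i ni].
- exact: sub_cst (@adm_var n).
- exact: sub_var (@adm_var n) _.
- exact: ord_var.
Qed.

(** A substitution tangent to the identity is the identity on leading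
    terms; its logarithm converges for this reason. *)
Lemma sub_tangent n m (g g' : nat -> B m) e (f : B n) : adm n g -> adm n g' ->
  (forall i, (i < n)%N -> ord 2 (g i - g' i)) -> ord e f ->
  ord e.+1 (sub g f - sub g' f).
Proof.
move=> + + hd; elim: n e f hd => [|n IH] e f hd hg hg' hf.
  by rewrite subrr; exact: ordz.
have -> : sub g f - sub g' f = (sub g f - \sum_(i < e.+1) sub g (f i) * g n ^+ i)
   - (sub g' f - \sum_(i < e.+1) sub g' (f i) * g' n ^+ i)
   + \sum_(i < e.+1) (sub g (f i) * g n ^+ i - sub g' (f i) * g' n ^+ i).
  rewrite sumrB; ring.
apply: ordD; first by apply: ordB; exact: sub_approx.
apply: ord_sum => i _.
have -> : sub g (f i) * g n ^+ i - sub g' (f i) * g' n ^+ i =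
  (sub g (f i) - sub g' (f i)) * g n ^+ i + sub g' (f i) * (g n ^+ i - g' n ^+ i) by ring.
have on := ord1X i (hg n (ltnSn n)).
apply: ordD.
  have := IH (e - i)%N (f i) (fun j jn => hd j (ltnW jn)) (admS hg) (admS hg') (hf i).
  by move=> /ordM /(_ on); apply: ord_le; have := ltn_ord i; lia.
case: (posnP i) => [->|i0]; first by rewrite !expr0 subrr mulr0; exact: ordz.
have o2 : ord i.+1 (g n ^+ i - g' n ^+ i).
  apply: expr_diff_ord (hd n (ltnSn n)) _; [exact: hg|exact: hg'|lia].
have := ordM (sub_ord (admS hg') (hf i)) o2.
by apply: ord_le; have := ltn_ord i; lia.
Qed.

Fixpoint der n (j : nat) : B n -> B n :=
  if n is k.+1 then fun f => if j == k then psder f else (fun i => @der k j (f i))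
  else fun=> 0.

Definition derivation n (D : B n -> B n) :=
  [/\ forall f g, D (f + g) = D f + D g,
      forall f g, D (f * g) = D f * g + f * D g &
      forall c, D (cst n c) = 0].

Lemma der_derivation n j : derivation (@der n j).
Proof.
elim: n => [|n [IHD IHM IHc]]; first by split => *; rewrite /= ?mul0r ?mulr0 ?addr0.
split=> [f g|f g|c] /=; case: (j == n).
- exact: psderD.
- by apply: psP => i; rewrite !psD IHD.
- exact: psderM.
- apply: psP => i; rewrite psD !psM.
  have h0 : @der n j 0 = 0 by have := IHc 0; rewrite rmorph0.
  rewrite -big_split /= (big_morph _ (IHD) h0); apply: eq_bigr => k _.
  by rewrite IHM.
- by apply: psP => i; rewrite /psder /= mul0rn.
- by apply: psP => -[|i] /=; rewrite ?IHc //; have := IHc 0; rewrite rmorph0.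
Qed.

Lemma derD n j (f g : B n) : der j (f + g) = der j f + der j g.
Proof. by have [] := @der_derivation n j. Qed.
Lemma derM n j (f g : B n) : der j (f * g) = der j f * g + f * der j g.
Proof. by have [] := @der_derivation n j. Qed.
Lemma der_cst n j c : der j (cst n c) = 0.
Proof. by have [] := @der_derivation n j. Qed.
Lemma der_zmod n j : zmod_morphism (@der n j).
Proof.
move=> f g; have h := derD j (f - g) g; rewrite subrK in h.
by rewrite h addrK.
Qed.
Lemma derB n j (f g : B n) : der j (f - g) = der j f - der j g.
Proof. exact: der_zmod. Qed.
HB.instance Definition _ n j := GRing.isZmodMorphism.Build (B n) (B n) (@der n j)
  (@der_zmod n j).

Lemma der_var n j i : (i < n)%N -> der j (var F n i) = (i == j)%:R.
Proof.
elim: n => [|n IH] // hi /=; case: (j =P n) => jn; case: (i =P n) => ni.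
- rewrite jn ni eqxx; apply: psP => -[|k] //=; by rewrite /psder /psX /= mul0rn.
- have -> : (i == j) = false by apply/eqP; rewrite jn.
  by apply: psP => k; rewrite /psder /psC /= mul0rn.
- have -> : (i == j) = false by apply/eqP; rewrite ni => e; apply: jn.
  apply: psP => -[|[|k]]; rewrite /psX /= ?raddf0 //.
  by have := der_cst n j 1; rewrite rmorph1.
- have hi' : (i < n)%N by rewrite ltn_neqAle -ltnS hi andbT; apply/eqP.
  apply: psP => -[|k]; rewrite /psC /= ?IH ?raddf0 //; by case: eqP.
Qed.

Lemma der_ord n j d (f : B n) : ord d f -> ord d.-1 (der j f).
Proof.
elim: n d f => [|n IH] d f /= h; first by [].
case: eqP => _ i; last by apply: ord_le (IH _ _ (h i)); lia.
rewrite /psder -mulr_natr; apply: ordMr; apply: ord_le (h i.+1); lia.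
Qed.

Lemma derC n i j (f : B n) : der i (der j f) = der j (der i f).
Proof.
elim: n f => [|n IH] f //=; case: (i =P n) => hi; case: (j =P n) => hj //.
- by apply: psP => k; rewrite /psder raddfMn.
- by apply: psP => k; rewrite /psder raddfMn.
- by apply: psP => k; rewrite IH.
Qed.

(** Both sides are derivations along sub g, and they agree on the
    variables. *)
Lemma chain n m (g : nat -> B m) (D : B m -> B m) (f : B n) :
  adm n g -> derivation D ->
  D (sub g f) = \sum_(i < n) sub g (der i f) * D (g i).
Proof.
move=> hg [DD DM Dc]; apply/eqP; rewrite -subr_eq0; apply/eqP.
have [S SE] : exists S : {rmorphism B n -> B m}, forall f, S f = sub g f.
  by exists (subm hg).
have D0 : D 0 = 0 by have := Dc 0; rewrite rmorph0.
have DN f' : D (- f') = - D f'.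
  by apply/eqP; rewrite -addr_eq0 -DD addNr D0.
pose T f := D (S f) - \sum_(i < n) S (der i f) * D (g i).
suff : T f = 0 by rewrite /T SE; under eq_bigr do rewrite SE.
apply: (@tder_eq0 n m S S T) => [u v|u v|c|i ni|i ni].
- have e : \sum_(i < n) S (der i (u + v)) * D (g i) =
      \sum_(i < n) S (der i u) * D (g i) + \sum_(i < n) S (der i v) * D (g i).
    by rewrite -big_split /=; apply: eq_bigr => i _; rewrite derD rmorphD mulrDl.
  by rewrite /T e rmorphD DD; ring.
- have e : \sum_(i < n) S (der i (u * v)) * D (g i) =
      S v * (\sum_(i < n) S (der i u) * D (g i)) + S u * (\sum_(i < n) S (der i v) * D (g i)).
    rewrite !mulr_sumr -big_split /=; apply: eq_bigr => i _.
    by rewrite derM rmorphD !rmorphM; ring.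
  by rewrite /T e rmorphM DM; ring.
- rewrite /T SE sub_cst // Dc big1 ?subr0 // => i _.
  by rewrite der_cst raddf0 mul0r.
- rewrite /T SE sub_var // (bigD1 (Ordinal ni)) //= big1 ?addr0.
    by rewrite der_var // eqxx rmorph1 mul1r subrr.
  move=> j /eqP ji; rewrite der_var //; case: eqP => [e|_]; last by rewrite rmorph0 mul0r.
  by case: ji; apply: val_inj.
- by rewrite SE sub_var //; exact: hg.
Qed.

(** The constants of the fraction field of B n are the scalars. Two nonzero
    series with proportional derivatives start in the same degree, with
    leading coefficients in a constant ratio c; applied to u - c v, this
    shows that it is zero. *)
Lemma wronskian_const n (u v : B n) : v != 0 ->
  (forall i, (i < n)%N -> u * der i v = v * der i u) ->
  exists c, u = cst n c * v.
Proof.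
elim: n u v => [|n IH] u v v0 h; first by exists (u / v); rewrite /= divfK.
have [-> |u0] := eqVneq u 0; first by exists 0; rewrite rmorph0 mul0r.
have key (w : B n.+1) : w != 0 -> (forall i, (i < n.+1)%N -> w * der i v = v * der i w) ->
  exists2 c, c != 0 & exists m, [/\ w m = cst n c * v m, v m != 0, w m != 0 &
    forall i, (i < m)%N -> w i = 0 /\ v i = 0].
  move=> w0 hw; have [a [va a0]] := ps_neq0 v0; have [b [wb b0]] := ps_neq0 w0.
  pose X := psX (B n).
  have Xl (f : ps (B n)) k : (X * psder f) k = f k *+ k.
    by rewrite psXM; case: k => [|k]; rewrite ?mulr0n.
  have : (w * (X * psder v)) (b + a)%N = (v * (X * psder w)) (a + b)%N.
    have := hw n (ltnSn n); rewrite /= eqxx => e.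
    by rewrite [(b + a)%N]addnC mulrCA e mulrCA.
  rewrite !ps_lead // ?Xl; last 2 first.
  - by move=> i ib; rewrite Xl b0 // mul0rn.
  - by move=> i ib; rewrite Xl a0 // mul0rn.
  rewrite !mulrnAr mulrC => /eqP; rewrite -subr_eq0 => e.
  have ab : a = b.
    have nz : v a * w b != 0 by rewrite mulf_neq0.
    apply/eqP; case: (ltngtP a b) e => // ab.
      rewrite -opprB oppr_eq0 -mulrnBr ?(ltnW ab) // -mulr_natr mulf_eq0 (negbTE nz) /=.
      have -> : ((b - a)%N%:R : B n) = cst n (b - a)%N%:R by rewrite rmorph_nat.
      by rewrite fmorph_eq0 pnatr_eq0 subn_eq0 leqNgt ab.
    rewrite -mulrnBr ?(ltnW ab) // -mulr_natr mulf_eq0 (negbTE nz) /=.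
    have -> : ((a - b)%N%:R : B n) = cst n (a - b)%N%:R by rewrite rmorph_nat.
    by rewrite fmorph_eq0 pnatr_eq0 subn_eq0 leqNgt ab.
  subst b.
  have [|c hc] := IH (w a) (v a) va.
    move=> i ni; have := hw i (ltnW ni); rewrite /= (ltn_eqF ni) => e1.
    have := congr1 (fun f : ps (B n) => f (a + a)%N) e1.
    rewrite !ps_lead //.
    - by move=> j ja; rewrite b0 // raddf0.
    - by move=> j ja; rewrite a0 // raddf0.
  exists c; first by apply: contra_neq wb => c0; rewrite hc c0 rmorph0 mul0r.
  by exists a; split=> // i ia; split; [exact: b0|exact: a0].
have [c c0 [m [um vm um0 hlt]]] := key u u0 h.
exists c; apply/eqP; rewrite -subr_eq0; apply: contrapT => /negP w0.
have [i ni|d d0 [k [wk vk wk0 hk]]] := key _ w0.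
  have -> : der i (u - cst n.+1 c * v) = der i u - cst n.+1 c * der i v.
    by rewrite derB derM der_cst mul0r add0r.
  by rewrite mulrBl mulrBr h //; ring.
have wm : (u - cst n.+1 c * v) m = 0 by rewrite psB um psCM_aux subrr.
have km : k = m.
  case: (ltngtP k m) => // hkm; first by have [_ e] := hlt _ hkm; rewrite e eqxx in vk.
  by have [_ e] := hk _ hkm; rewrite e eqxx in vm.
by move: wk0; rewrite km wm eqxx.
Qed.

End Sub.

Section Unfold.
Variables (F : numFieldType) (n : nat).
Lemma cstS c : cst n.+1 c = psC (cst n c) :> B F n.+1. Proof. by []. Qed.
Lemma varS i : var F n.+1 i = if i == n then psX (B F n) else psC (var F n i).
Proof. by []. Qed.
Lemma derS j (f : B F n.+1) :
  der j f = if j == n then psder f else (fun i => der j (f i) : B F n).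
Proof. by []. Qed.
Lemma psCE (a : B F n) k : psC a k = if k == 0%N then a else 0. Proof. by []. Qed.
End Unfold.

(** These recursions on the dimension must not unfold when the dimension is
    a successor. *)
Arguments B : simpl never.
Arguments cf : simpl never.
Arguments cst : simpl never.
Arguments var : simpl never.
Arguments ord : simpl never.
Arguments sub : simpl never.
Arguments der : simpl never.

(** * Finiteness of the solution space *)

Definition is_der (K : nzRingType) (d : K -> K) :=
  (forall a b, d (a + b) = d a + d b) /\ (forall a b, d (a * b) = d a * b + a * d b).

Section IsDer.
Variables (K : comNzRingType) (d : K -> K).
Hypothesis hd : is_der d.
Lemma is_der0 : d 0 = 0.
Proof. by apply: (addrI (d 0)); rewrite -(proj1 hd) !addr0. Qed.
Lemma is_der1 : d 1 = 0.
Proof.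
have /eqP := proj2 hd 1 1; rewrite !mulr1 mul1r -subr_eq0.
by rewrite opprD addrA subrr sub0r oppr_eq0 => /eqP.
Qed.
Lemma is_derN a : d (- a) = - d a.
Proof. by apply/eqP; rewrite -addr_eq0 -(proj1 hd) addNr is_der0. Qed.
Lemma is_derB a b : d (a - b) = d a - d b.
Proof. by rewrite (proj1 hd) is_derN. Qed.
Lemma is_der_sum (I : Type) (r : seq I) (P : pred I) (G : I -> K) :
  d (\sum_(i <- r | P i) G i) = \sum_(i <- r | P i) d (G i).
Proof. exact: (big_morph d (proj1 hd) is_der0). Qed.
End IsDer.

Section Closure.
Variables (K : fieldType) (x y : K -> K).
Hypothesis (hx : is_der x) (hy : is_der y).
Let t g := x (y g) - y (x g).
Variables (p q p' q' al be ga : K).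
Hypothesis hxt : forall g, x (t g) = t (x g) + (p * y g + q * t g).
Hypothesis hyt : forall g, y (t g) = t (y g) + (p' * y g + q' * t g).
Variable W : K -> Prop.
Hypothesis hxx : forall f, W f -> x (x f) = al * f + be * x f.
Hypothesis hyy : forall f, W f -> y (y f) = ga * y f.
Hypothesis two0 : (2 : K) != 0.
Hypothesis three0 : (3 : K) != 0.

(** Let t be the commutator of the derivations x and y, and let f be a solution
    of x x f = al f + be x f and y y f = ga y f. Since [x, t] and [y, t] are
    combinations of y and t, all derivatives of f are combinations of these
    eight. *)
Definition dbasis (i : nat) : K -> K :=
  nth id [:: id; x; y; y \o x; t; x \o t; y \o t; t \o t] i.
Local Notation e := dbasis.

Definition sp (m : nat) (G : K -> K) :=
  exists c : nat -> K, forall f, W f -> G f = \sum_(i < m) c i * e i f.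

Lemma sp_eq m G G' : (forall f, W f -> G f = G' f) -> sp m G' -> sp m G.
Proof. by move=> h [c hc]; exists c => f Wf; rewrite h // hc. Qed.
Lemma spD m G H : sp m G -> sp m H -> sp m (fun f => G f + H f).
Proof.
move=> [c hc] [c' hc']; exists (fun i => c i + c' i) => f Wf.
by rewrite hc // hc' // -big_split; apply: eq_bigr => i _; rewrite mulrDl.
Qed.
Lemma spZ m a G : sp m G -> sp m (fun f => a * G f).
Proof.
move=> [c hc]; exists (fun i => a * c i) => f Wf.
by rewrite hc // mulr_sumr; apply: eq_bigr => i _; rewrite mulrA.
Qed.
Lemma spN m G : sp m G -> sp m (fun f => - G f).
Proof. by move=> /(spZ (-1)); apply: sp_eq => f _; rewrite mulN1r. Qed.
Lemma spB m G H : sp m G -> sp m H -> sp m (fun f => G f - H f).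
Proof. by move=> hG hH; apply: spD => //; exact: spN. Qed.
Lemma sp_le m m' G : (m <= m')%N -> sp m G -> sp m' G.
Proof.
move=> mm [c hc]; exists (fun i => if (i < m)%N then c i else 0) => f Wf.
rewrite hc // (big_ord_widen _ (fun i => c i * e i f) mm) big_mkcond.
by apply: eq_bigr => i _; case: ifP => _; rewrite ?mul0r.
Qed.
Lemma sp_e m i : (i < m)%N -> sp m (e i).
Proof.
move=> im; exists (fun j => (j == i)%:R) => f Wf.
rewrite (bigD1 (Ordinal im)) //= eqxx mul1r big1 ?addr0 // => j /eqP ji.
by case: eqP => [E|_]; [case: ji; apply: val_inj|rewrite mul0r].
Qed.
Lemma sp_der m m' (d : K -> K) G : is_der d -> (m <= m')%N ->
  (forall i, (i < m)%N -> sp m' (d \o e i)) -> sp m G -> sp m' (d \o G).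
Proof.
move=> hd mm hi [c hc].
apply: (@sp_eq _ _ (fun f => \sum_(i < m) (d (c i) * e i f + c i * d (e i f)))).
  move=> f Wf /=; rewrite hc // is_der_sum //.
  by apply: eq_bigr => i _; rewrite (proj2 hd).
elim: m mm hi {hc} => [|m IH] mm hi.
  by exists (fun=> 0) => f _; rewrite big_ord0 big1 // => i _; rewrite mul0r.
apply: sp_eq (fun f _ => big_ord_recr _ _) _; apply: spD.
  by apply: IH => [|i im]; [exact: ltnW|apply: hi; exact: ltnW].
apply: spD; first by apply: spZ; apply: sp_e.
by apply: (@spZ _ (c m) (d \o e m)); exact: hi.
Qed.

Lemma txE g : t (x g) = x (t g) - (p * y g + q * t g).
Proof. by rewrite hxt addrK. Qed.
Lemma tyE g : t (y g) = y (t g) - (p' * y g + q' * t g).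
Proof. by rewrite hyt addrK. Qed.
Lemma xyE g : x (y g) = y (x g) + t g.
Proof. by rewrite /t addrC subrK. Qed.

Lemma x0 m : (1 < m)%N -> sp m (x \o e 0). Proof. exact: (@sp_e _ 1). Qed.
Lemma y0 m : (2 < m)%N -> sp m (y \o e 0). Proof. exact: (@sp_e _ 2). Qed.
Lemma xx m : (1 < m)%N -> sp m (fun f => x (x f)).
Proof.
move=> m1; apply: (sp_eq hxx); apply: spD; apply: spZ; last exact: (@sp_e _ 1).
by apply: (@sp_e _ 0); exact: ltnW.
Qed.
Lemma yy m : (2 < m)%N -> sp m (fun f => y (y f)).
Proof. by move=> m1; apply: (sp_eq hyy); apply: spZ; exact: (@sp_e _ 2). Qed.

Lemma xF1 G : sp 3 G -> sp 5 (x \o G).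
Proof.
apply: sp_der => // -[|[|[|]]] // _; [exact: x0|exact: xx|].
by apply: sp_eq (fun f _ => xyE f) _; apply: spD; [exact: (@sp_e _ 3)|exact: (@sp_e _ 4)].
Qed.
Lemma yF1 G : sp 3 G -> sp 5 (y \o G).
Proof.
by apply: sp_der => // -[|[|[|]]] // _; [exact: y0|exact: (@sp_e _ 3)|exact: yy].
Qed.
Lemma sp_y m : (2 < m)%N -> sp m y. Proof. exact: (@sp_e _ 2). Qed.
Lemma sp_t m : (4 < m)%N -> sp m t. Proof. exact: (@sp_e _ 4). Qed.
Lemma sp_pq m a b : (4 < m)%N -> sp m (fun f => a * y f + b * t f).
Proof.
by move=> m4; apply: spD; apply: spZ; [apply: sp_y; exact: leq_trans m4|exact: sp_t].
Qed.

(** Since x y = y x + t, the derivative x y x f is y x x f up to t x f, and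
    x x f is known. *)
Lemma xe3 : sp 5 (fun f => x (e 3 f) - e 5 f).
Proof.
apply: (@sp_eq _ _ (fun f => y (x (x f)) - (p * y f + q * t f))).
  by move=> f Wf; rewrite /e /= xyE txE; ring.
by apply: spB; [exact: (yF1 (xx _))|exact: sp_pq].
Qed.
Lemma ye3 : sp 5 (fun f => y (e 3 f) + 2 * e 6 f).
Proof.
apply: (@sp_eq _ _ (fun f => x (y (y f)) + (p' * y f + q' * t f))).
  move=> f Wf; rewrite /e /=.
  have -> : y (x f) = x (y f) - t f by rewrite xyE addrK.
  rewrite (is_derB hy) [x (y (y f))]xyE tyE; ring.
by apply: spD; [exact: (xF1 (yy _))|exact: sp_pq].
Qed.
Lemma sp_shift m a G H : sp m H -> sp m (fun f => G f + a * H f) -> sp m G.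
Proof.
move=> hH /spB /(_ (spZ a hH)); apply: sp_eq => f _; by rewrite addrK.
Qed.
Lemma xF2 G : sp 5 G -> sp 7 (x \o G).
Proof.
apply: sp_der => // -[|[|[|[|[|]]]]] // _.
- exact: x0.
- exact: xx.
- by apply: sp_le (xF1 (sp_y _)).
- apply: (@sp_shift _ (-1) _ (e 5)); first exact: sp_e.
  by apply: sp_eq (sp_le _ xe3) => // f _; rewrite mulN1r.
- exact: (@sp_e _ 5).
Qed.
Lemma yF2 G : sp 5 G -> sp 7 (y \o G).
Proof.
apply: sp_der => // -[|[|[|[|[|]]]]] // _.
- exact: y0.
- exact: (@sp_e _ 3).
- exact: yy.
- by apply: (@sp_shift _ 2 _ (e 6)); [exact: sp_e|apply: sp_le ye3].
- exact: (@sp_e _ 6).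
Qed.
Lemma tF1 G : sp 3 G -> sp 7 (t \o G).
Proof. by move=> hG; apply: spB; [exact: (xF2 (yF1 hG))|exact: (yF2 (xF1 hG))]. Qed.
Lemma sp_x m : (1 < m)%N -> sp m x. Proof. exact: (@sp_e _ 1). Qed.
(** Commuting t to the left turns x x t f into t x x f, and x x f is known. *)
Lemma xe5 : sp 7 (x \o e 5).
Proof.
apply: (@sp_eq _ _ (fun f => (t (x (x f)) + (p * e 3 f + q * t (x f)))
    + x (p * y f + q * t f))).
  by move=> f Wf; rewrite /e /= -hxt -(proj1 hx) -hxt.
apply: spD; last by apply: (xF2 (sp_pq _ _ _)).
apply: spD; first exact: (tF1 (xx _)).
by apply: spD; apply: spZ; [exact: sp_e|exact: (tF1 (sp_x _))].
Qed.
Lemma ye6 : sp 7 (y \o e 6).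
Proof.
apply: (@sp_eq _ _ (fun f => (t (y (y f)) + (p' * y (y f) + q' * t (y f)))
    + y (p' * y f + q' * t f))).
  by move=> f Wf; rewrite /e /= -hyt -(proj1 hy) -hyt.
apply: spD; last by apply: (yF2 (sp_pq _ _ _)).
apply: spD; first exact: (tF1 (yy _)).
by apply: spD; apply: spZ; [exact: yy|exact: (tF1 (sp_y _))].
Qed.
(** The combination x (y e3 + 2 e6) - y (x e3 - e5) is known, and x y - y x
    = t turns it into a relation between y e5 and e7. *)
Lemma ye5 : sp 7 (fun f => y (e 5 f) + 2^-1 * e 7 f).
Proof.
pose R f := y (e 3 f) + 2 * e 6 f; pose S f := x (e 3 f) - e 5 f.
apply: (@sp_eq _ _ (fun f => 4^-1 * (x (R f) - y (S f)
   + (p' * e 3 f + q' * t (x f)) + y (p * y f + q * t f)))).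
  move=> f Wf; rewrite /R /S (proj1 hx) (is_derB hy) (proj2 hx).
  have -> : x (2 : K) = 0 by rewrite -natr1 (proj1 hx) is_der1 // addr0.
  rewrite (xyE (e 3 f)); rewrite /e /=.
  rewrite (xyE (t f)).
  have -> : t (y (x f)) = y (x (t f)) - y (p * y f + q * t f) - (p' * y (x f) + q' * t (x f)).
    by rewrite tyE txE (is_derB hy).
  field; apply/andP; split => //.
  by rewrite (_ : 4 = 2 * 2 :> K) ?mulf_neq0 //; ring.
apply: spZ; apply: spD; last by apply: (yF2 (sp_pq _ _ _)).
apply: spD; last by apply: spD; apply: spZ; [exact: sp_e|exact: (tF1 (sp_x _))].
by apply: spB; [exact: (xF2 ye3)|exact: (yF2 xe3)].
Qed.
Lemma xe6 : sp 7 (fun f => x (e 6 f) - 2^-1 * e 7 f).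
Proof.
apply: sp_eq ye5 => f Wf; rewrite /e /= xyE.
by field.
Qed.
Lemma xF3 G : sp 7 G -> sp 8 (x \o G).
Proof.
apply: sp_der => // i; case: (ltnP i 5) => [i5 _|].
  by apply: sp_le (xF2 (sp_e i5)).
case: i => [|[|[|[|[|[|[|]]]]]]] // _ _; first exact: sp_le xe5.
apply: (@sp_shift _ (- 2^-1) _ (e 7)); first exact: sp_e.
by apply: sp_eq (sp_le _ xe6) => // f _; rewrite mulNr.
Qed.
Lemma yF3 G : sp 7 G -> sp 8 (y \o G).
Proof.
apply: sp_der => // i; case: (ltnP i 5) => [i5 _|].
  by apply: sp_le (yF2 (sp_e i5)).
case: i => [|[|[|[|[|[|[|]]]]]]] // _ _; last exact: sp_le ye6.
by apply: (@sp_shift _ (2^-1) _ (e 7)); [exact: sp_e|exact: sp_le ye5].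
Qed.
Lemma x2V : x (2^-1 : K) = 0.
Proof.
have : x (2 * 2^-1) = 0 by rewrite mulfV // is_der1.
have h2 : x (2 : K) = 0 by rewrite -natr1 (proj1 hx) is_der1 // addr0.
by rewrite (proj2 hx) h2 mul0r add0r => /eqP; rewrite mulf_eq0 (negbTE two0) => /eqP.
Qed.
Lemma y2V : y (2^-1 : K) = 0.
Proof.
have : y (2 * 2^-1) = 0 by rewrite mulfV // is_der1.
have h2 : y (2 : K) = 0 by rewrite -natr1 (proj1 hy) is_der1 // addr0.
by rewrite (proj2 hy) h2 mul0r add0r => /eqP; rewrite mulf_eq0 (negbTE two0) => /eqP.
Qed.
(** As for ye5, one order higher: x (y e5 + e7 / 2) - y (x e5) is known. *)
Lemma xe7 : sp 8 (x \o e 7).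
Proof.
pose U f := y (e 5 f) + 2^-1 * e 7 f.
apply: (@sp_eq _ _ (fun f => 2 / 3 * (x (U f) - y (x (e 5 f))
  + (p * e 6 f + q * e 7 f)))).
  move=> f Wf; rewrite /U (proj1 hx) (proj2 hx) x2V (xyE (e 5 f)); rewrite /e /=.
  by rewrite txE; field; rewrite ?two0 ?three0.
apply: spZ; apply: spD; last by apply: spD; apply: spZ; exact: sp_e.
by apply: spB; [exact: (xF3 ye5)|exact: (yF3 xe5)].
Qed.
Lemma ye7 : sp 8 (y \o e 7).
Proof.
pose U f := x (e 6 f) - 2^-1 * e 7 f.
apply: (@sp_eq _ _ (fun f => 2 / 3 * (x (y (e 6 f)) - y (U f)
  + (p' * e 6 f + q' * e 7 f)))).
  move=> f Wf; rewrite /U (is_derB hy) (proj2 hy) y2V (xyE (e 6 f)); rewrite /e /=.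
  by rewrite tyE; field; rewrite ?two0 ?three0.
apply: spZ; apply: spD; last by apply: spD; apply: spZ; exact: sp_e.
by apply: spB; [exact: (xF3 ye6)|exact: (yF3 xe6)].
Qed.

Lemma dbasis_closed (i : 'I_8) : sp 8 (x \o e i) /\ sp 8 (y \o e i).
Proof.
case: (ltnP i 7) => [i7|]; first by split; [exact: (xF3 (sp_e i7))|exact: (yF3 (sp_e i7))].
case: i => -[|[|[|[|[|[|[|[|i]]]]]]]] // ? _; split; [exact: xe7|exact: ye7].
Qed.

Definition dvec (f : K) : 'rV[K]_8 := \row_(j < 8) e j f.

Lemma dvec_system : exists A A' : 'M[K]_8, forall f, W f ->
  map_mx x (dvec f) = dvec f *m A /\ map_mx y (dvec f) = dvec f *m A'.
Proof.
have hX i := cid (proj1 (dbasis_closed i)); have hY i := cid (proj2 (dbasis_closed i)).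
exists (\matrix_(j, i) projT1 (hX i) j), (\matrix_(j, i) projT1 (hY i) j) => f Wf.
split; apply/rowP => i; rewrite !mxE.
  rewrite [LHS](projT2 (hX i) f Wf); apply: eq_bigr => j _.
  by rewrite !mxE mulrC.
rewrite [LHS](projT2 (hY i) f Wf); apply: eq_bigr => j _.
by rewrite !mxE mulrC.
Qed.

(** Solution vectors satisfy a linear differential system. Differentiating
    a relation between them and subtracting the relation multiplied by the
    matrix of the system leaves a relation with the derivatives of the
    coefficients, which must be trivial. *)
Lemma dvec_const r (f : 'I_r -> K) (g : K) (c : 'rV[K]_r) :
  (forall i, W (f i)) -> W g -> row_free (\matrix_i dvec (f i)) ->
  dvec g = c *m (\matrix_i dvec (f i)) -> forall i, x (c 0 i) = 0 /\ y (c 0 i) = 0.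
Proof.
move=> Wf Wg fr hg; have [A [A' hA]] := dvec_system.
suff key (d : K -> K) (M : 'M[K]_8) : is_der d ->
    (forall f, W f -> map_mx d (dvec f) = dvec f *m M) -> map_mx d c = 0.
  move=> i; split.
    have /rowP /(_ i) := key x A hx (fun f Wf => proj1 (hA f Wf)); by rewrite !mxE.
  have /rowP /(_ i) := key y A' hy (fun f Wf => proj2 (hA f Wf)); by rewrite !mxE.
move=> hd hM; apply: (row_free_inj fr); rewrite mul0mx.
have := hM g Wg; rewrite hg -mulmxA.
have -> : (\matrix_i dvec (f i)) *m M = map_mx d (\matrix_i dvec (f i)).
  apply/row_matrixP => i; rewrite row_mul !rowK -hM //.
  by apply/rowP => j; rewrite !mxE.
have -> : map_mx d (c *m (\matrix_i dvec (f i))) =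
   map_mx d c *m (\matrix_i dvec (f i)) + c *m map_mx d (\matrix_i dvec (f i)).
  apply/rowP => j; rewrite !mxE is_der_sum // -big_split; apply: eq_bigr => i _.
  by rewrite !mxE (proj2 hd).
by move=> /eqP; rewrite -subr_eq0 addrK => /eqP.
Qed.

End Closure.

(** * Derivations of fraction fields *)

(** The field of fractions K of A is only used through the embedding of A;
    keeping it abstract prevents the quotient from being unfolded. *)
Definition is_fracfield (A : idomainType) (K : fieldType) (tf : {rmorphism A -> K}) :=
  injective tf /\ forall k, exists r : A * A, r.2 != 0 /\ k = tf r.1 / tf r.2.

Lemma fraction_fracfield (A : idomainType) : is_fracfield (@tofrac A).
Proof.
split=> [a b /eqP|k]; first by rewrite tofrac_eq => /eqP.
suff : exists r : A * A, r.2 != 0 /\ k = tofrac r.1 / tofrac r.2 by [].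
elim/quotW: k => r; exists (frac r); have d0 := denom_ratioP r; split=> //.
apply: (canRL (mulfK _)); first by rewrite tofrac_eq0.
rewrite -[LHS]/(FracField.mul _ (FracField.tofrac _)).
unlock FracField.tofrac; rewrite piE; apply/eqmodP.
rewrite /= FracField.equivfE /FracField.mulf !numden_Ratio ?oner_neq0 ?mulr1 //.
by rewrite mulrC.
Qed.

Section FracDer.
Variables (A : idomainType) (K : fieldType) (tf : {rmorphism A -> K}).
Hypothesis hK : is_fracfield tf.
Lemma frac_ex (k : K) : exists r : A * A, r.2 != 0 /\ k = tf r.1 / tf r.2.
Proof. exact: (proj2 hK). Qed.
Lemma tf_eq0 a : (tf a == 0) = (a == 0).
Proof. by rewrite -(rmorph0 tf) (inj_eq (proj1 hK)). Qed.

Variable D : A -> A.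
Hypothesis hD : is_der D.

(** The quotient rule, for an arbitrary representation of k as a fraction;
    fderE shows that the choice does not matter. *)
Definition fder (k : K) : K :=
  let r := projT1 (cid (frac_ex k)) in
  (tf (D r.1) - k * tf (D r.2)) / tf r.2.

Lemma fderE n d : d != 0 ->
  fder (tf n / tf d) = (tf (D n) - tf n / tf d * tf (D d)) / tf d.
Proof.
move=> d0; rewrite /fder; case: cid => -[n' d'] /= [d'0].
have t0 : tf d != 0 by rewrite tf_eq0.
have t'0 : tf d' != 0 by rewrite tf_eq0.
set k := tf n / tf d => kE.
have nE : tf n = k * tf d by rewrite /k divfK.
have n'E : tf n' = k * tf d' by rewrite kE divfK.
have e : n' * d = n * d'.
  by apply: (proj1 hK); rewrite !rmorphM nE n'E; ring.
have := congr1 (fun a => tf (D a)) e.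
rewrite /= !(proj2 hD) !rmorphD !rmorphM nE n'E => e2.
apply/eqP; rewrite eqr_div //; apply/eqP.
have -> : (tf (D n') - k * tf (D d')) * tf d =
   (tf (D n') * tf d + k * tf d' * tf (D d)) - k * tf d' * tf (D d) - k * tf d * tf (D d').
  by ring.
by rewrite e2; ring.
Qed.

Lemma fder_tf a : fder (tf a) = tf (D a).
Proof.
have {1}-> : tf a = tf a / tf 1 by rewrite rmorph1 divr1.
rewrite fderE ?oner_neq0 //.
by rewrite (is_der1 hD) rmorph0 rmorph1 mulr0 subr0 !divr1.
Qed.

Lemma fder_der : is_der fder.
Proof.
split=> k k'; have [[n d] /= [d0 ->]] := frac_ex k;
  have [[n' d'] /= [d'0 ->]] := frac_ex k';
  have t0 : tf d != 0 by rewrite ?tf_eq0.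
  have t'0 : tf d' != 0 by rewrite tf_eq0.
  have -> : tf n / tf d + tf n' / tf d' = tf (n * d' + n' * d) / tf (d * d').
    by rewrite rmorphD !rmorphM; field; rewrite t0 t'0.
  rewrite (fderE _ (mulf_neq0 d0 d'0)) (fderE _ d0) (fderE _ d'0).
  rewrite (proj1 hD).
  rewrite !(proj2 hD).
  rewrite !rmorphD !rmorphM.
  field.
  by rewrite t0 t'0.
have t'0 : tf d' != 0 by rewrite tf_eq0.
have -> : tf n / tf d * (tf n' / tf d') = tf (n * n') / tf (d * d').
  by rewrite !rmorphM; field; rewrite t0 t'0.
rewrite (fderE _ (mulf_neq0 d0 d'0)) (fderE _ d0) (fderE _ d'0).
rewrite !(proj2 hD).
rewrite !rmorphD !rmorphM.
field.
by rewrite t0 t'0.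
Qed.

Lemma fder_ext (d1 d2 : K -> K) : is_der d1 -> is_der d2 ->
  (forall a, d1 (tf a) = d2 (tf a)) -> forall k, d1 k = d2 k.
Proof.
move=> h1 h2 h k; have [[n d] /= [d0 ->]] := frac_ex k.
have t0 : tf d != 0 by rewrite tf_eq0.
apply: (mulIf t0).
have E (dd : K -> K) : is_der dd ->
    dd (tf n / tf d) * tf d = dd (tf n) - tf n / tf d * dd (tf d).
  move=> hd; have := proj2 hd (tf n / tf d) (tf d).
  by rewrite divfK // => ->; rewrite addrK.
by rewrite !E // !h.
Qed.

End FracDer.

Lemma comm_der (K : comNzRingType) (d d' : K -> K) : is_der d -> is_der d' ->
  is_der (fun a => d (d' a) - d' (d a)).
Proof.
move=> h h'; split=> a b.
  by rewrite !(proj1 h, proj1 h'); ring.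
by rewrite !(proj2 h, proj2 h') !(proj1 h, proj1 h') !(proj2 h, proj2 h'); ring.
Qed.

Lemma zero_der (K : comNzRingType) : is_der (fun _ : K => 0).
Proof. by split=> *; rewrite ?mul0r ?mulr0 addr0. Qed.

(** * Solutions of the symmetry equations are finitely determined *)

Section Symmetry.
(* The dimension n is 3; it is kept abstract so that B F n does not reduce. *)
Variables (F : numFieldType) (n : nat).
Hypothesis n3 : n = 3%N.
Local Notation B3 := (B F n).
Variables (K : fieldType) (tf : {rmorphism B3 -> K}).
Hypothesis hK : is_fracfield tf.
Variable Q : B3.
Let u : B3 := der 1 Q.
Let v : B3 := der 2 Q.
(** The Levi form of the hypersurface w = Q(z, zbar, wbar) is this
    determinant up to a nonzero factor. *)
Definition levi_det (Q : B3) : B3 :=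
  der 1 Q * der 0 (der 2 Q) - der 2 Q * der 0 (der 1 Q).
Local Notation Delta := (levi_det Q).
(** With variables 0, 1, 2 standing for z, zbar, wbar, this derivation
    annihilates z and Q, the coordinates z and w on the graph w = Q; the
    derivation der 0 annihilates zbar and wbar. *)
Definition segre_der (Q f : B3) : B3 := der 2 Q * der 1 f - der 1 Q * der 2 f.
Local Notation E' := (segre_der Q).

(** The equations satisfied by f = Q_zbar c + Q_wbar d when c and d do not
    depend on z and f = L Q - Q_z a with L Q and a annihilated by
    segre_der, which is the form of an infinitesimal symmetry of w = Q.
    Then segre_der f = levi_det Q * a. *)
Definition symmetry (f : B3) :=
  Delta * der 0 (der 0 f) =
    (der 0 (der 0 u) * der 0 v - der 0 (der 0 v) * der 0 u) * f +
    (der 0 (der 0 v) * u - der 0 (der 0 u) * v) * der 0 f /\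
  Delta * E' (E' f) = E' Delta * E' f.

Hypothesis Delta0 : Delta != 0.
Variable d : nat -> K -> K.
Hypothesis hd : forall j, is_der (d j).
Hypothesis dtf : forall j a, d j (tf a) = tf (der j a).

Let hder (j : nat) : is_der (@der F n j).
Proof. by split; [exact: derD|exact: derM]. Qed.

Let dC i j k : d i (d j k) = d j (d i k).
Proof.
apply/eqP; rewrite -subr_eq0; apply/eqP.
apply: (fder_ext hK (comm_der (hd i) (hd j)) (@zero_der K)) => a /=.
by rewrite !dtf derC subrr.
Qed.
Let U := tf u.
Let V := tf v.
Let x := d 0.
Let y (k : K) := V * d 1 k - U * d 2 k.
Let Dl := tf Delta.
Let Dl0 : Dl != 0. Proof. by rewrite (tf_eq0 hK). Qed.
Let DlE : Dl = U * x V - V * x U.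
Proof. by rewrite /Dl /U /V /x !dtf rmorphB !rmorphM. Qed.
Let hx : is_der x := hd 0.
Let hy : is_der y.
Proof.
by split=> a b; rewrite /y !(proj1 (hd _), proj2 (hd _)); ring.
Qed.
Let t k := x (y k) - y (x k).
Let tE k : t k = x V * d 1 k - x U * d 2 k.
Proof.
rewrite /t /y (is_derB hx) !(proj2 hx) /x (dC 0 1) (dC 0 2); ring.
Qed.
(** Cramer's rule with determinant Dl. *)
Let cram a b : exists p q, a = p * V + q * x V /\ b = p * U + q * x U.
Proof.
exists ((b * x V - a * x U) / Dl), ((U * a - V * b) / Dl).
by rewrite DlE; split; field; rewrite -DlE.
Qed.
Let comb a b : exists p q, forall k, a * d 1 k - b * d 2 k = p * y k + q * t k.
Proof.
have [p [q [-> ->]]] := cram a b; exists p, q => k; rewrite tE /y; ring.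
Qed.
Let hxt : exists p q, forall k, x (t k) = t (x k) + (p * y k + q * t k).
Proof.
have [p [q h]] := comb (x (x V)) (x (x U)); exists p, q => k.
rewrite -h !tE (is_derB hx) !(proj2 hx) /x (dC 0 1) (dC 0 2); ring.
Qed.
Let ht : is_der t := comm_der hx hy.
Let hyt : exists p q, forall k, y (t k) = t (y k) + (p * y k + q * t k).
Proof.
have [p [q h]] := comb (y (x V) - t V) (y (x U) - t U); exists p, q => k.
rewrite -h (tE k) {2}/y (is_derB hy) (is_derB ht) !(proj2 hy) !(proj2 ht).
have -> : y (d 1 k) = V * d 1 (d 1 k) - U * d 1 (d 2 k) by rewrite /y (dC 2 1).
have -> : y (d 2 k) = V * d 1 (d 2 k) - U * d 2 (d 2 k) by [].
have -> : t (d 1 k) = x V * d 1 (d 1 k) - x U * d 1 (d 2 k) by rewrite tE (dC 2 1).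
have -> : t (d 2 k) = x V * d 1 (d 2 k) - x U * d 2 (d 2 k) by rewrite tE.
ring.
Qed.

Let yE f : y (tf f) = tf (E' f).
Proof. by rewrite /y !dtf /E' rmorphB !rmorphM. Qed.

Let W (k : K) := exists f, k = tf f /\ symmetry f.

Let hxx : exists al be, forall k, W k -> x (x k) = al * k + be * x k.
Proof.
exists (tf (der 0 (der 0 u) * der 0 v - der 0 (der 0 v) * der 0 u) / Dl),
  (tf (der 0 (der 0 v) * u - der 0 (der 0 u) * v) / Dl).
move=> _ [f [-> [h _]]]; rewrite /x !dtf.
have := congr1 tf h; rewrite rmorphD !(rmorphM tf) -/Dl => e.
apply: (mulfI Dl0); rewrite e; field; exact: Dl0.
Qed.
Let hyy : exists ga, forall k, W k -> y (y k) = ga * y k.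
Proof.
exists (tf (E' Delta) / Dl) => _ [f [-> [_ h]]]; rewrite !yE.
have := congr1 tf h; rewrite !(rmorphM tf) -/Dl => e.
by apply: (mulfI Dl0); rewrite e; field.
Qed.

Let natK0 m : (m.+1%:R : K) != 0.
Proof.
have -> : (m.+1%:R : K) = tf (cst n m.+1%:R) by rewrite !rmorph_nat.
by rewrite (tf_eq0 hK) fmorph_eq0 pnatr_eq0.
Qed.

Let const k : x k = 0 -> y k = 0 -> exists c, k = tf (cst n c).
Proof.
move=> xk yk; have tk : t k = 0 by rewrite /t xk yk (is_der0 hx) (is_der0 hy) subrr.
have [d1 d2] : d 1 k = 0 /\ d 2 k = 0.
  split; apply: (mulfI Dl0); rewrite mulr0.
    have -> : Dl * d 1 k = U * t k - x U * y k by rewrite DlE tE /y; ring.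
    by rewrite tk yk !mulr0 subrr.
  have -> : Dl * d 2 k = V * t k - x V * y k by rewrite DlE tE /y; ring.
  by rewrite tk yk !mulr0 subrr.
have [[nu de] /= [de0 kE]] := frac_ex hK k.
have t0 : tf de != 0 by rewrite (tf_eq0 hK).
have [|c hc] := @wronskian_const F n nu de de0; last first.
  by exists c; rewrite kE hc rmorphM mulfK.
move=> i i3; have di : d i k = 0.
  by move: (leq_trans i3 (eq_leq n3)) => {i3}; case: i => [|[|[|]]].
have e : tf nu = k * tf de by rewrite kE divfK.
have := congr1 (d i) e; rewrite (proj2 (hd i)) di mul0r add0r !dtf => e2.
have : tf (der i nu) * tf de = tf nu * tf (der i de) by rewrite e2 e; ring.
rewrite -!rmorphM => /(proj1 hK) <-; exact: mulrC.
Qed.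

(** A minimal linear relation over K between the vectors of derivatives of
    symmetries has constant coefficients by dvec_const, so symmetries
    independent over F have vectors independent over K. They form a space
    of dimension at most 8, on which the filtration by the order of
    vanishing is eventually trivial. *)
Lemma symmetry_determined_frac : exists k0, forall f, symmetry f -> ord k0 f -> f = 0.
Proof.
apply: contrapT => hno.
have hex k : exists f, [/\ symmetry f, ord k f & f != 0].
  apply: contrapT => h; apply: hno; exists k => f sf kf.
  by apply/eqP/negP => /negP f0; apply: h; exists f.
have [p [q hpq]] := hxt; have [p' [q' hpq']] := hyt.
have [al [be hab]] := hxx; have [ga hga] := hyy.
pose vec f := dvec x y (tf f).
(* Nonzero symmetries of arbitrarily high order would give nine of them
   with distinct orders, and nine independent vectors of size 8. *)
suff key r : exists f : 'I_r -> B3, [/\ forall i, symmetry (f i),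
    row_free (\matrix_i vec (f i)) & exists k, forall la : 'I_r -> F,
    ord k (\sum_i cst n (la i) * f i) -> forall i, la i = 0].
  have [f [_ + _]] := key 9; rewrite /row_free => /eqP rk.
  by have := rank_leq_col (\matrix_i vec (f i)); rewrite rk.
elim: r => [|r [f [sf fr [k hk]]]].
  exists (fun=> 0); split=> [[]//||]; last by exists 0%N => la _ [].
  by rewrite /row_free -leqn0 rank_leq_row.
have [g [sg kg g0]] := hex k.
have [k' gk'] : exists k', ~ ord k' g.
  apply: contrapT => /forallNP h; move: g0; rewrite (@ord_eq0 F n g) ?eqxx // => d0.
  by have := h d0; rewrite notK.
have kk' : (k <= k')%N.
  by rewrite leqNgt; apply/negP => h; apply: gk'; apply: ord_le kg; exact: ltnW.
pose G (i : 'I_r.+1) := if unlift ord_max i is Some j then f j else g.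
exists G; have Gmax : G ord_max = g by rewrite /G unlift_none.
have Glift j : G (lift ord_max j) = f j by rewrite /G liftK.
have Gw (j : 'I_r) : G (widen_ord (leqnSn r) j) = f j.
  by rewrite -Glift; congr G; apply: val_inj; rewrite /= /bump leqNgt ltn_ord.
split.
- move=> i; case: (unliftP ord_max i) => [j|] ->.
    by rewrite Glift; exact: sf.
  by rewrite Gmax; exact: sg.
- apply: contrapT => nfr.
  have [c hc] : exists c, vec g = c *m (\matrix_i vec (f i)).
    apply/submxP; apply: contrapT => /negP nsub; apply: nfr.
    suff hz (w : 'rV_r.+1) : w *m (\matrix_i vec (G i)) = 0 -> w = 0.
      rewrite -kermx_eq0; apply/eqP/row_matrixP => i; rewrite row0; apply: hz.
      by apply/sub_kermxP; exact: row_sub.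
    move=> hw.
    have wE : w *m (\matrix_i vec (G i)) = w 0 ord_max *: vec g +
        (\row_i w 0 (widen_ord (leqnSn r) i)) *m (\matrix_i vec (f i)).
      rewrite !mulmx_sum_row big_ord_recr addrC /= rowK Gmax; congr (_ + _).
      by apply: eq_bigr => i _; rewrite !rowK Gw mxE.
    have wm : w 0 ord_max = 0.
      apply/eqP; apply: contraT => wm; case/negP: nsub; apply/submxP.
      exists (- (w 0 ord_max)^-1 *: (\row_i w 0 (widen_ord (leqnSn r) i))).
      rewrite -scalemxAl; move: hw; rewrite wE => /eqP; rewrite addrC addr_eq0 => /eqP ->.
      by rewrite scalerN scaleNr opprK scalerA mulVf // scale1r.
    have /rowP wr : \row_i w 0 (widen_ord (leqnSn r) i) = 0.
      apply: (row_free_inj fr); rewrite mul0mx -hw wE wm scale0r add0r //.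
    apply/rowP => i; rewrite [RHS]mxE; case: (unliftP ord_max i) => [j|] -> //.
    have := wr j; rewrite !mxE => <-; congr (w 0 _); apply: val_inj.
    by rewrite /= /bump leqNgt ltn_ord.
  have hconst := dvec_const hx hy hpq hpq' hab hga (natK0 1) (natK0 2)
    (f := fun i => tf (f i)) (g := tf g) (c := c)
    (fun i => ex_intro _ (f i) (conj erefl (sf i)))
    (ex_intro _ g (conj erefl sg)) fr hc.
  have hla i : exists la, c 0 i = tf (cst n la).
    by have [? ?] := hconst i; exact: const.
  pose la i := projT1 (cid (hla i)).
  have cE i : c 0 i = tf (cst n (la i)) by rewrite /la; case: cid.
  have gE : g = \sum_i cst n (la i) * f i.
    apply: (proj1 hK).
    have /rowP /(_ 0) := hc; rewrite !mxE /dbasis /= => ->.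
    rewrite raddf_sum; apply: eq_bigr => i _; rewrite !mxE cE /dbasis /=.
    by rewrite rmorphM.
  have la0 := hk la; rewrite -gE in la0.
  move: g0; rewrite gE big1 ?eqxx // => i _.
  by rewrite la0 // rmorph0 mul0r.
- exists k' => la; rewrite big_ord_recr /= Gmax.
  under eq_bigr do rewrite Gw.
  set S := \sum_(i < r) _ => hS.
  have S0 : forall i : 'I_r, la (widen_ord (leqnSn r) i) = 0.
    apply: hk; rewrite -/S -[S](addrK (cst n (la ord_max) * g)).
    by apply: ordB; [exact: ord_le kk' hS|exact: ordMl kg].
  have lam : la ord_max = 0.
    apply/eqP; apply: contraT => lm; exfalso; apply: gk'.
    have -> : g = cst n (la ord_max)^-1 * (S + cst n (la ord_max) * g).
      rewrite /S big1 => [|i _]; last by rewrite S0 rmorph0 mul0r.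
      by rewrite add0r mulrA -rmorphM mulVf // rmorph1 mul1r.
    exact: ordMl hS.
  move=> i; case: (unliftP ord_max i) => [j|] -> //.
  by rewrite -(S0 j); congr la; apply: val_inj; rewrite /= /bump leqNgt ltn_ord.
Qed.

End Symmetry.

Theorem symmetry_determined (F : numFieldType) (n : nat) (Q : B F n) :
  n = 3%N -> levi_det Q != 0 ->
  exists k0, forall f, symmetry Q f -> ord k0 f -> f = 0.
Proof.
move=> n3 D0; pose hK := fraction_fracfield (B F n).
have hder j : is_der (@der F n j) by split; [exact: derD|exact: derM].
exact: (symmetry_determined_frac n3 hK D0 (fun j => fder_der hK (hder j))
  (fun j => fder_tf hK (hder j))).
Qed.

(** * The logarithm of an automorphism tangent to the identity *)

Section BinomialPoly.
Variable F : numFieldType.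

(** The binomial coefficient 'C(X, j) as a polynomial in X. *)
Fixpoint bpoly (j : nat) : {poly F} :=
  if j is i.+1 then (i.+1%:R^-1) *: (bpoly i * ('X - i%:R%:P)) else 1.

Lemma bpoly_nat j n : (bpoly j).[n%:R] = 'C(n, j)%:R.
Proof.
elim: j => [|j IH]; first by rewrite hornerC bin0.
rewrite /= hornerZ hornerM hornerXsubC IH.
have j0 : (j.+1%:R : F) != 0 by rewrite pnatr_eq0.
apply: (mulfI j0); rewrite mulrA mulfV // mul1r -natrM mul_bin_left.
case: (leqP j n) => jn; first by rewrite natrM natrB // mulrC.
by rewrite bin_small // mul0r muln0.
Qed.

Lemma bpoly_coef0 j : (bpoly j)`_0 = (j == 0%N)%:R.
Proof.
case: j => [|j]; first by rewrite coef1.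
rewrite /= coefZ; elim: j => [|j IH]; first by rewrite mul1r subr0 coefX mulr0.
by rewrite coef0M /= coefZ IH mul0r mulr0.
Qed.

Lemma bpoly_coef1 : (bpoly 1)`_1 = 1.
Proof. by rewrite /= mul1r subr0 invr1 scale1r coefX. Qed.

Lemma poly_nat_eq0 (p : {poly F}) : (forall n : nat, p.[n%:R] = 0) -> p = 0.
Proof.
move=> h; apply/eqP; apply: contraT => p0.
pose rs : seq F := [seq i%:R | i <- iota 0 (size p)].
have : (size rs < size p)%N.
  apply: max_poly_roots => //; first by apply/allP => _ /mapP [i _ ->]; apply/rootP.
  by rewrite map_inj_uniq ?iota_uniq //; exact: mulrIn (oner_neq0 _).
by rewrite size_map size_iota ltnn.
Qed.
End BinomialPoly.

Section Log.
Variables (F : numFieldType) (n : nat) (g : nat -> B F n).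
Hypothesis hg : forall i, (i < n)%N -> ord 2 (g i - var F n i).
Local Notation B := (B F n).

Let gadm : adm n g.
Proof.
move=> i ni; rewrite -[g i](subrK (var F n i)).
by apply: ordD (ord_var _ _ _); apply: ord_le (hg ni).
Qed.

Local Notation h := (@sub F n g n).
Definition subd (f : B) : B := h f - f.
Local Notation N := subd.

Let hB f f' : h (f - f') = h f - h f'. Proof. exact: sub_zmod gadm _ _. Qed.
Let hD f f' : h (f + f') = h f + h f'. Proof. exact: (raddfD (subm gadm)). Qed.
Let hM f f' : h (f * f') = h f * h f'. Proof. exact: (rmorphM (subm gadm)). Qed.
Let hc c : h (cst n c) = cst n c. Proof. exact: sub_cst. Qed.

Lemma subd_zmod : zmod_morphism N.
Proof. by move=> f f'; rewrite /subd hB; ring. Qed.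
HB.instance Definition _ := GRing.isZmodMorphism.Build B B N subd_zmod.
Lemma subdZ c f : N (cst n c * f) = cst n c * N f.
Proof. by rewrite /subd hM hc mulrBr. Qed.
Lemma subd_ord e f : ord e f -> ord e.+1 (N f).
Proof.
by move=> ef; rewrite /subd -{2}[f]sub_id; apply: sub_tangent => //; exact: adm_var.
Qed.

Definition subdn j f := iter j N f.
Lemma subdn_ord j e f : ord e f -> ord (e + j) (subdn j f).
Proof.
by move=> ef; elim: j => [|j IH]; rewrite ?addn0 // addnS; exact: subd_ord.
Qed.
Lemma subdn_zmod j : zmod_morphism (subdn j).
Proof. by move=> f f'; elim: j => [|j IH] //=; rewrite IH raddfB. Qed.
HB.instance Definition _ j := GRing.isZmodMorphism.Build B B (subdn j) (subdn_zmod j).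

(** The binomial theorem for h ^ m = (1 + subd) ^ m; the terms from the
    D-th on have order at least D. *)
Lemma iter_subE D m f :
  ord D (iter m h f - \sum_(j < D) cst n 'C(m, j)%:R * subdn j f).
Proof.
elim: m => [|m IH].
  case: D => [|D]; first exact: ord_ge0.
  rewrite big_ord_recl bin0 rmorph1 mul1r big1 ?addr0 ?subrr => [|i _].
    exact: ordz.
  by rewrite bin0n rmorph0 mul0r.
set S := \sum_(j < D) cst n 'C(m, j)%:R * subdn j f in IH.
have NE : N S = \sum_(j < D) cst n 'C(m, j)%:R * subdn j.+1 f.
  by rewrite /S raddf_sum; apply: eq_bigr => j _; exact: subdZ.
have -> : \sum_(j < D) cst n 'C(m.+1, j)%:R * subdn j f =
    S + N S - (if D is D'.+1 then cst n 'C(m, D')%:R * subdn D f else 0).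
  rewrite NE /S; case: (D) => [|D']; first by rewrite !big_ord0 !addr0 subrr.
  rewrite [X in _ = _ + X - _]big_ord_recr /= addrA addrK.
  rewrite big_ord_recl [X in _ = X + _]big_ord_recl !bin0 -addrA -big_split /=.
  congr (_ + _); apply: eq_bigr => j _.
  by rewrite /bump /= add1n binS natrD rmorphD mulrDl.
have -> : iter m.+1 h f = iter m h f + N (iter m h f) by rewrite /subd /= addrC subrK.
have NS := subd_zmod (iter m h f) S.
move: (iter m h f) IH NS => w IH NS; set T := (X in S + N S - X).
have -> : w + N w - (S + N S - T) = (w - S) + N (w - S) + T by rewrite NS; ring.
apply: ordD; last first.
  rewrite /T; case: (D) => [|D']; first exact: ord_ge0.
  by apply: ordMl; exact: subdn_ord (ord_ge0 f).
by apply: ordD => //; apply: ord_le (subd_ord IH).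
Qed.

(** The logarithm of h: the coefficient of t in the binomial expansion of h
    ^ t = (1 + subd) ^ t. *)
Definition sublog (f : B) : B :=
  isum (fun j => cst n ((bpoly F j)`_1) * subdn j f).
Local Notation L := sublog.

Lemma sublogP f D : ord D (L f - \sum_(j < D) cst n ((bpoly F j)`_1) * subdn j f).
Proof. by apply: isumP => i; apply: ordMl; exact: subdn_ord (ord_ge0 f). Qed.

Lemma sublogD f f' : L (f + f') = L f + L f'.
Proof.
apply: ord_sep => D; pose S f := \sum_(j < D) cst n ((bpoly F j)`_1) * subdn j f.
have SD : S (f + f') = S f + S f'.
  by rewrite /S -big_split; apply: eq_bigr => j _; rewrite raddfD mulrDr.
have -> : L (f + f') - (L f + L f') =
   (L (f + f') - S (f + f')) - (L f - S f) - (L f' - S f') by rewrite SD; ring.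
by apply: ordB; first apply: ordB; exact: sublogP.
Qed.

Lemma subdnSr j f : subdn j.+1 f = subdn j (N f).
Proof. by rewrite /subdn iterSr. Qed.

Let ordMl' d (w w' : B) : w = 0 \/ ord d w' -> ord d (w * w').
Proof. by case=> [->|]; [rewrite mul0r; exact: ordz|exact: ordMl]. Qed.

Lemma sublog_ord e f : ord e (N f) -> ord e (L f).
Proof.
move=> ef; rewrite -[L f](subrK (\sum_(j < e) cst n ((bpoly F j)`_1) * subdn j f)).
apply: ordD; first exact: sublogP.
apply: ord_sum => i _; apply: ordMl'; case: (nat_of_ord i) => [|j].
  by left; rewrite coef1 rmorph0.
by right; rewrite subdnSr; apply: ord_le (subdn_ord j ef); exact: leq_addr.
Qed.

Lemma sublog_cst c : L (cst n c) = 0.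
Proof.
apply: ord_eq0 => e; apply: sublog_ord; rewrite /subd hc subrr; exact: ordz.
Qed.

(** L w is subd w up to terms of higher order. *)
Lemma sublog_eq0 f : L f = 0 -> N f = 0.
Proof.
move=> Lf; apply: ord_eq0; elim=> [|e IH]; first exact: ord_ge0.
have := sublogP f e.+2; rewrite Lf sub0r => /ordN; rewrite opprK.
rewrite big_ord_recl big_ord_recl /= coef1 rmorph0 mul0r add0r bpoly_coef1.
rewrite rmorph1 mul1r => h1.
rewrite -[N f](addrK (\sum_(i < e) cst n ((bpoly F (bump 0 (bump 0 i)))`_1) *
   subdn (bump 0 (bump 0 i)) f)).
apply: ordB; first exact: ord_le h1.
apply: ord_sum => j _; apply: ordMl.
change (ord e.+1 (subdn j.+2 f)); rewrite subdnSr.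
by apply: ord_le (subdn_ord j.+1 IH); rewrite addnS ltnS leq_addr.
Qed.

(** h ^ m is multiplicative for every natural number m. Coefficient by
    coefficient both sides of this identity are polynomials in m, so it
    holds for an indeterminate m, and its linear part is Leibniz' rule. *)
Lemma sublogM f f' : L (f * f') = L f * f' + f * L f'.
Proof.
apply/eqP; rewrite -subr_eq0; apply/eqP/ord_eq0 => d; apply/ord_cf => al _.
set D := (\sum_(i < n) al i).+1; pose phi := @cf F n al.
have phi0 w : ord D w -> phi w = 0 by move=> /ord_cf; apply.
have phiE w w' : ord D (w - w') -> phi w = phi w'.
  by move=> /phi0; rewrite /phi raddfB => /eqP; rewrite subr_eq0 => /eqP.
pose p := \sum_(j < D) phi (subdn j (f * f')) *: bpoly F j -
  \sum_(i < D) \sum_(l < D) phi (subdn i f * subdn l f') *: (bpoly F i * bpoly F l).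
have p0 : p = 0.
  apply: poly_nat_eq0 => m; rewrite /p hornerD hornerN.
  have -> : (\sum_(j < D) phi (subdn j (f * f')) *: bpoly F j).[m%:R] =
      phi (\sum_(j < D) cst n 'C(m, j)%:R * subdn j (f * f')).
    rewrite horner_sum /phi raddf_sum; apply: eq_bigr => j _.
    by rewrite hornerZ bpoly_nat [RHS]cf_cst mulrC.
  have -> : (\sum_(i < D) \sum_(l < D) phi (subdn i f * subdn l f') *:
       (bpoly F i * bpoly F l)).[m%:R] =
      phi ((\sum_(i < D) cst n 'C(m, i)%:R * subdn i f) *
           (\sum_(l < D) cst n 'C(m, l)%:R * subdn l f')).
    rewrite mulr_suml horner_sum /phi raddf_sum; apply: eq_bigr => i _.
    rewrite mulr_sumr horner_sum [RHS]raddf_sum; apply: eq_bigr => l _.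
    rewrite hornerZ hornerM !bpoly_nat.
    transitivity (cf al (cst n 'C(m, i)%:R * (cst n 'C(m, l)%:R * (subdn i f * subdn l f')))).
      by rewrite !cf_cst; ring.
    by congr (cf al _); ring.
  apply/eqP; rewrite subr_eq0; apply/eqP/phiE.
  have itM : iter m h (f * f') = iter m h f * iter m h f'.
    by elim: m => [|m IH] //=; rewrite IH hM.
  set S := \sum_(j < D) _; set S1 := \sum_(j < D) _; set S2 := \sum_(j < D) _.
  have -> : S - S1 * S2 = (iter m h f - S1) * iter m h f' + S1 * (iter m h f' - S2)
     - (iter m h (f * f') - S) by rewrite itM; ring.
  apply: ordB; last exact: iter_subE.
  by apply: ordD; [apply: ordMr|apply: ordMl]; exact: iter_subE.
have := congr1 (fun q : {poly F} => q`_1) p0; rewrite /p coefB coef0 => /eqP.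
pose lam j := (bpoly F j)`_1.
have S1 : (\sum_(j < D) phi (subdn j (f * f')) *: bpoly F j)`_1 = phi (L (f * f')).
  rewrite (phiE _ _ (sublogP _ D)) coef_sum /phi raddf_sum; apply: eq_bigr => j _.
  by rewrite coefZ [RHS]cf_cst mulrC.
have cM i l : (bpoly F i * bpoly F l)`_1 = (i == 0%N)%:R * lam l + lam i * (l == 0%N)%:R.
  by rewrite coefM big_ord_recl big_ord_recl big_ord0 addr0 /= !bpoly_coef0.
have S2 : (\sum_(i < D) \sum_(l < D) phi (subdn i f * subdn l f') *:
       (bpoly F i * bpoly F l))`_1 = phi (L f * f') + phi (f * L f').
  have -> : phi (L f * f') = phi ((\sum_(j < D) cst n (lam j) * subdn j f) * f').
    by apply: phiE; rewrite -mulrBl; apply: ordMr; exact: sublogP.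
  have -> : phi (f * L f') = phi (f * (\sum_(j < D) cst n (lam j) * subdn j f')).
    by apply: phiE; rewrite -mulrBr; apply: ordMl; exact: sublogP.
  rewrite mulr_suml mulr_sumr /phi !raddf_sum coef_sum addrC /=.
  transitivity (\sum_(i < D) (\sum_(l < D) phi (subdn i f * subdn l f') *
       ((i == 0%N :> nat)%:R * lam l) + \sum_(l < D) phi (subdn i f * subdn l f') *
       (lam i * (l == 0%N :> nat)%:R))).
    apply: eq_bigr => i _; rewrite coef_sum -big_split; apply: eq_bigr => l _.
    by rewrite coefZ cM mulrDr.
  rewrite big_split /=; congr (_ + _).
    rewrite big_ord_recl [X in _ + X]big1 ?addr0 => [|i _]; last first.
      by rewrite big1 // => l _; rewrite mul0r mulr0.
    apply: eq_bigr => l _; rewrite mul1r -[subdn ord0 f]/f mulrCA [RHS]cf_cst.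
    by rewrite mulrC.
  apply: eq_bigr => i _; rewrite big_ord_recl [X in _ + X]big1 ?addr0 => [|l _].
    by rewrite mulr1 -[subdn ord0 f']/f' -mulrA [RHS]cf_cst mulrC.
  by rewrite !mulr0.
by rewrite S1 S2 subr_eq0 => /eqP e; rewrite !raddfB /= raddfD /= -/phi e subrr.
Qed.

Lemma sublog_derivation : derivation L.
Proof. by split; [exact: sublogD|exact: sublogM|exact: sublog_cst]. Qed.

(** Every subdn j f lies in the kernel of D, and D is continuous for the
    filtration by order. *)
Lemma sublog_ker (D : B -> B) f : derivation D ->
  (forall d w, ord d w -> ord d.-1 (D w)) ->
  (forall w, D w = 0 -> D (h w) = 0) -> D f = 0 -> D (L f) = 0.
Proof.
move=> [DD DM Dc] Do Dh Df.
have D0 : D 0 = 0 by have := Dc 0; rewrite rmorph0.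
have DN w : D (- w) = - D w by apply/eqP; rewrite -addr_eq0 -DD addNr D0.
have DNn j : D (subdn j f) = 0.
  by elim: j => [|j IH] //=; rewrite /subd DD DN IH subr0; exact: Dh.
apply: ord_eq0 => e; set S := \sum_(j < e.+1) cst n ((bpoly F j)`_1) * subdn j f.
have -> : L f = (L f - S) + S by rewrite subrK.
have -> : D (L f - S + S) = D (L f - S).
  rewrite DD; have -> : D S = 0; last by rewrite addr0.
  rewrite /S; elim/big_ind: _ => // [x y hx hy|j _]; first by rewrite DD hx hy addr0.
  by rewrite DM Dc DNn mul0r mulr0 addr0.
exact: (Do e.+1) (sublogP _ _).
Qed.

End Log.

(** * Rigidity of formal automorphisms *)

Section Rigidity.
Variables (F : numFieldType) (n : nat).
Hypothesis n3 : n = 3%N.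
Local Notation B3 := (B F n).
Variable Q : B3.
Hypothesis Q1 : ord 1 Q.
Hypothesis Qtau : cf (fun=> 0%N) (der 2 Q) != 0.
Hypothesis Delta0 : levi_det Q != 0.

Definition pair (a b : B3) (i : nat) : B3 := if i == 0%N then a else b.
(** Restriction of functions of z, w to the graph w = Q. *)
Definition gZ := pair (var F n 0) Q.
(** Functions of zbar, wbar. *)
Definition gC := pair (var F n 1) (var F n 2).
(** The action on functions of z, zbar, wbar of a map whose first component
    is f and whose conjugate has components fc, gc. *)
Definition gH (f fc gc : B F 2) (i : nat) : B3 :=
  if i == 0%N then sub gZ f else if i == 1%N then sub gC fc else sub gC gc.

Let lt0 : (0 < n)%N. Proof. by rewrite n3. Qed.
Let lt1 : (1 < n)%N. Proof. by rewrite n3. Qed.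
Let lt2 : (2 < n)%N. Proof. by rewrite n3. Qed.
Let ltP (P : nat -> Prop) : P 0%N -> P 1%N -> P 2%N ->
  forall i, (i < n)%N -> P i.
Proof. by rewrite n3 => ? ? ? [|[|[|]]]. Qed.
Let sum3 (V : nmodType) (G : nat -> V) : \sum_(i < n) G i = G 0%N + G 1%N + G 2%N.
Proof. by rewrite n3 !big_ord_recr big_ord0 /= add0r. Qed.

Lemma gZ_adm : adm 2 gZ.
Proof. by move=> i _; rewrite /gZ /pair; case: eqP => _ //; exact: ord_var. Qed.
Lemma gC_adm : adm 2 gC.
Proof. by move=> i _; rewrite /gC /pair; case: eqP => _; exact: ord_var. Qed.

Lemma segre_derivation : derivation (segre_der Q).
Proof.
split=> [f g|f g|c]; rewrite /segre_der.
- by rewrite !derD; ring.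
- by rewrite !derM; ring.
- by rewrite !der_cst !mulr0 subrr.
Qed.

(** Let h be the substitution gH, tangent to the identity. It preserves the
    kernel of der 0, which contains the functions of zbar, wbar, and,
    because of the relation for Q, the kernel of segre_der Q, which
    contains the functions of z, w on the graph. Its logarithm L does so
    too. Hence the series Q_zbar (L zbar) + Q_wbar (L wbar) = L Q - Q_z (L
    z) solves the equations of symmetry_determined, and it vanishes if h is
    tangent to the identity to high order. As levi_det Q is not zero, this
    series and its derivative der 0 determine L zbar and L wbar, which
    vanish; so h fixes zbar and wbar. *)
Theorem formal_rigidity : exists k, forall f g fc gc : B F 2,
  ord k (f - var F 2 0) -> ord k (fc - var F 2 0) -> ord k (gc - var F 2 1) ->
  sub (gH f fc gc) Q = sub gZ g ->
  sub gC fc = var F n 1 /\ sub gC gc = var F n 2.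
Proof.
have [k0 hk0] := symmetry_determined n3 Delta0.
exists k0.+2 => f g fc gc hf hfc hgc inv.
have hdiff : forall i, (i < n)%N -> ord k0.+2 (gH f fc gc i - var F n i).
  apply: ltP.
  - by have := sub_ord gZ_adm hf; rewrite (sub_zmod gZ_adm) (sub_var gZ_adm).
  - by have := sub_ord gC_adm hfc; rewrite (sub_zmod gC_adm) (sub_var gC_adm).
  - by have := sub_ord gC_adm hgc; rewrite (sub_zmod gC_adm) (sub_var gC_adm).
have h2 : forall i, (i < n)%N -> ord 2 (gH f fc gc i - var F n i).
  by move=> i i3; apply: ord_le (hdiff i i3).
have [G [GE G0 G1 G2]] : exists G, [/\ G = gH f fc gc, G 0 = sub gZ f,
    G 1 = sub gC fc & G 2 = sub gC gc].
  exact: (ex_intro _ (gH f fc gc) (And4 erefl erefl erefl erefl)).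
rewrite -GE in hdiff h2 inv; clear GE.
have Gadm : adm n G.
  move=> i i3; rewrite -[G i](subrK (var F n i)).
  by apply: ordD (ord_var _ _ _); apply: ord_le (h2 _ i3).
set u := der 1 Q; set v := der 2 Q.
have dsum (D : B3 -> B3) (w : B3) : derivation D ->
    D (sub G w) = sub G (der 0 w) * D (G 0) + sub G (der 1 w) * D (G 1) + sub G (der 2 w) * D (G 2).
  by move=> hD; rewrite (chain _ Gadm hD) (sum3 (fun i => sub G (der i w) * D (G i))).
have dsum2 (D : B3 -> B3) a b (w : B F 2) : derivation D -> adm 2 (pair a b) -> D a = 0 -> D b = 0 ->
    D (sub (pair a b) w) = 0.
  move=> hD hab Da Db.
  have E := chain w hab hD.
  apply: (etrans E).
  apply: big1 => i _.
  have -> : D (pair a b i) = 0.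
    by rewrite /pair; case: (nat_of_ord i == 0%N).
  exact: mulr0.
have E1 : segre_der Q (var F n 0) = 0.
  by rewrite /segre_der !der_var //= !mulr0 subrr.
have EQ : segre_der Q Q = 0 by rewrite /segre_der mulrC subrr.
have dG0 : segre_der Q (G 0) = 0.
  by rewrite G0; exact: dsum2 segre_derivation gZ_adm E1 EQ.
have dC1 : der 0 (var F n 1) = 0 :> B3 by rewrite der_var.
have dC2 : der 0 (var F n 2) = 0 :> B3 by rewrite der_var.
have dG1 : der 0 (G 1) = 0.
  by rewrite G1; exact: dsum2 (@der_derivation F n 0) gC_adm dC1 dC2.
have dG2 : der 0 (G 2) = 0.
  by rewrite G2; exact: dsum2 (@der_derivation F n 0) gC_adm dC1 dC2.
have h0 : sub G (0 : B3) = 0 by exact: (raddf0 (subm Gadm)).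
have kerz (w : B3) : der 0 w = 0 -> der 0 (sub G w) = 0.
  move=> w0; rewrite dsum; last exact: der_derivation.
  by rewrite w0 h0 dG1 dG2 !mulr0 mul0r !addr0.
have hv0 : sub G v != 0.
  apply: contra_neq Qtau => hv.
  have := subd_ord h2 (ord_ge0 v); rewrite /subd hv sub0r => /ordN; rewrite opprK.
  by move=> /ord_cf; apply; rewrite big1.
(* The relation says that h Q is annihilated by segre_der Q, which fixes
   the ratio of the derivatives of G 1 and G 2 along segre_der Q. *)
have kerE (w : B3) : segre_der Q w = 0 -> segre_der Q (sub G w) = 0.
  move=> w0; apply: (mulfI hv0); rewrite mulr0 dsum; last exact: segre_derivation.
  have eQ : sub G u * segre_der Q (G 1) + sub G v * segre_der Q (G 2) = 0.
    have := dsum _ Q segre_derivation; rewrite dG0 mulr0 add0r => <-.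
    by rewrite inv; exact: dsum2 segre_derivation gZ_adm E1 EQ.
  have ew : sub G v * sub G (der 1 w) - sub G u * sub G (der 2 w) = 0.
    have := congr1 (@sub F n G n) w0; rewrite h0 /segre_der => <-.
    have sB := raddfB (subm Gadm); have sM := rmorphM (subm Gadm).
    by rewrite /= in sB sM; rewrite sB !sM.
  rewrite dG0 mulr0 add0r mulrDr.
  have -> : sub G v * (sub G (der 2 w) * segre_der Q (G 2)) =
     sub G (der 2 w) * (0 - sub G u * segre_der Q (G 1)) by rewrite -eQ; ring.
  transitivity ((sub G v * sub G (der 1 w) - sub G u * sub G (der 2 w)) * segre_der Q (G 1)).
    by ring.
  by rewrite ew mul0r.
have segre_ord d w : ord d w -> ord d.-1 (segre_der Q w).
  by move=> hw; apply: ordB; apply: ordMl; exact: der_ord.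
pose L := sublog G; have hL : derivation L := sublog_derivation h2.
have L3 w : L w = der 0 w * L (var F n 0) + der 1 w * L (var F n 1) + der 2 w * L (var F n 2).
  have := chain w (@adm_var F n) hL; rewrite sub_id => ->.
  rewrite (sum3 (fun i => sub (var F n) (der i w) * L (var F n i))).
  by rewrite !sub_id.
set a := L (var F n 0) in L3; set c := L (var F n 1) in L3; set d := L (var F n 2) in L3.
have c0 : der 0 c = 0.
  by apply: (sublog_ker h2) => //; [exact: der_derivation|exact: der_ord].
have d0 : der 0 d = 0.
  by apply: (sublog_ker h2) => //; [exact: der_derivation|exact: der_ord].
have a0 : segre_der Q a = 0 by apply: (sublog_ker h2) => //; exact: segre_derivation.
have b0 : segre_der Q (L Q) = 0 by apply: (sublog_ker h2) => //; exact: segre_derivation.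
pose w := u * c + v * d.
have wz : der 0 w = der 0 u * c + der 0 v * d.
  by rewrite /w derD !derM c0 d0 !mulr0 !addr0.
have wzz : der 0 (der 0 w) = der 0 (der 0 u) * c + der 0 (der 0 v) * d.
  by rewrite wz derD !derM c0 d0 !mulr0 !addr0.
have [ED EM _] := segre_derivation.
have EN z : segre_der Q (- z) = - segre_der Q z by rewrite /segre_der !raddfN; ring.
have Ew : segre_der Q w = levi_det Q * a.
  have -> : w = L Q - der 0 Q * a by rewrite L3 /w; ring.
  rewrite ED EN EM a0 b0 mulr0 addr0 add0r.
  rewrite /segre_der /levi_det !(derC _ 0) -/u -/v; ring.
have sw : symmetry Q w.
  split; first by rewrite wzz wz /w /levi_det -/u -/v; ring.
  by rewrite Ew EM a0 mulr0 addr0; ring.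
have oL i : (i < n)%N -> ord k0.+2 (L (var F n i)).
  by move=> i3; apply: (sublog_ord h2); rewrite /subd sub_var //; exact: hdiff.
have w0 : w = 0.
  apply: hk0 => //; apply: (@ord_le _ _ k0.+2); first by rewrite leqW.
  by apply: ordD; apply: ordMl; exact: oL.
have wz0 : der 0 w = 0 by rewrite w0 raddf0.
have c00 : c = 0.
  apply: (mulfI Delta0); rewrite mulr0.
  have -> : levi_det Q * c = der 0 v * w - v * der 0 w by rewrite wz /w /levi_det -/u -/v; ring.
  by rewrite wz0 w0 !mulr0 subrr.
have d00 : d = 0.
  apply: (mulfI Delta0); rewrite mulr0.
  have -> : levi_det Q * d = u * der 0 w - der 0 u * w by rewrite wz /w /levi_det -/u -/v; ring.
  by rewrite wz0 w0 !mulr0 subrr.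
split.
  have := sublog_eq0 h2 c00; rewrite /subd sub_var // => /eqP.
  by rewrite subr_eq0 G1 => /eqP.
have := sublog_eq0 h2 d00; rewrite /subd sub_var // => /eqP.
by rewrite subr_eq0 G2 => /eqP.
Qed.

End Rigidity.

(** * Convergent power series *)

Section Modulus.
Variable R : realType.
Local Notation C := (Cplx R).

Definition nm (z : C) : R := Normc.normc (z : R[i]).

Lemma nm0 : nm 0 = 0. Proof. exact: Normc.normc0. Qed.
Lemma nm1 : nm 1 = 1. Proof. exact: Normc.normc1. Qed.
Lemma nmM x y : nm (x * y) = nm x * nm y. Proof. exact: Normc.normcM. Qed.
Lemma nmN x : nm (- x) = nm x. Proof. exact: normcN. Qed.
Lemma nmD x y : nm (x + y) <= nm x + nm y. Proof. exact: le_normcD. Qed.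
Lemma nmB x y : nm (x - y) <= nm x + nm y.
Proof. by rewrite -(nmN y); exact: nmD. Qed.
Lemma nmC x y : nm (x - y) = nm (y - x). Proof. by rewrite -nmN opprB. Qed.
Lemma nm_ge0 x : 0 <= nm x.
Proof. by case: x => a b; exact: sqrtr_ge0. Qed.
Lemma nm_eq0 x : nm x = 0 -> x = 0. Proof. exact: Normc.eq0_normc. Qed.
Lemma nm_gt0 x : (0 < nm x) = (x != 0).
Proof.
rewrite lt_neqAle nm_ge0 andbT; congr negb; apply/eqP/eqP => [e|->].
  exact: nm_eq0.
by rewrite nm0.
Qed.
Lemma nmX x k : nm (x ^+ k) = nm x ^+ k.
Proof. by elim: k => [|k IH]; rewrite ?expr0 ?nm1 // !exprS nmM IH. Qed.
Lemma nmV x : nm x^-1 = (nm x)^-1. Proof. exact: Normc.normcV. Qed.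
Lemma nm_sum (I : Type) (r : seq I) (P : pred I) (G : I -> C) :
  nm (\sum_(i <- r | P i) G i) <= \sum_(i <- r | P i) nm (G i).
Proof.
elim/big_rec2: _ => [|i y1 y2 _ h]; first by rewrite nm0.
by apply: le_trans (nmD _ _) _; rewrite lerD2l.
Qed.
Lemma nm_tri x y z : nm (x - z) <= nm (x - y) + nm (y - z).
Proof. by rewrite -[x - z](subrKA y); exact: nmD. Qed.
Lemma nm_Re x : `|complex.Re x| <= nm x.
Proof.
case: x => a b; rewrite /nm /= -sqrtr_sqr ler_sqrt ?lerDl ?sqr_ge0 //.
by rewrite addr_ge0 ?sqr_ge0.
Qed.
Lemma nm_Im x : `|complex.Im x| <= nm x.
Proof.
case: x => a b; rewrite /nm /= -sqrtr_sqr ler_sqrt ?lerDr ?sqr_ge0 //.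
by rewrite addr_ge0 ?sqr_ge0.
Qed.
Lemma nm_real (a : R) : nm (a%:C)%C = `|a|.
Proof. by rewrite /nm /= expr0n /= addr0 sqrtr_sqr. Qed.
Lemma nm_le_ReIm x : nm x <= `|complex.Re x| + `|complex.Im x|.
Proof.
have E : x = (complex.Re x)%:C%C + imag R * (complex.Im x)%:C%C :> C.
  by rewrite [LHS]complexE.
have hI : nm (imag R) = 1 by rewrite /nm /= expr0n /= add0r expr1n sqrtr1.
by rewrite {1}E; apply: le_trans (nmD _ _) _; rewrite nmM !nm_real hI mul1r.
Qed.
Lemma nm_conj (x : C) : nm (conjc x) = nm x.
Proof. by case: x => a b; rewrite /nm /= sqrrN. Qed.
Lemma nm_small0 x : (forall e, 0 < e -> nm x <= e) -> x = 0.
Proof.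
move=> h; apply: nm_eq0; apply/eqP; rewrite eq_le nm_ge0 andbT.
by apply/ler_addgt0Pr => e e0; rewrite add0r; exact: h.
Qed.

Lemma mono_lim (a : nat -> R) c : (forall i j, (i <= j)%N -> a i <= a j) ->
  (forall i, a i <= c) -> exists l, [/\ l <= c, forall i, a i <= l &
    forall e, 0 < e -> exists N, l - e < a N].
Proof.
move=> hm hc; pose A : set R := [set a i | i in setT]%classic.
have hs : has_sup A.
  by split; [exists (a 0%N); exists 0%N|exists c => _ [i _ <-]].
exists (sup A); split.
- by apply: ge_sup => [|_ [i _ <-]]; [exists (a 0%N); exists 0%N|exact: hc].
- by move=> i; apply: ub_le_sup; [exact: (proj2 hs)|exists i].
- by move=> e e0; have [_ [i _ <-] h] := sup_adherent e0 hs; exists i.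
Qed.

End Modulus.

(** The Cauchy product of truncated series consists of the pairs with i + j
    < N. *)
Lemma triangle (K : comNzRingType) (N : nat) (a b : nat -> K) (t : K) :
  \sum_(k < N) (\sum_(i < k.+1) a i * b (k - i)%N) * t ^+ k =
  \sum_(i < N) \sum_(j < N | (i + j < N)%N) a i * t ^+ i * (b j * t ^+ j).
Proof.
transitivity (\sum_(k < N) \sum_(i < N | (i <= k)%N) a i * t ^+ i * (b (k - i)%N * t ^+ (k - i)%N)).
  apply: eq_bigr => k _; rewrite mulr_suml.
  rewrite (big_ord_widen_cond N xpredT (fun i => a i * b (k - i)%N * t ^+ k)) //.
  apply: eq_bigr => i ik.
  have -> : t ^+ k = t ^+ i * t ^+ (k - i)%N by rewrite -exprD subnKC.
  ring.
rewrite (exchange_big_dep xpredT) //=; apply: eq_bigr => i _.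
rewrite -(big_mkord (fun k => i <= k)%N (fun k => a i * t ^+ i * (b (k - i)%N * t ^+ (k - i)%N))).
rewrite -(big_mkord (fun j => i + j < N)%N (fun j => a i * t ^+ i * (b j * t ^+ j))).
rewrite (big_cat_nat (n := i)) //=; last exact: ltnW.
rewrite big_nat_cond big1 ?add0r; last by move=> k /andP [/andP [_ ki] ik]; lia.
rewrite big_nat_cond [RHS](big_cat_nat (n := (N - i)%N)) //=; last exact: leq_subr.
rewrite [X in _ = _ + X]big_nat_cond [X in _ = _ + X]big1 ?addr0; last first.
  by move=> k /andP [/andP [ki _] ik]; lia.
rewrite -{1}[nat_of_ord i]add0n big_addn [RHS]big_nat_cond.
apply: eq_big => k; first by apply/idP/idP; lia.
by rewrite addnK.
Qed.

Section Conv.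
Variable R : realType.
Local Notation C := (Cplx R).
Local Notation B := (B C).

(** Finite parts of the weighted l^1 norm: monomials with all exponents
    below N, weighted by the radii s. *)
Fixpoint box n (N : nat) (s : nat -> R) : B n -> R :=
  if n is m.+1 then fun f => \sum_(i < N) @box m N s (f i) * s m ^+ i
  else fun c => nm c.

Section Box.
Variable s : nat -> R.
Hypothesis s0 : forall i, 0 <= s i.

Lemma boxS n N (f : B n.+1) : box N s f = \sum_(i < N) box N s (f i) * s n ^+ i.
Proof. by []. Qed.
Let sX n k : 0 <= s n ^+ k. Proof. exact: exprn_ge0. Qed.

Lemma box_ge0 n N (f : B n) : 0 <= box N s f.
Proof.
elim: n f => [|n IH] f; first exact: nm_ge0.
by rewrite boxS; apply: sumr_ge0 => i _; exact: mulr_ge0.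
Qed.
Lemma box0 n N : box N s (0 : B n) = 0.
Proof.
elim: n => [|n IH]; first exact: nm0.
by rewrite boxS big1 // => i _; rewrite IH mul0r.
Qed.
Lemma boxD n N (f g : B n) : box N s (f + g) <= box N s f + box N s g.
Proof.
elim: n f g => [|n IH] f g; first exact: nmD.
rewrite !boxS -big_split; apply: ler_sum => i _ /=.
by rewrite -mulrDl ler_wpM2r // IH.
Qed.
Lemma boxN n N (f : B n) : box N s (- f) = box N s f.
Proof.
elim: n f => [|n IH] f; first exact: nmN.
by rewrite !boxS; apply: eq_bigr => i _; rewrite IH.
Qed.
Lemma box_sum n N (I : Type) (r : seq I) (P : pred I) (G : I -> B n) :
  box N s (\sum_(i <- r | P i) G i) <= \sum_(i <- r | P i) box N s (G i).
Proof.
elim/big_rec2: _ => [|i y1 y2 _ h]; first by rewrite box0.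
by apply: le_trans (boxD _ _ _) _; rewrite lerD2l.
Qed.

Lemma boxM n N (f g : B n) : box N s (f * g) <= box N s f * box N s g.
Proof.
elim: n f g => [|n IH] f g; first by rewrite [box _ _ _]nmM.
rewrite boxS; apply: (@le_trans _ _ (\sum_(k < N)
    (\sum_(i < k.+1) box N s (f i) * box N s (g (k - i)%N)) * s n ^+ k)).
  apply: ler_sum => k _; apply: ler_wpM2r => //; rewrite psM.
  by apply: le_trans (box_sum _ _ _ _) _; apply: ler_sum => i _; exact: IH.
rewrite (triangle N (fun i => box N s (f i)) (fun j => box N s (g j))) !boxS.
rewrite mulr_suml; apply: ler_sum => i _.
rewrite mulr_sumr big_mkcond; apply: ler_sum => j _; case: ifP => // _.
by rewrite !mulr_ge0 ?box_ge0.
Qed.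

Lemma box_mono n N N' (f : B n) : (N <= N')%N -> box N s f <= box N' s f.
Proof.
move=> NN; elim: n f => [|n IH] f //; rewrite !boxS.
rewrite (big_ord_widen _ (fun i => box N s (f i) * s n ^+ i) NN) big_mkcond.
apply: ler_sum => i _; case: ifP => _; first by rewrite ler_wpM2r.
by rewrite mulr_ge0 ?box_ge0.
Qed.

Lemma box_cst n N c : box N s (cst n c) <= nm c.
Proof.
elim: n => [|n IH] //; rewrite boxS cstS; case: N IH => [|N] IH.
  by rewrite big_ord0 nm_ge0.
rewrite big_ord_recl big1 ?addr0 ?expr0 ?mulr1 // => i _.
by rewrite psCE /= box0 mul0r.
Qed.

Lemma box_var n N i : box N s (var C n i) <= s i.
Proof.
elim: n => [|n IH]; first by rewrite [box _ _ _]nm0.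
rewrite boxS varS; case: (i =P n) => [->|_].
  have z (k : 'I_N) : k != 1%N :> nat -> box N s (psX (B n) k) * s n ^+ k = 0.
    by rewrite /psX => /negbTE ->; rewrite box0 mul0r.
  case: (ltnP 1 N) => hN; last first.
    by rewrite big1 // => k _; apply: z; have := ltn_ord k; lia.
  rewrite (bigD1 (Ordinal hN)) //= big1 ?addr0 => [|k k1]; last exact: z.
  rewrite expr1 -[leRHS]mul1r ler_wpM2r // /psX /=.
  by rewrite -(rmorph1 (cst n)) (le_trans (box_cst _ _ _)) ?nm1.
case: N IH => [|N] IH; first by rewrite big_ord0.
rewrite big_ord_recl big1 ?addr0 ?expr0 ?mulr1 // => k _.
by rewrite psCE /= box0 mul0r.
Qed.

(** A monomial with all exponents below N has degree at most n * N. *)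
Lemma box_loc n N d (f : B n) : (n * N < d)%N -> ord d f -> box N s f = 0.
Proof.
elim: n d f => [|n IH] d f dn h.
  by rewrite [box _ _ _](_ : _ = nm f) // (h _) ?nm0.
rewrite boxS big1 // => i _; have -> : box N s (f i) = 0; last by rewrite mul0r.
apply: (IH (d - i)%N); last exact: (h i).
by have := ltn_ord i; move: dn; rewrite mulSn; lia.
Qed.

Lemma boxX n N (f : B n) k : box N s (f ^+ k) <= box N s f ^+ k.
Proof.
elim: k => [|k IH].
  by rewrite !expr0 -(rmorph1 (cst n)) (le_trans (box_cst _ _ _)) ?nm1.
by rewrite !exprS; apply: le_trans (boxM _ _ _) _; rewrite ler_wpM2l ?box_ge0.
Qed.

End Box.

Lemma box_radii n N (s s' : nat -> R) (f : B n) : (forall i, 0 <= s i) ->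
  (forall i, s i <= s' i) -> box N s f <= box N s' f.
Proof.
move=> s0 ss; elim: n f => [|n IH] f //; rewrite !boxS; apply: ler_sum => i _.
by apply: ler_pM; rewrite ?box_ge0 ?exprn_ge0 // lerXn2r ?nnegrE // (le_trans (s0 n)).
Qed.

(** By box_loc the infinite sum defining a substitution may be cut at D
    without changing the norm on the left. *)
Lemma box_sub n m N (s s' : nat -> R) (g : nat -> B m) (f : B n) :
  (forall i, 0 <= s i) -> (forall i, 0 <= s' i) ->
  adm n g -> (forall i, (i < n)%N -> box N s' (g i) <= s i) ->
  forall D, (m * N < D)%N -> box N s' (sub g f) <= box D s f.
Proof.
move=> s0 s'0 + + D hD; elim: n f => [|n IH] f hg hb; first exact: box_cst.
rewrite -[sub g f](subrK (\sum_(i < D) sub g (f i) * g n ^+ i)).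
apply: le_trans (boxD s'0 _ _ _) _; rewrite (box_loc _ hD (sub_approx _ _ hg)) add0r.
rewrite boxS; apply: le_trans (box_sum s'0 _ _ _ _) _.
apply: ler_sum => i _; apply: le_trans (boxM s'0 _ _ _) _.
apply: ler_pM; rewrite ?box_ge0 //.
  by apply: IH => [|j jn]; [exact: admS|apply: hb; exact: ltnW].
apply: le_trans (boxX s'0 _ _ _) _.
by rewrite lerXn2r ?nnegrE ?box_ge0 // hb.
Qed.

(** Halving the radii absorbs the factor k.+1 <= 2 ^ k of differentiation. *)
Lemma box_der n N (s : nat -> R) i (f : B n) : (forall i, 0 < s i) ->
  box N (fun j => s j / 2) (der i f) <= (s i)^-1 * box N.+1 s f.
Proof.
move=> s0; have s0' j : 0 <= s j by exact: ltW.
have h0 j : 0 <= s j / 2 by rewrite divr_ge0.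
have hs j : s j / 2 <= s j by have := s0 j; lra.
elim: n f => [|n IH] f.
  by rewrite [der _ _](_ : _ = 0) // box0 // mulr_ge0 ?invr_ge0 ?box_ge0.
rewrite !boxS derS; case: (i =P n) => [->|_].
  rewrite big_ord_recl mulrDr (le_trans _ (ler_wpDl _ (lexx _))) //; last first.
    by rewrite !mulr_ge0 ?invr_ge0 ?box_ge0 // exprn_ge0.
  rewrite mulr_sumr; apply: ler_sum => k _; rewrite /psder.
  have p2 : (k.+1%:R : R) <= 2 ^+ k.
    elim: (nat_of_ord k) => [|j IHj]; first by rewrite expr0.
    rewrite exprS mulr_natl mulr2n -[j.+2]addn1 natrD lerD //.
    by apply: exprn_ege1; rewrite ler1n.
  have bk : box N (fun j => s j / 2) (f k.+1 *+ k.+1) <= k.+1%:R * box N.+1 s (f k.+1).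
    apply: (@le_trans _ _ (k.+1%:R * box N (fun j => s j / 2) (f k.+1))).
      move: (f k.+1) => w; elim: k.+1 => [|j IHj]; first by rewrite mulr0n mul0r box0.
      rewrite [w *+ _]mulrSr; apply: le_trans (boxD h0 _ _ _) _.
      by rewrite -[j.+1%:R]natr1 mulrDl mul1r lerD2r.
    rewrite ler_wpM2l // (le_trans (box_radii _ _ h0 hs)) //.
    exact: box_mono.
  apply: (@le_trans _ _ (k.+1%:R * box N.+1 s (f k.+1) * (s n / 2) ^+ k)).
    by rewrite ler_wpM2r // exprn_ge0.
  have -> : (s n)^-1 * (box N.+1 s (f (lift ord0 k)) * s n ^+ lift ord0 k) =
      box N.+1 s (f k.+1) * s n ^+ k.
    rewrite [lift ord0 k : nat]/= /bump /= add1n exprS; field; exact: lt0r_neq0.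
  rewrite mulrAC mulrC ler_wpM2l ?box_ge0 // expr_div_n.
  have p0 : 0 < 2 ^+ k :> R by exact: exprn_gt0.
  by rewrite mulrCA ler_piMr ?exprn_ge0 // ler_pdivrMr // mul1r.
rewrite big_ord_recr mulrDr (le_trans _ (ler_wpDr _ (lexx _))) //; last first.
  by rewrite !mulr_ge0 ?invr_ge0 ?box_ge0 // exprn_ge0.
rewrite mulr_sumr; apply: ler_sum => k _; rewrite mulrA.
by apply: ler_pM; rewrite ?box_ge0 ?exprn_ge0 // lerXn2r ?nnegrE.
Qed.

End Conv.

(** * Evaluation of convergent power series *)

Lemma sum_trunc (V : nmodType) (G : nat -> V) N N' : (N <= N')%N ->
  \sum_(i < N) G i = \sum_(i < N') if (i < N)%N then G i else 0.
Proof. by move=> NN; rewrite (big_ord_widen _ G NN) big_mkcond. Qed.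

Lemma Re_lip (R : realType) (a b : Cplx R) :
  `|complex.Re a - complex.Re b| <= nm (a - b).
Proof. by have := nm_Re (a - b); case: a b => [? ?] [? ?]. Qed.
Lemma Im_lip (R : realType) (a b : Cplx R) :
  `|complex.Im a - complex.Im b| <= nm (a - b).
Proof. by have := nm_Im (a - b); case: a b => [? ?] [? ?]. Qed.

Lemma large4 a b c d : exists N, [/\ a <= N, b <= N, c <= N & d <= N]%N.
Proof. by exists (a + b + c + d)%N; split; lia. Qed.

Section Eval.
Variable R : realType.
Local Notation C := (Cplx R).
Local Notation B := (B C).

Fixpoint evN n (N : nat) (x : nat -> C) : B n -> C :=
  if n is m.+1 then fun f => \sum_(i < N) @evN m N x (f i) * x m ^+ i
  else fun c => c.

Lemma evNS n N x (f : B n.+1) : evN N x f = \sum_(i < N) evN N x (f i) * x n ^+ i.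
Proof. by []. Qed.

Definition dom n (s : nat -> R) (x : nat -> C) := forall i, (i < n)%N -> nm (x i) <= s i.

Lemma domS n s x : dom n.+1 s x -> dom n s x.
Proof. by move=> h i ni; apply: h; exact: ltnW. Qed.

Lemma evN_zmod n N x : zmod_morphism (@evN n N x).
Proof.
elim: n => [|n IH] f g //; rewrite !evNS -sumrB; apply: eq_bigr => i _.
by rewrite psB IH mulrBl.
Qed.
HB.instance Definition _ n N x := GRing.isZmodMorphism.Build (B n) C (@evN n N x)
  (@evN_zmod n N x).

Lemma evN_cst n N x c : evN N.+1 x (cst n c) = c.
Proof.
elim: n => [|n IH] //; rewrite evNS cstS big_ord_recl big1 => [|i _].
  by rewrite addr0 expr0 mulr1 psCE /= IH.
by rewrite psCE /= raddf0 mul0r.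
Qed.

Lemma evN_var n N x i : (i < n)%N -> evN N.+2 x (var C n i) = x i.
Proof.
elim: n => [|n IH] //; rewrite ltnS evNS varS => il.
case: (i =P n) => [->|/eqP ni].
  rewrite (bigD1 (Ordinal (isT : 1 < N.+2)%N)) //= /psX /= big1 ?addr0.
    by rewrite -(rmorph1 (cst n)) evN_cst mul1r expr1.
  move=> k /eqP k1; case: eqP => [e|_]; last by rewrite raddf0 mul0r.
  by case: k1; apply: val_inj.
have hi : (i < n)%N by rewrite ltn_neqAle ni.
rewrite big_ord_recl big1 => [|k _]; last by rewrite psCE /= raddf0 mul0r.
by rewrite addr0 expr0 mulr1 psCE /= IH.
Qed.

Section Radii.
Variables (s : nat -> R) (x : nat -> C).
Hypothesis s0 : forall i, 0 <= s i.

Lemma powX_le n k : nm (x n) <= s n -> nm (x n ^+ k) <= s n ^+ k.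
Proof. by move=> h; rewrite nmX lerXn2r ?nnegrE ?nm_ge0. Qed.

Lemma evN_le n N (f : B n) : dom n s x -> nm (evN N x f) <= box N s f.
Proof.
elim: n f => [|n IH] f hx //; rewrite evNS boxS.
apply: le_trans (nm_sum _ _ _) _; apply: ler_sum => i _; rewrite nmM.
apply: ler_pM; rewrite ?nm_ge0 //; first by apply: IH; exact: domS.
by apply: powX_le; exact: hx.
Qed.

(** Domination by the norm makes the partial sums a Cauchy sequence. *)
Lemma evN_diff n N N' (f : B n) : dom n s x -> (N <= N')%N ->
  nm (evN N' x f - evN N x f) <= box N' s f - box N s f.
Proof.
move=> + NN; elim: n f => [|n IH] f hx; first by rewrite /= !subrr nm0.
rewrite !evNS !boxS (sum_trunc (fun i => evN N x (f i) * x n ^+ i) NN).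
rewrite (sum_trunc (fun i => box N s (f i) * s n ^+ i) NN) -!sumrB.
apply: le_trans (nm_sum _ _ _) _; apply: ler_sum => i _.
have px : nm (x n ^+ i) <= s n ^+ i by apply: powX_le; exact: hx.
case: ifP => _; last first.
  rewrite !subr0 nmM; apply: ler_pM; rewrite ?nm_ge0 //.
  by apply: evN_le; exact: domS.
rewrite -!mulrBl nmM; apply: ler_pM; rewrite ?nm_ge0 //.
by apply: IH; exact: domS.
Qed.

(** The difference consists of products of terms outside the triangle i + j
    < N, hence outside the square of side M since 2 M <= N; it is dominated
    by the tail of the product of the norms. *)
Lemma evN_M n N M (f g : B n) : dom n s x -> (M + M <= N)%N ->
  nm (evN N x (f * g) - evN N x f * evN N x g) <=
  box N s f * box N s g - box M s f * box M s g.
Proof.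
move=> + MN; elim: n f g => [|n IH] f g hx; first by rewrite /= !subrr nm0.
have hx' := domS hx.
have bge n' N' (w : B n') : 0 <= box N' s w by exact: box_ge0.
have px k : nm (x n ^+ k) <= s n ^+ k by apply: powX_le; exact: hx.
have sX k : 0 <= s n ^+ k by exact: exprn_ge0.
rewrite evNS.
set T1 := \sum_(k < N) _; set T3 := evN N x f * evN N x g.
pose T2 := \sum_(k < N) (\sum_(i < k.+1) evN N x (f i) * evN N x (g (k - i)%N)) * x n ^+ k.
pose U := \sum_(k < N) (\sum_(i < k.+1) (box N s (f i) * box N s (g (k - i)%N)
   - box M s (f i) * box M s (g (k - i)%N))) * s n ^+ k.
have h12 : nm (T1 - T2) <= U.
  rewrite /T1 /T2 -sumrB; apply: le_trans (nm_sum _ _ _) _; apply: ler_sum => k _.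
  rewrite -mulrBl nmM; apply: ler_pM; rewrite ?nm_ge0 // psM raddf_sum -sumrB.
  by apply: le_trans (nm_sum _ _ _) _; apply: ler_sum => i _; exact: IH.
have UE : U = \sum_(i < N) \sum_(j < N | (i + j < N)%N)
      (box N s (f i) * s n ^+ i * (box N s (g j) * s n ^+ j))
   - \sum_(i < N) \sum_(j < N | (i + j < N)%N)
      (box M s (f i) * s n ^+ i * (box M s (g j) * s n ^+ j)).
  rewrite -(triangle N (fun i => box N s (f i)) (fun j => box N s (g j))).
  rewrite -(triangle N (fun i => box M s (f i)) (fun j => box M s (g j))) /U -sumrB; apply: eq_bigr => k _.
  by rewrite -mulrBl -sumrB.
have T3E : T3 = \sum_(i < N) \sum_(j < N)
      evN N x (f i) * x n ^+ i * (evN N x (g j) * x n ^+ j).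
  by rewrite /T3 !evNS mulr_suml; apply: eq_bigr => i _; rewrite mulr_sumr.
have h23 : nm (T2 - T3) <= \sum_(i < N) \sum_(j < N | ~~ (i + j < N)%N)
      (box N s (f i) * s n ^+ i * (box N s (g j) * s n ^+ j)).
  rewrite /T2 (triangle N (fun i => evN N x (f i)) (fun j => evN N x (g j))) T3E nmC -sumrB; apply: le_trans (nm_sum _ _ _) _.
  apply: ler_sum => i _; rewrite (bigID (fun j : 'I_N => (i + j < N)%N)) /= addrC addrK.
  apply: le_trans (nm_sum _ _ _) _; apply: ler_sum => j _; rewrite !nmM.
  by apply: ler_pM; rewrite ?mulr_ge0 ?nm_ge0 //; apply: ler_pM;
    rewrite ?nm_ge0 //; exact: evN_le.
apply: le_trans (nm_tri _ T2 _) _.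
apply: le_trans (lerD h12 h23) _; rewrite UE addrAC -big_split /=.
rewrite (eq_bigr (fun i : 'I_N => \sum_(j < N) box N s (f i) * s n ^+ i *
   (box N s (g j) * s n ^+ j))); last first.
  by move=> i _; rewrite [RHS](bigID (fun j : 'I_N => (i + j < N)%N)).
have -> : \sum_(i < N) \sum_(j < N) box N s (f i) * s n ^+ i *
   (box N s (g j) * s n ^+ j) = box N s f * box N s g.
  by rewrite !boxS mulr_suml; apply: eq_bigr => i _; rewrite mulr_sumr.
rewrite lerD2l lerN2 mulr_suml.
have MN' : (M <= N)%N by apply: leq_trans MN; exact: leq_addr.
rewrite (sum_trunc (fun i => box M s (f i) * s n ^+ i *
   (\sum_(j < M) box M s (g j) * s n ^+ j)) MN').
apply: ler_sum => i _; case: ifP => iM; last first.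
  by apply: sumr_ge0 => j _; rewrite !mulr_ge0.
rewrite mulr_sumr (sum_trunc (fun j => box M s (f i) * s n ^+ i *
   (box M s (g j) * s n ^+ j)) MN') [leRHS]big_mkcond.
apply: ler_sum => j _; case: ifP => jM; last first.
  by case: ifP => // _; rewrite !mulr_ge0.
by case: ifP => // /negbT; lia.
Qed.

End Radii.

(** Normal convergence on the polydisc of radii s, with norm at most c. *)
Definition nb n (s : nat -> R) (c : R) (f : B n) := forall N, box N s f <= c.

(** The sum at x, by convention 0 when the partial sums diverge. *)
Definition ev n (x : nat -> C) (f : B n) : C :=
  xget 0 [set y | forall e, 0 < e -> exists N0, forall N, (N0 <= N)%N ->
    nm (evN N x f - y) <= e]%classic.

(** The exact norm, the limit of the norms of the finite parts. *)
Lemma nb_tight n s c (f : B n) : (forall i, 0 <= s i) -> nb s c f ->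
  exists c', [/\ c' <= c, nb s c' f & forall e, 0 < e -> exists N, c' - box N s f <= e].
Proof.
move=> s0 hf; have [|l [lc hl he]] := @mono_lim R (fun N => box N s f) c _ hf.
  by move=> i j ij; exact: box_mono.
exists l; split=> // e e0; have [N hN] := he e e0; exists N; lra.
Qed.

Section EvLimit.
Variables (n : nat) (s : nat -> R) (x : nat -> C).
Hypotheses (s0 : forall i, 0 <= s i) (hx : dom n s x).

Lemma ev_uniq (f : B n) y : (forall e, 0 < e -> exists N0, forall N, (N0 <= N)%N ->
    nm (evN N x f - y) <= e) -> ev x f = y.
Proof.
move=> hy; rewrite /ev; case: xgetP => [y' -> hy'|/(_ y)]; last by [].
apply/eqP; rewrite -subr_eq0; apply/eqP/nm_small0 => e e0.
have e20 : 0 < e / 2 by rewrite divr_gt0.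
have [N h] := hy _ e20; have [N' h'] := hy' _ e20.
have := h _ (leq_maxl N N'); have := h' _ (leq_maxr N N').
set w := evN _ _ _ => h1 h2; rewrite nmC in h1.
by apply: le_trans (nm_tri _ w _) _; lra.
Qed.

Lemma evP c (f : B n) N : nb s c f -> nm (ev x f - evN N x f) <= c - box N s f.
Proof.
move=> hf; have bm i j : (i <= j)%N -> box i s f <= box j s f by exact: box_mono.
have lim (p : C -> R) : (forall a b, `|p a - p b| <= nm (a - b)) ->
    exists l, forall e, 0 < e -> exists N0, forall N, (N0 <= N)%N ->
      `|p (evN N x f) - l| <= e.
  move=> hp.
  have step i j : (i <= j)%N -> `|p (evN j x f) - p (evN i x f)| <= box j s f - box i s f.
    by move=> ij; apply: le_trans (hp _ _) _; exact: evN_diff.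
  have [l1 [_ h1 e1]] := @mono_lim R (fun N => box N s f) c bm hf.
  have [|j|l2 [_ h2 e2]] := @mono_lim R (fun N => p (evN N x f) + box N s f)
     (p (evN 0 x f) + c + c).
  - by move=> i j ij; have := step i j ij; rewrite ler_norml => /andP [? ?]; lra.
  - have := step 0%N j (leq0n _); rewrite ler_norml => /andP [? ?].
    by have := hf j; have := box_ge0 s0 0 f; lra.
  exists (l2 - l1) => e e0.
  have [N1 hN1] := e1 _ e0; have [N2 hN2] := e2 _ e0.
  exists (maxn N1 N2) => M hM; rewrite ler_norml.
  have m1 := bm N1 M (leq_trans (leq_maxl _ _) hM); have := h1 M; have := h2 M.
  have := step N2 M (leq_trans (leq_maxr _ _) hM); rewrite ler_norml => /andP [? ?].
  by move=> ? ?; apply/andP; split; lra.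
have [a ha] := lim (@complex.Re R) (@Re_lip R).
have [b hb] := lim (@complex.Im R) (@Im_lip R).
have hy : forall e, 0 < e -> exists N0, forall N, (N0 <= N)%N ->
    nm (evN N x f - (a +i* b)%C) <= e.
  move=> e e0; have e20 : 0 < e / 2 by rewrite divr_gt0.
  have [N1 h1] := ha _ e20; have [N2 h2] := hb _ e20.
  exists (maxn N1 N2) => M hM; apply: le_trans (nm_le_ReIm _) _.
  have := h1 M (leq_trans (leq_maxl _ _) hM); have := h2 M (leq_trans (leq_maxr _ _) hM).
  case: (evN M x f) => u v /=; lra.
rewrite (ev_uniq hy); apply/ler_addgt0Pr => e e0.
have [N0 hN0] := hy e e0; have := hN0 _ (leq_maxl N0 N); have := evN_diff s0 f hx (leq_maxr N0 N).
have := hf (maxn N0 N); set w := evN (maxn _ _) _ _ => h1 h2 h3.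
by apply: le_trans (nm_tri _ w _) _; rewrite nmC in h3; lra.
Qed.

Lemma ev_le c (f : B n) : nb s c f -> nm (ev x f) <= c.
Proof.
move=> hf; rewrite -[ev x f](subrK (evN 0 x f)); apply: le_trans (nmD _ _) _.
by have := evP 0 hf; have := evN_le s0 0 f hx; lra.
Qed.

Lemma ev_lim c (f : B n) : nb s c f -> forall e, 0 < e ->
  exists N0, forall N, (N0 <= N)%N -> nm (evN N x f - ev x f) <= e.
Proof.
move=> hf e e0; have [c' [_ hc' he]] := nb_tight s0 hf; have [N0 hN0] := he e e0.
exists N0 => N NN; rewrite nmC; apply: le_trans (evP N hc') _.
by have := box_mono s0 f NN; lra.
Qed.

Lemma nbD c d (f g : B n) : nb s c f -> nb s d g -> nb s (c + d) (f + g).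
Proof. by move=> hf hg N; apply: le_trans (boxD s0 _ _ _) _; exact: lerD. Qed.
Lemma nbN c (f : B n) : nb s c f -> nb s c (- f).
Proof. by move=> hf N; rewrite boxN. Qed.
Lemma nbM c d (f g : B n) : nb s c f -> nb s d g -> nb s (c * d) (f * g).
Proof.
by move=> hf hg N; apply: le_trans (boxM s0 _ _ _) _; apply: ler_pM; rewrite ?box_ge0.
Qed.
Lemma nb_cst a : nb s (nm a) (cst n a).
Proof. by move=> N; exact: box_cst. Qed.
Lemma nb_var i : nb s (s i) (var C n i).
Proof. by move=> N; exact: box_var. Qed.
Lemma nb_le c d (f : B n) : nb s c f -> c <= d -> nb s d f.
Proof. by move=> hf cd N; apply: le_trans (hf N) cd. Qed.

Lemma ev_cst a : ev x (cst n a) = a.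
Proof.
by apply: ev_uniq => e e0; exists 1%N => -[|N] // _; rewrite evN_cst subrr nm0 ltW.
Qed.
Lemma ev0 : ev x (0 : B n) = 0.
Proof. by rewrite -(rmorph0 (cst n)) ev_cst. Qed.
Lemma ev_var i : (i < n)%N -> ev x (var C n i) = x i.
Proof.
move=> ni; apply: ev_uniq => e e0; exists 2%N => -[|[|N]] // _.
by rewrite evN_var // subrr nm0 ltW.
Qed.
Lemma evB c d (f g : B n) : nb s c f -> nb s d g -> ev x (f - g) = ev x f - ev x g.
Proof.
move=> hf hg; apply: ev_uniq => e e0; have e20 : 0 < e / 2 by rewrite divr_gt0.
have [N1 h1] := ev_lim hf e20; have [N2 h2] := ev_lim hg e20.
exists (maxn N1 N2) => M hM; rewrite evN_zmod.
have -> : evN M x f - evN M x g - (ev x f - ev x g) =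
   (evN M x f - ev x f) - (evN M x g - ev x g) by ring.
apply: le_trans (nmB _ _) _.
have := h1 M (leq_trans (leq_maxl _ _) hM); have := h2 M (leq_trans (leq_maxr _ _) hM).
lra.
Qed.
Lemma evNeg c (f : B n) : nb s c f -> ev x (- f) = - ev x f.
Proof.
move=> hf; rewrite -[- f]sub0r (@evB 0 c) ?ev0 ?sub0r //.
by move=> N; rewrite box0.
Qed.
Lemma evD c d (f g : B n) : nb s c f -> nb s d g -> ev x (f + g) = ev x f + ev x g.
Proof.
by move=> hf hg; rewrite -{1}[g]opprK (evB hf (nbN hg)) (evNeg hg) opprK.
Qed.
Lemma evM c d (f g : B n) : nb s c f -> nb s d g -> ev x (f * g) = ev x f * ev x g.
Proof.
move=> hf hg; have [c' [_ {}hf hc]] := nb_tight s0 hf; have [d' [_ {}hg hd]] := nb_tight s0 hg.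
have c0 : 0 <= c' by apply: le_trans (hf 0%N); exact: box_ge0.
have d0 : 0 <= d' by apply: le_trans (hg 0%N); exact: box_ge0.
have cd1 : 0 < c' + d' + 1 by lra.
apply/eqP; rewrite -subr_eq0; apply/eqP/nm_small0 => e e0.
have e10 : 0 < e / (c' + d' + 1) / 4 by rewrite !divr_gt0.
set e1 := e / _ / 4 in e10.
have eE : e = 4 * (e1 * (c' + d' + 1)).
  by rewrite /e1; field; exact: lt0r_neq0.
have e40 : 0 < e / 4 by rewrite divr_gt0.
have [N1 h1] := hc _ e10; have [N2 h2] := hd _ e10.
have [N3 h3] := ev_lim (nbM hf hg) e40.
have [N4 h4] := ev_lim hf e10; have [N5 h5] := ev_lim hg e10.
pose M := maxn N1 N2; have [N [iM i3 i4 i5]] := large4 (M + M) N3 N4 N5.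
have {}h1 : c' - box M s f <= e1 by have := box_mono s0 f (leq_maxl N1 N2); rewrite -/M; lra.
have {}h2 : d' - box M s g <= e1 by have := box_mono s0 g (leq_maxr N1 N2); rewrite -/M; lra.
have {}h3 := h3 N i3; have {}h4 := h4 N i4; have {}h5 := h5 N i5.
have hM := @evN_M s x s0 n N M f g hx iM.
have -> : ev x (f * g) - ev x f * ev x g =
  (evN N x (f * g) - evN N x f * evN N x g) - (evN N x (f * g) - ev x (f * g))
  + ((evN N x f - ev x f) * evN N x g + ev x f * (evN N x g - ev x g)) by ring.
apply: le_trans (nmD _ _) _.
have A1 : nm ((evN N x (f * g) - evN N x f * evN N x g) - (evN N x (f * g) - ev x (f * g)))
   <= e1 * (c' + d') + e / 4.
  apply: le_trans (nmB _ _) _; apply: lerD => //; apply: le_trans hM _.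
  have := hf N; have := hg N; have := hf M; have := hg M.
  have := box_ge0 s0 N f; have := box_ge0 s0 N g; have := box_ge0 s0 M f; have := box_ge0 s0 M g.
  nra.
have A2 : nm ((evN N x f - ev x f) * evN N x g + ev x f * (evN N x g - ev x g))
   <= e1 * d' + c' * e1.
  apply: le_trans (nmD _ _) _; rewrite !nmM; apply: lerD.
    by apply: ler_pM; rewrite ?nm_ge0 // (le_trans (evN_le s0 N g hx)).
  by apply: ler_pM; rewrite ?nm_ge0 //; exact: ev_le.
have := lerD A1 A2; lra.
Qed.

End EvLimit.
End Eval.

Section Composition.
Variable R : realType.
Local Notation C := (Cplx R).
Local Notation B := (B C).

Definition cvs n (s : nat -> R) (f : B n) := exists c, nb s c f.

Section Cvs.
Variables (n : nat) (s : nat -> R) (x : nat -> C).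
Hypotheses (s0 : forall i, 0 <= s i) (hx : dom n s x).
Implicit Types f g : B n.

Lemma cvsD f g : cvs s f -> cvs s g -> cvs s (f + g).
Proof. by move=> [c hc] [d hd]; exists (c + d); exact: nbD. Qed.
Lemma cvsN f : cvs s f -> cvs s (- f).
Proof. by move=> [c hc]; exists c; exact: nbN. Qed.
Lemma cvsB f g : cvs s f -> cvs s g -> cvs s (f - g).
Proof. by move=> hf hg; apply: cvsD => //; exact: cvsN. Qed.
Lemma cvsM f g : cvs s f -> cvs s g -> cvs s (f * g).
Proof. by move=> [c hc] [d hd]; exists (c * d); exact: nbM. Qed.
Lemma cvs_cst a : cvs s (cst n a).
Proof. by exists (nm a); exact: nb_cst. Qed.
Lemma cvs0 : cvs s (0 : B n). Proof. by rewrite -(rmorph0 (cst n)); exact: cvs_cst. Qed.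
Lemma cvs1 : cvs s (1 : B n). Proof. by rewrite -(rmorph1 (cst n)); exact: cvs_cst. Qed.
Lemma cvs_var i : cvs s (var C n i).
Proof. by exists (s i); exact: nb_var. Qed.
Lemma cvsX f k : cvs s f -> cvs s (f ^+ k).
Proof.
by move=> hf; elim: k => [|k IH]; rewrite ?expr0 ?exprS; [exact: cvs1|exact: cvsM].
Qed.
Lemma cvs_sum (I : Type) (r : seq I) (P : pred I) (G : I -> B n) :
  (forall i, P i -> cvs s (G i)) -> cvs s (\sum_(i <- r | P i) G i).
Proof. by move=> h; elim/big_ind: _ => //; [exact: cvs0|exact: cvsD]. Qed.

Lemma evcD f g : cvs s f -> cvs s g -> ev x (f + g) = ev x f + ev x g.
Proof. by move=> [c hc] [d hd]; exact: (evD s0 hx hc hd). Qed.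
Lemma evcB f g : cvs s f -> cvs s g -> ev x (f - g) = ev x f - ev x g.
Proof. by move=> [c hc] [d hd]; exact: (evB s0 hx hc hd). Qed.
Lemma evcM f g : cvs s f -> cvs s g -> ev x (f * g) = ev x f * ev x g.
Proof. by move=> [c hc] [d hd]; exact: (evM s0 hx hc hd). Qed.
Lemma evc1 : ev x (1 : B n) = 1.
Proof. by rewrite -(rmorph1 (cst n)) ev_cst. Qed.
Lemma evcX f k : cvs s f -> ev x (f ^+ k) = ev x f ^+ k.
Proof.
move=> hf; elim: k => [|k IH]; first by rewrite !expr0 evc1.
by rewrite !exprS evcM ?IH //; exact: cvsX.
Qed.
Lemma evc_sum m (G : nat -> B n) : (forall i, (i < m)%N -> cvs s (G i)) ->
  ev x (\sum_(i < m) G i) = \sum_(i < m) ev x (G i).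
Proof.
elim: m => [|m IH] h; first by rewrite !big_ord0 ev0.
have h' i : (i < m)%N -> cvs s (G i) by move=> im; apply: h; exact: ltnW.
rewrite !big_ord_recr /= evcD ?IH //; last exact: h.
by apply: cvs_sum => i _; exact: h'.
Qed.
End Cvs.

Lemma evN_ext n N (x y : nat -> C) (f : B n) : (forall i, (i < n)%N -> x i = y i) ->
  evN N x f = evN N y f.
Proof.
elim: n f => [|n IH] f h //; rewrite !evNS; apply: eq_bigr => i _.
by rewrite h // IH // => j jn; apply: h; exact: ltnW.
Qed.
Lemma ev_ext n (x y : nat -> C) (f : B n) : (forall i, (i < n)%N -> x i = y i) ->
  ev x f = ev y f.
Proof.
move=> h; rewrite /ev; congr xget; apply/predeqP => z; split=> hz e e0;
  have [N0 hN0] := hz e e0; exists N0 => N NN; have := hN0 N NN;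
  by rewrite (evN_ext N f h).
Qed.

Fixpoint tr n (M : nat) : B n -> B n :=
  if n is m.+1 then fun f => (fun i => if (i < M)%N then @tr m M (f i) else 0)
  else fun c => c.

Lemma nb_tr n s c M (f : B n) : (forall i, 0 <= s i) -> nb s c f ->
  nb s (c - box M s f) (f - tr M f).
Proof.
move=> s0 hf N; case: (leqP M N) => [MN|/ltnW NM]; last first.
  apply: le_trans (box_mono s0 _ NM) _.
  have : box M s (f - tr M f) <= box M s f - box M s f; last by have := hf M; lra.
  elim: n f {hf} => [|n IH] f; first by rewrite /tr subrr box0 subrr.
  rewrite subrr boxS big1 // => i _.
  have -> : box M s ((f - tr M f) i) = 0; last by rewrite mul0r.
  apply/eqP; rewrite eq_le box_ge0 // andbT.
  by have := IH (f i); rewrite subrr psB /= ltn_ord.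
suff : box N s (f - tr M f) <= box N s f - box M s f by have := hf N; lra.
elim: n f {hf} => [|n IH] f; first by rewrite /tr subrr box0 subrr.
rewrite !boxS (sum_trunc (fun i => box M s (f i) * s n ^+ i) MN) -sumrB.
apply: ler_sum => i _; rewrite psB /=; case: ifP => _; last by rewrite !subr0.
by rewrite -mulrBl ler_wpM2r ?exprn_ge0.
Qed.

Section SubEval.
Variables (n m : nat) (s s' : nat -> R) (g : nat -> B m) (x : nat -> C).
Hypotheses (s0 : forall i, 0 <= s i) (s'0 : forall i, 0 <= s' i).
Hypotheses (hx : dom m s' x).

Lemma nb_sub k c (f : B k) : adm k g -> (forall i, (i < k)%N -> nb s' (s i) (g i)) ->
  nb s c f -> nb s' c (sub g f).
Proof.
move=> hg gs hf N; apply: le_trans (hf (m * N).+1); apply: box_sub => //.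
by move=> i ni; exact: gs.
Qed.

Let y i := ev x (g i).

Lemma sub_tr k M (f : B k.+1) : adm k.+1 g ->
  sub g (tr M f : B k.+1) = \sum_(i < M) sub g (tr M (f i)) * g k ^+ i.
Proof.
move=> hg; have g0 : sub g (0 : B k) = 0 := raddf0 (subm (admS hg)).
rewrite subE; apply: isum_uniq => [N|i]; last by apply: ordMl; apply: ord1X; exact: hg.
exists (N + M)%N; first exact: leq_addr.
rewrite [X in X - _](sum_trunc (fun i => sub g (tr M (f i)) * g k ^+ i) (leq_addl N M)).
rewrite -sumrB; apply: ord_sum => i _ /=.
by case: ifP => _; rewrite ?g0 ?mul0r subrr; exact: ordz.
Qed.

Lemma cvs_tr k M (f : B k) : cvs s f -> cvs s (tr M f).
Proof.
move=> [c hf]; rewrite -[tr M f](subKr f); apply: (cvsB s0); first by exists c.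
by exists (c - box M s f); exact: nb_tr.
Qed.

Lemma ev_sub_tr k M (f : B k) : adm k g -> (forall i, (i < k)%N -> nb s' (s i) (g i)) ->
  ev x (sub g (tr M f)) = evN M y f.
Proof.
elim: k f => [|k IH] f hg gs; first exact: ev_cst.
have hg' := admS hg; have gs' i : (i < k)%N -> nb s' (s i) (g i) by move=> /ltnW; exact: gs.
have cgk : cvs s' (g k) by exists (s k); exact: gs.
have ct i : cvs s' (sub g (tr M (f i))).
  elim: (k) (f i) hg' gs' => [|k' IH'] h hg' gs'; first exact: cvs_cst.
  rewrite sub_tr //; apply: (cvs_sum s'0) => j _; apply: (cvsM s'0).
    by apply: IH' => [|j' /ltnW]; [exact: admS|exact: gs'].
  by apply: (cvsX s'0); exists (s k'); exact: gs'.
rewrite sub_tr // (evc_sum s'0 hx (G := fun i => sub g (tr M (f i)) * g k ^+ i)).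
  rewrite evNS; apply: eq_bigr => i _; rewrite (evcM s'0 hx) //; last exact: (cvsX s'0).
  by rewrite (evcX s'0 hx) // IH.
by move=> i _; apply: (cvsM s'0) => //; exact: (cvsX s'0).
Qed.

(** f is approximated in norm by its truncations, for which the
    substitution is a finite computation. *)
Lemma ev_sub (f : B n) : adm n g -> (forall i, (i < n)%N -> nb s' (s i) (g i)) ->
  cvs s f -> ev x (sub g f) = ev y f.
Proof.
move=> hg gs [c hf]; have [c' [_ {}hf he]] := nb_tight s0 hf.
have hy : dom n s y by move=> i ni; apply: (ev_le s'0 hx); exact: gs.
apply/eqP; rewrite -subr_eq0; apply/eqP/nm_small0 => e e0.
have e20 : 0 < e / 2 by rewrite divr_gt0.
have [M hM] := he _ e20; rewrite -[ev x _](subrK (ev x (sub g (tr M f)))).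
have hd := nb_tr M s0 hf.
have cf : cvs s f by exists c'.
have c1 : cvs s' (sub g f) by exists c'; exact: nb_sub.
have c2 : cvs s' (sub g (tr M f)).
  by have [d hd'] := cvs_tr M cf; exists d; exact: nb_sub.
rewrite -(evcB s'0 hx c1 c2) -(sub_zmod hg) (ev_sub_tr M f hg gs) -addrA.
have h1 : nm (ev x (sub g (f - tr M f))) <= c' - box M s f.
  by apply: (ev_le s'0 hx); exact: nb_sub.
have h2 := evP s0 hy M hf; rewrite nmC in h2.
apply: le_trans (nmD _ _) _; lra.
Qed.
End SubEval.

Lemma ev_outer m s c (x : nat -> C) (f : B m.+1) : (forall i, 0 < s i) ->
  dom m.+1 s x -> nb s c f ->
  [/\ cvs s (f 0%N), cvs s (f 1%N) &
  nm (ev x f - ev x (f 0%N) - ev x (f 1%N) * x m) <= c * (nm (x m) / s m) ^+ 2].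
Proof.
move=> s1 hx hf; have s0 i : 0 <= s i by exact: ltW.
have hx' : dom m s x := domS hx.
have bt i N : 0 <= box N s (f i) * s m ^+ i by rewrite mulr_ge0 ?box_ge0 ?exprn_ge0.
have hN N : box N.+2 s (f 0%N) + box N.+2 s (f 1%N) * s m <= c.
  apply: le_trans (hf N.+2); rewrite boxS !big_ord_recl /= expr0 mulr1 expr1 addrA.
  by rewrite lerDl; apply: sumr_ge0.
have n0 : nb s c (f 0%N).
  move=> N; apply: le_trans (box_mono s0 _ (leq_addr 2 N)) _; rewrite addn2.
  by have := hN N; have := bt 1%N N.+2; rewrite expr1; lra.
have n1 : nb s (c / s m) (f 1%N).
  move=> N; apply: le_trans (box_mono s0 _ (leq_addr 2 N)) _; rewrite addn2.
  by rewrite ler_pdivlMr //; have := hN N; have := box_ge0 s0 N.+2 (f 0%N); lra.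
split; [by exists c|by exists (c / s m)|].
have c0 : 0 <= c by apply: le_trans (hf 0%N); exact: box_ge0.
have key N : nm (evN N.+2 x f - evN N.+2 x (f 0%N) - evN N.+2 x (f 1%N) * x m)
    <= c * (nm (x m) / s m) ^+ 2.
  rewrite evNS !big_ord_recl /= expr0 mulr1 /bump /= expr1.
  set S := \sum_(i < N) _.
  have -> : evN N.+2 x (f 0%N) + (evN N.+2 x (f 1%N) * x m + S) - evN N.+2 x (f 0%N)
     - evN N.+2 x (f 1%N) * x m = S by ring.
  apply: le_trans (nm_sum _ _ _) _.
  apply: (@le_trans _ _ (box N.+2 s f * (nm (x m) / s m) ^+ 2)); last first.
    by rewrite ler_wpM2r ?exprn_ge0 // divr_ge0 ?nm_ge0.
  rewrite boxS !big_ord_recl mulrDl (le_trans _ (ler_wpDl _ (lexx _))) //; last first.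
    by rewrite mulr_ge0 // ?exprn_ge0 ?divr_ge0 ?nm_ge0.
  rewrite mulrDl (le_trans _ (ler_wpDl _ (lexx _))) //; last first.
    by rewrite mulr_ge0 // ?exprn_ge0 ?divr_ge0 ?nm_ge0.
  rewrite mulr_suml; apply: ler_sum => i _; rewrite nmM /bump /= !add1n.
  have -> : box N.+2 s (f i.+2) * s m ^+ i.+2 * (nm (x m) / s m) ^+ 2 =
     box N.+2 s (f i.+2) * (nm (x m) ^+ 2 * s m ^+ i).
    by rewrite !exprS expr0; field; exact: lt0r_neq0.
  apply: ler_pM; rewrite ?nm_ge0 //; first by apply: evN_le.
  rewrite nmX -addn2 exprD mulrC ler_wpM2l ?exprn_ge0 ?nm_ge0 //.
  by rewrite lerXn2r ?nnegrE ?nm_ge0 // hx.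
apply/ler_addgt0Pr => e e0.
have e30 : 0 < e / 3 by rewrite divr_gt0.
have xm0 : 0 < nm (x m) + 1 by have := nm_ge0 (x m); lra.
have e40 : 0 < e / 3 / (nm (x m) + 1) by rewrite !divr_gt0.
have [N1 h1] := ev_lim s0 hx hf e30; have [N2 h2] := ev_lim s0 hx' n0 e30.
have [N3 h3] := ev_lim s0 hx' n1 e40; have [N [i1 i2 i3 _]] := large4 N1 N2 N3 0.
have {}h1 := h1 N.+2 (leqW (leqW i1)); have {}h2 := h2 N.+2 (leqW (leqW i2)).
have {}h3 := h3 N.+2 (leqW (leqW i3)).
have h4 : nm ((evN N.+2 x (f 1%N) - ev x (f 1%N)) * x m) <= e / 3.
  rewrite nmM; apply: (@le_trans _ _ (e / 3 / (nm (x m) + 1) * (nm (x m) + 1))).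
    by apply: ler_pM; rewrite ?nm_ge0 // lerDl.
  by rewrite divfK ?gt_eqF.
rewrite nmC in h1.
have -> : ev x f - ev x (f 0%N) - ev x (f 1%N) * x m =
  (evN N.+2 x f - evN N.+2 x (f 0%N) - evN N.+2 x (f 1%N) * x m)
  + ((ev x f - evN N.+2 x f) + ((evN N.+2 x (f 0%N) - ev x (f 0%N))
  + (evN N.+2 x (f 1%N) - ev x (f 1%N)) * x m)) by ring.
apply: le_trans (nmD _ _) _; apply: lerD; first exact: key.
apply: le_trans (nmD _ _) _; have := nmD (evN N.+2 x (f 0%N) - ev x (f 0%N))
  ((evN N.+2 x (f 1%N) - ev x (f 1%N)) * x m); lra.
Qed.

Lemma nb_der n s c i (f : B n) : (forall i, 0 < s i) -> nb s c f ->
  nb (fun j => s j / 2) ((s i)^-1 * c) (der i f).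
Proof.
move=> s0 hf N; apply: le_trans (box_der _ _ _ s0) _.
by rewrite ler_wpM2l ?invr_ge0 // ltW.
Qed.

(** First order Taylor expansion, obtained by composing f with the linear
    map (X, T) |-> x X + k T and expanding in T at X = 1. *)
Lemma ev_taylor n s c (f : B n) (x k : nat -> C) (t : C) :
  (forall i, 0 < s i) -> nb s c f ->
  (forall i, (i < n)%N -> nm (x i) + nm (k i) <= s i / 2) -> nm t <= 1 ->
  nm (ev (fun i => x i + t * k i) f - ev x f - t * \sum_(i < n) ev x (der i f) * k i)
    <= c * nm t ^+ 2.
Proof.
move=> s0 hf hxk t1; have [m m1] : exists m : nat, m = 1%N by exists 1%N.
have m0 : (0%N == m) = false by rewrite m1.
have s0' i : 0 <= s i by exact: ltW.
pose g i : B m.+1 := cst _ (x i) * var C m.+1 0 + cst _ (k i) * var C m.+1 m.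
pose z (t : C) (j : nat) : C := if j == m then t else 1.
have adg : adm n g by move=> i _; apply: ordD; apply: ordMl; exact: ord_var.
have nbg (r : R) i : 0 <= r -> nb (fun=> r) ((nm (x i) + nm (k i)) * r) (g i).
  move=> r0; have r0' (j : nat) : 0 <= (fun _ : nat => r) j by [].
  rewrite mulrDl; apply: (nbD r0'); apply: (nbM r0');
    by [exact: nb_cst|exact: (nb_var _ r0')].
have one0 (i : nat) : 0 <= (fun _ : nat => 1 : R) i by []. 
have two0 (i : nat) : 0 < (fun _ : nat => 2 : R) i by [].
have two0' (i : nat) : 0 <= (fun _ : nat => 2 : R) i by [].
have zd (r : R) t' : 1 <= r -> nm t' <= r -> dom m.+1 (fun=> r) (z t').
  by move=> r1 tr' i _; rewrite /z; case: eqP; rewrite ?nm1.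
have evg (r : R) t' i : 1 <= r -> nm t' <= r -> ev (z t') (g i) = x i + t' * k i.
  move=> r1 tr'; have r0 (j : nat) : 0 <= r by apply: le_trans r1.
  have dz := zd r t' r1 tr'.
  have cc a : cvs (fun=> r) (cst m.+1 a) by exact: cvs_cst.
  have cv j : cvs (fun=> r) (var C m.+1 j) by exact: cvs_var r0 _.
  have cm a j := cvsM r0 (cc a) (cv j).
  rewrite (evcD r0 dz (cm _ _) (cm _ _)) !(evcM r0 dz (cc _) (cv _)).
  rewrite !ev_cst !ev_var // /z eqxx m1 mulr1.
  by rewrite [t' * _]mulrC.
have g2 i : (i < n)%N -> nb (fun=> 2) (s i) (g i).
  by move=> ni; have h := hxk i ni; apply: nb_le (nbg 2 i (two0' 0%N)) _; clear -h; lra.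
have g1 i : (i < n)%N -> nb (fun=> 1) (s i / 2) (g i).
  by move=> ni; have h := hxk i ni; apply: nb_le (nbg 1 i (one0 0%N)) _; clear -h; lra.
pose G : B m.+1 := sub g f.
have nG : nb (fun=> 2) c G by apply: nb_sub g2 hf.
have evG t' : nm t' <= 1 -> ev (z t') G = ev (fun i => x i + t' * k i) f.
  move=> t1'; have t2 : nm t' <= 2 by clear -t1'; lra.
  have l12 : (1 : R) <= 2 by rewrite ler1n.
  rewrite /G (ev_sub s0' two0' (zd 2 t' l12 t2) adg g2); last by exists c.
  by apply: ev_ext => i ni; exact: (evg 2).
have l12 : (1 : R) <= 2 by rewrite ler1n.
have t2 : nm t <= 2 by clear -t1; lra.
have z2 : nm (0 : C) <= 2 by rewrite nm0.
have z1 : nm (0 : C) <= 1 by rewrite nm0.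
have [_ _ ht] := ev_outer two0 (zd 2 t l12 t2) nG.
have [_ _ h0] := ev_outer two0 (zd 2 0 l12 z2) nG.
have zt0 (w : B m) : ev (z t) w = ev (z 0) w.
  by apply: ev_ext => i im; rewrite /z ltn_eqF.
have zm t' : z t' m = t' by rewrite /z eqxx.
rewrite !zm mulr0 subr0 nm0 mul0r expr0n mulr0 in h0.
have e0 : ev (z 0) (G 0%N) = ev x f.
  apply/esym/eqP; rewrite -subr_eq0; apply/eqP/nm_eq0/le_anti; rewrite nm_ge0 andbT.
  have -> : ev x f = ev (z 0) G; last exact: h0.
  by rewrite evG //; apply: ev_ext => i _; rewrite mul0r addr0.
have nd : nb (fun=> 1) (2^-1 * c) (der m G).
  have h := nb_der m two0 nG; apply: nb_le; last exact: lexx.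
  move=> N; have := h N; rewrite (_ : (fun _ => 2 / 2) = (fun=> 1)) //.
  by apply/funext => j; rewrite divff.
have one1 (i : nat) : 0 < (fun _ : nat => 1 : R) i by [].
have l11 : (1 : R) <= 1 by [].
have d1 : ev (z 0) (G 1%N) = \sum_(i < n) ev x (der i f) * k i.
  have [_ _ hd] := ev_outer one1 (zd 1 0 l11 z1) nd.
  rewrite !zm mulr0 subr0 nm0 mul0r expr0n mulr0 in hd.
  have -> : G 1%N = (der m G) 0%N by rewrite derS eqxx /psder mulr1n.
  have -> : ev (z 0) ((der m G) 0%N) = ev (z 0) (der m G).
    apply/esym/eqP; rewrite -subr_eq0; apply/eqP/nm_eq0/le_anti.
    by rewrite nm_ge0 andbT.
  have s20 i : 0 <= s i / 2 by rewrite divr_ge0.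
  rewrite /G (chain f adg (@der_derivation _ _ m)).
  have cd i : cvs (fun j => s j / 2) (der i f) by eexists; exact: nb_der hf.
  have csub i : cvs (fun=> 1) (sub g (der i f)).
    by have [d hd'] := cd i; exists d; apply: nb_sub g1 hd'.
  have dg i : der m (g i) = cst _ (k i).
    by rewrite /g derD !derM !der_cst !der_var // eqxx m0 /= !mul0r mulr0 !add0r mulr1.
  rewrite (evc_sum one0 (zd 1 0 l11 z1) (G := fun i => sub g (der i f) * der m (g i))).
    apply: eq_bigr => i _; rewrite dg (evcM one0 (zd 1 0 l11 z1)) //; last exact: cvs_cst.
    rewrite ev_cst; congr (_ * _).
    rewrite (ev_sub s20 one0 (zd 1 0 l11 z1) adg g1) //.
    by apply: ev_ext => j jn; rewrite (evg 1) // mul0r addr0.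
  by move=> i _; apply: (cvsM one0) => //; rewrite dg; exact: cvs_cst.
rewrite zm !zt0 e0 d1 evG // [_ * t]mulrC in ht; apply: le_trans ht _.
have c0 : 0 <= c by apply: le_trans (hf 0%N); exact: box_ge0.
apply: ler_wpM2l => //; rewrite lerXn2r ?nnegrE ?divr_ge0 ?nm_ge0 //.
by rewrite ler_pdivrMr // ler_peMr ?nm_ge0 // ler1n.
Qed.

End Composition.

(** * Germs of convergent power series *)

Section Germs.
Variable R : realType.
Local Notation C := (Cplx R).
Local Notation B := (B C).

Definition conv n (f : B n) := exists r c, 0 < r /\ nb (fun=> r) c f.

Definition small n (d : R) (x : nat -> C) := forall i, (i < n)%N -> nm (x i) <= d.

Definition near0 n (P : (nat -> C) -> Prop) :=
  exists d, 0 < d /\ forall x, small n d x -> P x.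

Lemma small_le n d d' x : d <= d' -> small n d x -> small n d' x.
Proof. by move=> dd h i ni; apply: le_trans (h i ni) dd. Qed.

Lemma near0_and n (P P' : (nat -> C) -> Prop) :
  near0 n P -> near0 n P' -> near0 n (fun x => P x /\ P' x).
Proof.
move=> [d [d0 h]] [d' [d'0 h']]; exists (Num.min d d'); split.
  by rewrite lt_min d0.
by move=> x hx; split; [apply: h|apply: h']; apply: small_le hx;
  rewrite ge_min lexx ?orbT.
Qed.
Lemma near0_imp n (P P' : (nat -> C) -> Prop) :
  (forall x, P x -> P' x) -> near0 n P -> near0 n P'.
Proof. by move=> h [d [d0 hd]]; exists d; split=> // x /hd /h. Qed.

Lemma near0_widen n (W : (nat -> C) -> Prop) :
  near0 n W -> near0 n.+1 W.
Proof. by move=> [d [d0 hd]]; exists d; split=> // x hx; apply: hd => i /ltnW; exact: hx. Qed.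

Lemma nb_radius n r r' c (f : B n) : 0 <= r' -> r' <= r ->
  nb (fun=> r) c f -> nb (fun=> r') c f.
Proof. by move=> r0 rr hf N; apply: le_trans (hf N); apply: box_radii. Qed.

Lemma conv2 n (f g : B n) : conv f -> conv g ->
  exists r c, [/\ 0 < r, nb (fun=> r) c f & nb (fun=> r) c g].
Proof.
move=> [r [c [r0 hf]]] [r' [c' [r'0 hg]]].
have m0 : 0 < Num.min r r' by rewrite lt_min r0.
exists (Num.min r r'), (Num.max c c'); split=> //.
  apply: (@nb_le _ _ _ c); last by rewrite le_max lexx.
  by apply: nb_radius hf; [exact: ltW|rewrite ge_min lexx].
apply: (@nb_le _ _ _ c'); last by rewrite le_max lexx orbT.
by apply: nb_radius hg; [exact: ltW|rewrite ge_min lexx orbT].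
Qed.

Lemma conv_cst n a : conv (cst n a : B n).
Proof. by exists 1, (nm a); split=> //; exact: nb_cst. Qed.
Lemma conv_var n i : conv (var C n i).
Proof. by exists 1, 1; split=> //; apply: nb_var. Qed.
Lemma convN n (f : B n) : conv f -> conv (- f).
Proof. by move=> [r [c [r0 hf]]]; exists r, c; split=> //; exact: nbN. Qed.
Lemma convD n (f g : B n) : conv f -> conv g -> conv (f + g).
Proof.
move=> hf hg; have [r [c [r0 h1 h2]]] := conv2 hf hg.
by exists r, (c + c); split=> //; apply: nbD => // i; exact: ltW.
Qed.
Lemma convB n (f g : B n) : conv f -> conv g -> conv (f - g).
Proof. by move=> hf hg; apply: convD => //; exact: convN. Qed.
Lemma convM n (f g : B n) : conv f -> conv g -> conv (f * g).
Proof.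
move=> hf hg; have [r [c [r0 h1 h2]]] := conv2 hf hg.
by exists r, (c * c); split=> //; apply: nbM => // i; exact: ltW.
Qed.
Lemma conv_der n i (f : B n) : conv f -> conv (der i f).
Proof.
move=> [r [c [r0 hf]]]; exists (r / 2), (r^-1 * c); split; first exact: divr_gt0.
by apply: (nb_der (s := fun=> r)).
Qed.

Lemma near_ev n (f g : B n) : conv f -> conv g -> near0 n (fun x =>
  [/\ ev x (f + g) = ev x f + ev x g, ev x (f - g) = ev x f - ev x g &
      ev x (f * g) = ev x f * ev x g]).
Proof.
move=> hf hg; have [r [c [r0 h1 h2]]] := conv2 hf hg; exists r; split=> // x hx.
have r0' : forall i : nat, 0 <= (fun _ : nat => r) i by move=> _; exact: ltW.
have c1 : cvs (fun=> r) f by exists c. 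
have c2 : cvs (fun=> r) g by exists c.
by split; [exact: (evcD r0')|exact: (evcB r0')|exact: (evcM r0')].
Qed.

Lemma box_scale n N d (s : nat -> R) (la : R) (f : B n) : (forall i, 0 <= s i) ->
  0 <= la -> la <= 1 -> ord d f -> box N (fun i => la * s i) f <= la ^+ d * box N s f.
Proof.
move=> s0 l0 l1; elim: n d f => [|n IH] d f hd.
  case: (posnP d) => [->|d0]; first by rewrite expr0 mul1r.
  by rewrite (hd d0 : f = 0) !box0 mulr0.
rewrite !boxS mulr_sumr; apply: ler_sum => i _; rewrite exprMn.
apply: (@le_trans _ _ (la ^+ (d - i) * box N s (f i) * (la ^+ i * s n ^+ i))).
  by rewrite ler_wpM2r ?mulr_ge0 ?exprn_ge0 // IH //; exact: (hd i).
have -> : la ^+ (d - i) * box N s (f i) * (la ^+ i * s n ^+ i) =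
   (la ^+ (d - i) * la ^+ i) * (box N s (f i) * s n ^+ i) by ring.
rewrite -exprD ler_wpM2r ?mulr_ge0 ?box_ge0 ?exprn_ge0 //.
by rewrite ler_wiXn2l //; lia.
Qed.

(** Multiplying the radii by la <= 1 multiplies the norm of a series
    without constant term by at most la. *)
Lemma conv_ord1 n (g : B n) : conv g -> ord 1 g -> forall e, 0 < e ->
  exists d, 0 < d /\ forall d', 0 <= d' -> d' <= d -> nb (fun=> d') e g.
Proof.
move=> [r [c [r0 hg]]] g1 e e0.
have c0 : 0 <= c by apply: le_trans (hg 0%N); apply: box_ge0 => i; exact: ltW.
pose la := Num.min 1 (e / (c + 1)).
have la0 : 0 < la by rewrite lt_min ltr01 divr_gt0 //; lra.
have la1 : la <= 1 by rewrite ge_min lexx.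
exists (la * r); split=> [|d' d'0 d'd]; first exact: mulr_gt0.
apply: (nb_radius d'0 d'd) => N.
apply: le_trans (box_scale N (s := fun=> r) _ (ltW la0) la1 g1) _.
  by move=> i; exact: ltW.
rewrite expr1; apply: (@le_trans _ _ (e / (c + 1) * c)).
  apply: ler_pM; [exact: ltW|by apply: box_ge0 => i; exact: ltW| |exact: hg].
  by rewrite ge_min lexx orbT.
by rewrite mulrAC ler_pdivrMr ?ler_wpM2l //; lra.
Qed.

Lemma conv_radii n m (g : nat -> B m) (e : R) : 0 < e ->
  (forall i, (i < n)%N -> conv (g i)) -> adm n g ->
  exists d, 0 < d /\ forall d', 0 <= d' -> d' <= d ->
    forall i, (i < n)%N -> nb (fun=> d') e (g i).
Proof.
move=> e0; elim: n => [|n IH] cg hg; first by exists 1.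
have [d [d0 hd]] := IH (fun i ni => cg i (ltnW ni)) (admS hg).
have [d2 [d20 hd2]] := conv_ord1 (cg n (ltnSn n)) (hg n (ltnSn n)) e0.
exists (Num.min d d2); split=> [|d' d'0]; first by rewrite lt_min d0.
rewrite le_min => /andP [h1 h2] i; rewrite ltnS leq_eqVlt => /orP [/eqP ->|].
  exact: hd2.
exact: hd.
Qed.

(** By conv_ord1 the substituted series map a small polydisc into the
    domain of f. *)
Lemma near_sub n m (g : nat -> B m) (f : B n) : conv f ->
  (forall i, (i < n)%N -> conv (g i)) -> adm n g ->
  conv (sub g f) /\ near0 m (fun x => ev x (sub g f) = ev (fun i => ev x (g i)) f).
Proof.
move=> [r [c [r0 hf]]] cg hg; have [d [d0 hd]] := conv_radii r0 cg hg.
have gr := hd d (ltW d0) (lexx d).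
have r0' : forall i : nat, 0 <= (fun _ : nat => r) i by move=> _; exact: ltW.
have d0' : forall i : nat, 0 <= (fun _ : nat => d) i by move=> _; exact: ltW.
split; first by exists d, c; split=> //; exact: (nb_sub r0' d0' hg gr hf).
exists d; split=> // x hx; apply: (ev_sub r0' d0' hx hg gr); by exists c.
Qed.

Lemma near_small n m (g : nat -> B m) d : 0 < d ->
  (forall i, (i < n)%N -> conv (g i)) -> adm n g ->
  near0 m (fun x => small n d (fun i => ev x (g i))).
Proof.
move=> d0 cg hg; have [r [r0 hr]] := conv_radii d0 cg hg.
exists r; split=> // x hx i ni; apply: (ev_le (s := fun=> r)) => //.
  by move=> _; exact: ltW.
by apply: hr => //; exact: ltW.
Qed.

(** ev_taylor with k rescaled to the size of the polydisc. *)
Lemma conv_taylor n (f : B n) : conv f -> exists d K, [/\ 0 < d, 0 <= K &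
  forall x k eta, small n d x -> small n eta k -> eta <= d ->
   nm (ev (fun i => x i + k i) f - ev x f - \sum_(i < n) ev x (der i f) * k i)
    <= K * eta ^+ 2].
Proof.
move=> [r [c [r0 hf]]]; pose d := r / 4.
have d0 : 0 < d by rewrite divr_gt0.
have c0 : 0 <= c by apply: le_trans (hf 0%N); apply: box_ge0 => i; exact: ltW.
exists d, (c / d ^+ 2); split=> //; first by rewrite divr_ge0 // exprn_ge0 // ltW.
move=> x k eta hx hk ed; case: n f hf x k hx hk => [|n] f hf x k hx hk.
  rewrite big_ord0 (_ : ev (fun i => x i + k i) f = ev x f); last exact: ev_ext.
  by rewrite !subrr nm0 mulr_ge0 ?divr_ge0 ?exprn_even_ge0.
have eta0 : 0 <= eta by apply: le_trans (hk 0%N isT); exact: nm_ge0.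
have [eta00|etan0] := eqVneq eta 0; last first.
  have eta1 : 0 < eta by rewrite lt_neqAle eq_sym etan0.
  pose t : C := (eta / d)%:C%C; pose k' i : C := k i * ((d / eta)%:C)%C.
  have tE : nm t = eta / d by rewrite nm_real ger0_norm // divr_ge0 // ltW.
  have tk i : t * k' i = k i.
    rewrite /t /k' mulrCA -rmorphM /= mulrA divfK ?gt_eqF // divff // mulr1 //.
  have k'E i : nm (k' i) = nm (k i) * (d / eta).
    by rewrite /k' nmM nm_real ger0_norm // divr_ge0 // ltW.
  have h := @ev_taylor R n.+1 (fun=> r) c f x k' t (fun=> r0) hf.
  have {}h : nm (ev (fun i => x i + t * k' i) f - ev x f -
      t * \sum_(i < n.+1) ev x (der i f) * k' i) <= c * nm t ^+ 2.
    apply: h => [i ni|]; last by rewrite tE ler_pdivrMr // mul1r.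
    have -> : r / 2 = d + d by rewrite /d; field.
    apply: lerD; first exact: hx.
    rewrite k'E mulrA ler_pdivrMr // mulrC; apply: ler_wpM2l; [exact: ltW|exact: hk].
  have -> : \sum_(i < n.+1) ev x (der i f) * k i = t * \sum_(i < n.+1) ev x (der i f) * k' i.
    by rewrite mulr_sumr; apply: eq_bigr => i _; rewrite -tk mulrCA.
  rewrite (_ : ev (fun i => x i + k i) f = ev (fun i => x i + t * k' i) f); last first.
    by apply: ev_ext => i _; rewrite tk.
  apply: le_trans h _; rewrite tE expr_div_n.
  by rewrite mulrA mulrAC.
have k0 i : (i < n.+1)%N -> k i = 0.
  move=> ni; apply: nm_eq0; apply/eqP; rewrite eq_le nm_ge0 andbT.
  by have := hk i ni; rewrite eta00.
rewrite big1; last by move=> i _; rewrite k0 // mulr0.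
rewrite (_ : ev (fun i => x i + k i) f = ev x f).
  by rewrite !subrr nm0 eta00 expr0n /= mulr0.
by apply: ev_ext => i ni; rewrite k0 // addr0.
Qed.

Lemma conv_bound n (f : B n) : conv f -> exists d K, [/\ 0 < d, 0 <= K &
  forall x, small n d x -> nm (ev x f) <= K].
Proof.
move=> [r [c [r0 hf]]]; exists r, c; split=> //.
  by apply: le_trans (hf 0%N); apply: box_ge0 => i; exact: ltW.
by move=> x hx; apply: (ev_le (s := fun=> r)) => // i; exact: ltW.
Qed.

Lemma conv_bound_all n m (f : nat -> B n) : (forall i, (i < m)%N -> conv (f i)) ->
  exists d K, [/\ 0 < d, 0 <= K & forall x i, (i < m)%N -> small n d x -> nm (ev x (f i)) <= K].
Proof.
elim: m => [|m IH] h; first by exists 1, 0.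
have [d [K [d0 K0 hd]]] := IH (fun i im => h i (ltnW im)).
have [d' [K' [d'0 K'0 hd']]] := conv_bound (h m (ltnSn m)).
exists (Num.min d d'), (K + K'); split; [by rewrite lt_min d0|exact: addr_ge0|].
move=> x i; rewrite ltnS leq_eqVlt => /orP [/eqP ->|im] hx.
  apply: (@le_trans _ _ K'); last by rewrite lerDr.
  by apply: hd'; apply: small_le hx; rewrite ge_min lexx orbT.
apply: (@le_trans _ _ K); last by rewrite lerDl.
by apply: hd => //; apply: small_le hx; rewrite ge_min lexx.
Qed.

Lemma conv_lip n (f : B n) : conv f -> exists d K, [/\ 0 < d, 0 <= K &
  forall x k eta, small n d x -> small n eta k -> 0 <= eta -> eta <= d ->
   nm (ev (fun i => x i + k i) f - ev x f) <= K * eta].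
Proof.
move=> hf; have [d [K [d0 K0 hT]]] := conv_taylor hf.
have [d' [K' [d'0 K'0 hB]]] := conv_bound_all (fun i (_ : (i < n)%N) => conv_der i hf).
exists (Num.min d d'), (K * d + K' *+ n); split.
- by rewrite lt_min d0.
- by rewrite addr_ge0 ?mulr_ge0 ?mulrn_wge0 // ltW.
move=> x k eta hx hk eta0; rewrite le_min => /andP [ed ed'].
have h1 := hT x k eta (small_le _ hx) hk ed.
rewrite -[_ - _](subrK (\sum_(i < n) ev x (der i f) * k i)).
apply: le_trans (nmD _ _) _; rewrite mulrDl; apply: lerD.
  apply: le_trans (h1 _) _; first by rewrite ge_min lexx.
  by rewrite expr2 -mulrA ler_wpM2l // ler_wpM2r.
apply: le_trans (nm_sum _ _ _) _.
apply: (@le_trans _ _ (\sum_(i < n) K' * eta)).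
  apply: ler_sum => i _; rewrite nmM; apply: ler_pM; rewrite ?nm_ge0 //; last exact: hk.
  by apply: hB => //; apply: small_le hx; rewrite ge_min lexx orbT.
by rewrite sumr_const card_ord mulrnAl.
Qed.

Lemma ev_at0 n (f : B n) : ev (fun=> 0) f = cf (fun=> 0%N) f.
Proof.
apply: ev_uniq => e e0; exists 1%N => -[|N] // _.
have -> : evN N.+1 (fun=> 0) f = cf (fun=> 0%N) f; last by rewrite subrr nm0 ltW.
elim: n f => [|n IH] f //; rewrite evNS big_ord_recl big1 => [|i _].
  by rewrite addr0 expr0 mulr1 IH.
by rewrite expr0n mulr0.
Qed.

(** Strict differentiability at 0, the form used for the implicit function. *)
Lemma conv_strict n (f : B n) : conv f -> forall e, 0 < e -> exists d, 0 < d /\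
  forall x k eta, small n d x -> small n eta k -> 0 <= eta -> eta <= d ->
   nm (ev (fun i => x i + k i) f - ev x f
       - \sum_(i < n) cf (fun=> 0%N) (der i f) * k i) <= e * eta.
Proof.
move=> hf e e0; have [d [K [d0 K0 hT]]] := conv_taylor hf.
have hl m : exists d K, [/\ 0 < d, 0 <= K & forall i, (i < m)%N ->
  forall x eta, small n eta x -> 0 <= eta -> eta <= d ->
   nm (ev x (der i f) - cf (fun=> 0%N) (der i f)) <= K * eta].
  elim: m => [|m [d1 [K1 [d10 K10 h1]]]]; first by exists 1, 0.
  have [d2 [K2 [d20 K20 h2]]] := conv_lip (conv_der m hf).
  exists (Num.min d1 d2), (K1 + K2); split; [by rewrite lt_min d10|exact: addr_ge0|].
  move=> i; rewrite ltnS leq_eqVlt => hi x eta hx eta0.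
  rewrite le_min => /andP [ed1 ed2]; rewrite mulrDl.
  move: hi => /orP [/eqP ->|im]; last first.
    by apply: ler_wpDr; [exact: mulr_ge0|exact: h1].
  apply: ler_wpDl; first exact: mulr_ge0.
  have := h2 (fun=> 0) x eta; rewrite ev_at0.
  rewrite (_ : ev (fun i => 0 + x i) (der m f) = ev x (der m f)); last first.
    by apply: ev_ext => j _; rewrite add0r.
  by apply=> // j _; rewrite nm0 ltW.
have [d1 [K1 [d10 K10 h1]]] := hl n.
pose d2 := e / (K + K1 *+ n + 1).
have Kn : 0 <= K1 *+ n by rewrite mulrn_wge0.
have Kp : 0 < K + K1 *+ n + 1 by lra.
have d20 : 0 < d2 by rewrite divr_gt0.
exists (Num.min (Num.min d d1) d2); split; first by rewrite !lt_min d0 d10 d20.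
move=> x k eta hx hk eta0; rewrite !le_min => /andP [/andP [ed ed1] ed2].
have hxd : small n d x by apply: small_le hx; rewrite !ge_min lexx.
have hxm : small n (Num.min d1 d2) x.
  by apply: small_le hx; rewrite le_min !ge_min !lexx !orbT.
set S := \sum_(i < n) _.
rewrite -[_ - S](subrKA (\sum_(i < n) ev x (der i f) * k i)).
apply: le_trans (nmD _ _) _.
apply: (@le_trans _ _ (K * eta ^+ 2 + K1 *+ n * d2 * eta)).
  apply: lerD; first exact: hT.
  rewrite /S -sumrB; apply: le_trans (nm_sum _ _ _) _.
  apply: (@le_trans _ _ (\sum_(i < n) K1 * d2 * eta)); last first.
    by rewrite sumr_const card_ord !mulrnAl.
  apply: ler_sum => i _; rewrite -mulrBl nmM; apply: ler_pM; rewrite ?nm_ge0 //; last exact: hk.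
  apply: le_trans (h1 i (ltn_ord i) x _ hxm _ _) _; rewrite ?ge_min ?lexx ?orbT //.
    by rewrite le_min !ltW.
  by rewrite ler_wpM2l // ge_min lexx orbT.
have -> : K * eta ^+ 2 + K1 *+ n * d2 * eta = (K * eta + K1 *+ n * d2) * eta by ring.
apply: ler_wpM2r => //; apply: (@le_trans _ _ ((K + K1 *+ n) * d2)).
  by rewrite mulrDl lerD2r ler_wpM2l.
rewrite /d2 mulrCA ler_piMr ?(ltW e0) // ler_pdivrMr // mul1r; lra.
Qed.

Lemma cf_ext n (al be : nat -> nat) (f : B n) : (forall i, (i < n)%N -> al i = be i) ->
  cf al f = cf be f.
Proof.
elim: n f => [|n IH] f h //; rewrite [LHS]/(cf _ _) -/cf.
rewrite [LHS](_ : _ = cf al (f (al n))) // [RHS](_ : _ = cf be (f (be n))) //.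
by rewrite h // IH // => i ni; apply: h; exact: ltnW.
Qed.

Definition incr (al : nat -> nat) i := fun k => if k == i then (al k).+1 else al k.

Lemma cf_der n al i (f : B n) : (i < n)%N ->
  cf al (der i f) = cf (incr al i) f *+ (al i).+1.
Proof.
elim: n f => [|n IH] f // hi.
rewrite [LHS](_ : _ = cf al ((der i f) (al n))) //.
rewrite [X in _ = X *+ _](_ : _ = cf (incr al i) (f (incr al i n))) //.
rewrite derS; case: (i =P n) => [e|/eqP ni].
  rewrite /psder raddfMn /incr e eqxx; congr (_ *+ _).
  by apply: cf_ext => j jn; rewrite ltn_eqF.
rewrite {2}/incr eq_sym (negbTE ni) IH // ltn_neqAle ni; exact: hi.
Qed.

(** Up to factorials, the coefficients of f are the values at 0 of its
    iterated derivatives; the grading of P bounds the number of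
    derivations. *)
Lemma der_graded_ord n (P : nat -> B n -> Prop) :
  (forall m f i, (i < n)%N -> P m.+1 f -> P m (der i f)) ->
  (forall m f, P m f -> cf (fun=> 0%N) f = 0) -> forall m f, P m f -> ord m.+1 f.
Proof.
move=> hd h0 m f Pf; apply/ord_cf => al; rewrite ltnS => hm.
elim: m al f Pf hm => [|m IH] al f Pf hm.
  rewrite -(h0 _ _ Pf); apply: cf_ext => i ni.
  by move: hm; rewrite (bigD1 (Ordinal ni)) //= leqn0 addn_eq0 => /andP [/eqP ->].
case: (pselect (exists2 i, (i < n)%N & (0 < al i)%N)) => [[i ni ai]|hno].
  pose be k := if k == i then (al k).-1 else al k.
  have := cf_der be f ni; rewrite IH; last first.
  - have e1 : (\sum_(k < n) al k = al i + \sum_(k < n | k != Ordinal ni) al k)%N.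
      by rewrite (bigD1 (Ordinal ni)).
    have e2 : (\sum_(k < n) be k = (al i).-1 + \sum_(k < n | k != Ordinal ni) al k)%N.
      rewrite (bigD1 (Ordinal ni)) //= {1}/be eqxx; congr addn.
      apply: eq_bigr => k /eqP ki; rewrite /be; case: eqP => // e.
      by case: ki; exact: val_inj.
    by move: hm; rewrite e1 e2; move: ai; case: (al i).
  - exact: hd.
  move=> /esym/eqP; rewrite -mulr_natr mulf_eq0 pnatr_eq0 orbF => /eqP <-.
  apply: cf_ext => k _; rewrite /incr /be; case: eqP => [->|] //.
  by rewrite prednK.
rewrite -(h0 _ _ Pf); apply: cf_ext => i ni; apply/eqP; rewrite -leqn0 leqNgt.
by apply/negP => ai; apply: hno; exists i.
Qed.

Lemma cf0_ord1 m (f : B m) : cf (fun=> 0%N) f = 0 -> ord 1 f.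
Proof.
by move=> f0; apply: (@der_graded_ord m (fun k f => k = 0%N /\ cf (fun=> 0%N) f = 0)) => // [k g i _ []|k g []].
Qed.

Lemma ord1_cf0 m (f : B m) : ord 1 f -> cf (fun=> 0%N) f = 0.
Proof. by move=> /ord_cf; apply; rewrite big1. Qed.

Lemma der_closed_eq0 n (P : B n -> Prop) :
  (forall f i, (i < n)%N -> P f -> P (der i f)) ->
  (forall f, P f -> cf (fun=> 0%N) f = 0) -> forall f, P f -> f = 0.
Proof.
move=> hd h0 f Pf; apply: ord_eq0 => d; apply: ord_le (leqnSn d) _.
exact: (@der_graded_ord n (fun=> P) (fun _ => hd) (fun _ => h0) d f Pf).
Qed.

(** By Taylor's formula the derivatives of f vanish near 0 as well. *)
Lemma conv_eq0 n (f : B n) : conv f -> near0 n (fun x => ev x f = 0) -> f = 0.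
Proof.
move=> cf0 nf; apply: (@der_closed_eq0 n (fun f => conv f /\ near0 n (fun x => ev x f = 0))) => //.
  move=> {cf0 nf f} f i ni [hf [d [d0 hd]]]; split; first exact: conv_der.
  have [d' [K [d'0 K0 hT]]] := conv_taylor hf.
  pose d2 := Num.min (d / 2) d'.
  have d20 : 0 < d2 by rewrite lt_min divr_gt0.
  have dd : d2 <= d / 2 by rewrite ge_min lexx.
  exists d2; split=> // x hx; apply: nm_small0 => e e0.
  pose eta := Num.min d2 (e / (K + 1)).
  have eta0 : 0 < eta by rewrite lt_min d20 divr_gt0 //; lra.
  have ed2 : eta <= d2 by rewrite ge_min lexx.
  pose k j : C := if j == i then (eta%:C)%C else 0.
  have hk : small n eta k.
    move=> j _; rewrite /k; case: eqP => _; last by rewrite nm0 ltW.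
    by rewrite nm_real (ger0_norm (ltW eta0)).
  have := hT x k eta (small_le _ hx) hk.
  have hxd : small n d x by apply: small_le hx; lra.
  have hxk : small n d (fun i => x i + k i).
    move=> j jn; apply: le_trans (nmD _ _) _; have := hx j jn; have := hk j jn; lra.
  rewrite (hd _ hxd) (hd _ hxk) subr0 sub0r (bigD1 (Ordinal ni)) //= big1 => [|j /eqP ji].
    rewrite /k eqxx addr0 nmN => h.
    have d'd2 : d2 <= d' by rewrite ge_min lexx orbT.
    have {}h := h d'd2 (le_trans ed2 d'd2).
    rewrite nmM nm_real (ger0_norm (ltW eta0)) expr2 mulrA ler_pM2r // in h.
    apply: le_trans h _; apply: (@le_trans _ _ (K * (e / (K + 1)))).
      by rewrite ler_wpM2l // ge_min lexx orbT.
    by rewrite mulrCA ler_piMr ?(ltW e0) // ler_pdivrMr; lra.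
  rewrite /k; case: eqP => [e1|_]; last by rewrite mulr0.
  by case: ji; exact: val_inj.
move=> {cf0 nf f} f [_ [d [d0 hd]]]; rewrite -ev_at0; apply: hd => i _.
by rewrite nm0 ltW.
Qed.

End Germs.

(** * Analytic functions and their power series *)

Section Topology.
Variable R : realType.
Local Notation C := (Cplx R).

Lemma cnormE (z : C) : `|z| = ((nm z)%:C)%C :> C.
Proof. by rewrite normc_def; case: z. Qed.

Lemma cpos (e : C) : 0 < e -> exists r : R, 0 < r /\ e = (r%:C)%C.
Proof.
case: e => a b; rewrite ltcE /= => /andP [/eqP b0 a0]; exists a; split=> //.
by rewrite b0.
Qed.

Lemma ball_cE (z w : C) (r : R) : ball z ((r%:C)%C : C) w = (nm (z - w) < r) :> Prop.
Proof.
rewrite -ball_normE /ball_ /= cnormE ltcR //.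
Qed.

Lemma nbhs_rowC n (q : 'rV[C]_n) (A : set 'rV[C]_n) :
  nbhs q A <-> exists d : R, 0 < d /\ forall x : 'rV[C]_n, (forall j, nm (x 0 j - q 0 j) < d) -> A x.
Proof.
split.
  move=> /nbhs_ballP [e /cpos [d [d0 ->]] h]; exists d; split=> // x hx.
  by apply: h; split=> [|i j]; [rewrite ltcR|rewrite ord1 ball_cE nmC].
move=> [d [d0 h]]; apply/nbhs_ballP; exists ((d%:C)%C : C) => /=; first by rewrite ltcR.
by move=> x [_ hx]; apply: h => j; have := hx 0 j; rewrite ball_cE nmC.
Qed.

Lemma nbhs_rowR n (q : 'rV[R]_n) (A : set 'rV[R]_n) :
  nbhs q A -> exists d : R, 0 < d /\ forall x : 'rV[R]_n, (forall j, `|x 0 j - q 0 j| < d) -> A x.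
Proof.
move=> /nbhs_ballP [d /= d0 h]; exists d; split=> // x hx.
by apply: h; split=> // i j; rewrite ord1 -ball_normE /ball_ /= distrC.
Qed.

Lemma cvg_totC (T : choiceType) (u : {fset T} -> C) (l : C) :
  (u @ totally --> l)%classic -> forall e : R, 0 < e ->
  exists A, forall A', fsubset A A' -> nm (u A' - l) <= e.
Proof.
move=> hu e e0.
have hb : nbhs l (ball l ((e%:C)%C : C)) by apply: nbhsx_ballx; rewrite ltcR.
have [A _ hA] := hu _ hb; exists A => A' AA'; have := hA A' AA'.
by rewrite /= ball_cE nmC => /ltW.
Qed.

Lemma cvg_totR (T : choiceType) (u : {fset T} -> R) (l : R) :
  (u @ totally --> l)%classic -> forall e : R, 0 < e ->
  exists A, forall A', fsubset A A' -> `|u A' - l| <= e.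
Proof.
move=> hu e e0.
have hb : nbhs l (ball l e) by apply: nbhsx_ballx.
have [A _ hA] := hu _ hb; exists A => A' AA'; have := hA A' AA'.
by rewrite /= -ball_normE /ball_ /= distrC => /ltW.
Qed.

End Topology.

Section MakeSeries.
Variable R : realType.
Local Notation C := (Cplx R).
Local Notation B := (B C).

Definition upd (al : nat -> nat) n i := fun k => if k == n then i else al k.

Fixpoint mkser n (a : (nat -> nat) -> C) : B n :=
  if n is m.+1 then fun i => mkser m (fun al => a (upd al m i)) else a (fun=> 0%N).

(** Halving the radius gives in each variable a geometric series of sum at
    most 2. *)
Lemma box_mkser n N (r c : R) (a : (nat -> nat) -> C) : 0 < r ->
  (forall al : nat -> nat, nm (a al) * r ^+ (\sum_(i < n) al i)%N <= c) ->
  box N (fun=> r / 2) (mkser n a) <= c * 2 ^+ n.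
Proof.
move=> r0; elim: n c a => [|n IH] c a h.
  have := h (fun=> 0%N); rewrite big_ord0 !expr0 !mulr1; exact.
have c0 : 0 <= c.
  by apply: le_trans (h (fun=> 0%N)); rewrite mulr_ge0 ?nm_ge0 ?exprn_ge0 // ltW.
rewrite boxS; apply: (@le_trans _ _ (\sum_(i < N) c * 2 ^+ n * 2^-1 ^+ i)).
  apply: ler_sum => i _.
  have hi : box N (fun=> r / 2) (mkser n.+1 a i) <= c / r ^+ i * 2 ^+ n.
    apply: (IH _ (fun al => a (upd al n i))) => al; rewrite ler_pdivlMr ?exprn_gt0 // -mulrA -exprD.
    have E : (\sum_(k < n.+1) upd al n i k = \sum_(k < n) al k + i)%N.
      rewrite big_ord_recr /= /upd eqxx; congr addn.
      by apply: eq_bigr => k _; rewrite ltn_eqF.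
    by have := h (upd al n i); rewrite E.
  apply: (@le_trans _ _ (c / r ^+ i * 2 ^+ n * (r / 2) ^+ i)).
    by rewrite ler_wpM2r // exprn_ge0 // divr_ge0 // ltW.
  rewrite exprMn le_eqVlt; apply/orP; left; apply/eqP.
  have ri : r ^+ i != 0 by rewrite expf_neq0 // gt_eqF.
  by field.
rewrite -mulr_sumr exprSr mulrA ler_wpM2l ?mulr_ge0 ?exprn_ge0 //.
have E : \sum_(i < N) (2^-1 : R) ^+ i = 2 - 2 * 2^-1 ^+ N.
  elim: (N) => [|N' IHN]; first by rewrite big_ord0 expr0 mulr1 subrr.
  by rewrite big_ord_recr /= IHN exprS; field.
by rewrite E lerBlDr lerDl mulr_ge0 ?exprn_ge0 ?invr_ge0.
Qed.

Definition ext n (f : 'I_n -> nat) (k : nat) : nat :=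
  if insub k is Some j then f j else 0%N.

Lemma ext_ord n (f : 'I_n -> nat) (j : 'I_n) : ext f j = f j.
Proof. by rewrite /ext valK. Qed.
Lemma ext_out n (f : 'I_n -> nat) k : (n <= k)%N -> ext f k = 0%N.
Proof. by move=> nk; rewrite /ext insubF // ltnNge nk. Qed.

Lemma evN_mkser n N (a : (nat -> nat) -> C) x : 
  evN N x (mkser n a) =
  \sum_(be : {ffun 'I_n -> 'I_N}) a (ext (fun i => be i : nat)) * \prod_(i < n) x i ^+ be i.
Proof.
elim: n a => [|n IH] a.
  rewrite (eq_bigr (fun=> a (fun=> 0%N))) => [|be _]; last first.
    by rewrite big_ord0 mulr1; congr (a _); apply/funext => k; rewrite ext_out.
  by rewrite sumr_const card_ffun !card_ord expn0 mulr1n.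
have -> : evN N x (mkser n.+1 a) =
    \sum_(i < N) evN N x (mkser n (fun al => a (upd al n i))) * x n ^+ i by [].
under eq_bigr => i _ do rewrite IH mulr_suml.
rewrite pair_bigA /=.
pose h (p : 'I_N * {ffun 'I_n -> 'I_N}) : {ffun 'I_n.+1 -> 'I_N} :=
  [ffun k => if unlift ord_max k is Some k' then p.2 k' else p.1].
rewrite [RHS](reindex h) /=; last first.
  exists (fun ga : {ffun 'I_n.+1 -> 'I_N} => (ga ord_max, [ffun k => ga (lift ord_max k)])).
    move=> [i be] _ /=; rewrite /h; congr (_, _); first by rewrite ffunE unlift_none.
    by apply/ffunP => k; rewrite !ffunE liftK.
  move=> ga _; apply/ffunP => k; rewrite ffunE.
  by case: unliftP => [j|] -> //=; rewrite ffunE.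
apply: eq_bigr => -[i be] _ /=; rewrite -mulrA; congr (_ * _).
  congr (a _); apply/funext => k; rewrite /upd.
  case: eqP => [->|/eqP kn].
    by rewrite -[X in ext _ X]/(nat_of_ord (@ord_max n)) ext_ord ffunE unlift_none.
  case: (ltnP k n) => hk; last first.
    by rewrite !ext_out // ltn_neqAle eq_sym kn.
  have -> : k = lift ord_max (Ordinal hk) :> nat by rewrite /= /bump leqNgt hk.
  rewrite ext_ord ffunE liftK.
  have -> : lift ord_max (Ordinal hk) = (Ordinal hk) :> nat by rewrite /= /bump leqNgt hk.
  by rewrite ext_ord.
rewrite big_ord_recr /= ffunE unlift_none; congr (_ * _); apply: eq_bigr => k _.
rewrite ffunE; have -> : widen_ord (leqnSn n) k = lift ord_max k.
  by apply: val_inj; rewrite /= /bump leqNgt ltn_ord.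
by rewrite liftK.
Qed.

(* K is the field R or C, embedded in C by iota. *)
Variables (K : numFieldType) (iota : {rmorphism K -> C}).
Hypothesis htot : forall (T : choiceType) (u : {fset T} -> K) (l : K),
  (u @ totally --> l)%classic -> forall e : R, 0 < e ->
  exists A, forall A', fsubset A A' -> nm (iota (u A' - l)) <= e.
Hypothesis hnbhs : forall n (q : 'rV[K]_n) (A : set 'rV[K]_n), nbhs q A ->
  exists d : R, 0 < d /\ forall x : 'rV[K]_n, (forall j, nm (iota (x 0 j - q 0 j)) < d) -> A x.
Hypothesis hreal : forall r : R, exists k : K, iota k = (r%:C)%C.

Definition coord n (v : 'rV[K]_n) (i : nat) : C :=
  if insub i is Some j then iota (v 0 j) else 0.
Lemma coord_ord n (v : 'rV[K]_n) (j : 'I_n) : coord v j = iota (v 0 j).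
Proof. by rewrite /coord valK. Qed.

(** Summability at one point bounds all terms there, up to a finite set A0,
    because adding a term to A0 changes the sum little. This gives normal
    convergence on a smaller polydisc, where the unconditional sum is the
    limit along the boxes of multi-indices. *)
Lemma analytic_series n (f : 'rV[K]_n -> K) (q : 'rV[K]_n) : analytic_at f q ->
  exists G : B n, conv G /\ exists d : R, 0 < d /\ forall x : 'rV[K]_n,
    (forall j, nm (iota (x 0 j - q 0 j)) < d) -> iota (f x) = ev (coord (x - q)) G.
Proof.
move=> [a /hnbhs [d [d0 hd]]].
pose a' (al : nat -> nat) : C := iota (a [ffun i : 'I_n => al i]).
have d20 : 0 < d / 2 by rewrite divr_gt0.
have [k hk] := hreal (d / 2).
pose x0 : 'rV[K]_n := \row_j (q 0 j + k).
have hx0 j : nm (iota (x0 0 j - q 0 j)) < d.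
  by rewrite mxE addrC addKr hk nm_real ger0_norm ?(ltW d20) // ltr_pdivrMr // ltr_pMr // ltr1n.
have [A0 hA0] := htot (hd x0 hx0) ltr01.
pose term (al : {ffun 'I_n -> nat}) : K := a al * \prod_(i < n) (x0 0 i - q 0 i) ^+ al i.
have termE al : nm (iota (term al)) = nm (iota (a al)) * (d / 2) ^+ (\sum_(i < n) al i).
  rewrite /term rmorphM nmM; congr (_ * _).
  rewrite rmorph_prod (big_morph (@nm R) (@nmM R) (nm1 R)) expr_sum; apply: eq_bigr => i _.
  by rewrite rmorphXn nmX mxE addrC addKr hk nm_real ger0_norm // ltW.
have psE (S : {fset {ffun 'I_n -> nat}}) : partial_sum term S = \sum_(al <- S) term al.
  by rewrite /partial_sum big_seq_fsetE.
pose c := 2 + \sum_(al <- A0) nm (iota (term al)).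
have hterm al : nm (iota (term al)) <= c.
  case: (boolP (al \in A0)) => hal.
    rewrite /c (big_fsetD1 al) //= addrCA lerDl addr_ge0 //.
    by apply: sumr_ge0 => i _; exact: nm_ge0.
  have h1 := hA0 _ (fsubset_refl A0).
  have h2 := hA0 _ (fsubsetU1 al A0).
  have e1 : term al = partial_sum term (al |` A0)%fset - partial_sum term A0.
    by rewrite !psE big_fsetU1 //= addrK.
  apply: (@le_trans _ _ 2); last first.
    by rewrite lerDl; apply: sumr_ge0 => i _; exact: nm_ge0.
  rewrite e1 -(subrKA (f x0)) rmorphD; apply: le_trans (nmD _ _) _.
  have -> : (2 : R) = 1 + 1 by [].
  by apply: lerD => //; rewrite -nmN -rmorphN opprB.
pose G := mkser n a'.
have nbG : nb (fun=> d / 2 / 2) (c * 2 ^+ n) G.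
  move=> N; apply: box_mkser => // al; apply: le_trans (hterm [ffun i : 'I_n => al i]).
  have E : (\sum_(i < n) [ffun j : 'I_n => al j] i = \sum_(i < n) al i)%N.
    by apply: eq_bigr => i _; rewrite ffunE.
  by rewrite termE /a' E.
have d40 : 0 < d / 2 / 2 by rewrite divr_gt0.
exists G; split; first by exists (d / 2 / 2), (c * 2 ^+ n).
exists (d / 2 / 2); split=> // x hx.
have hxd j : nm (iota (x 0 j - q 0 j)) < d.
  apply: lt_trans (hx j) _; rewrite ltr_pdivrMr // ltr_pdivrMr // -mulrA ltr_pMr //.
  by rewrite -natrM ltr1n.
have s0 (i : nat) : 0 <= (fun _ : nat => d / 2 / 2) i by exact: ltW.
have hdom : dom n (fun=> d / 2 / 2) (coord (x - q)).
  move=> i ni; have /= -> := coord_ord (x - q) (Ordinal ni); rewrite !mxE.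
  exact: ltW (hx _).
apply/eqP; rewrite -subr_eq0; apply/eqP/nm_small0 => e e0.
have e20 : 0 < e / 2 by rewrite divr_gt0.
have [A1 hA1] := htot (hd x hxd) e20.
have [N0 hN0] := ev_lim s0 hdom nbG e20.
pose N1 := (\max_(al <- A1) \max_(i < n) al i).+1.
pose N := maxn N0 N1.
pose emb (be : {ffun 'I_n -> 'I_N}) : {ffun 'I_n -> nat} := [ffun i => be i : nat].
pose Bx := [fset emb be | be in {ffun 'I_n -> 'I_N}]%fset.
have sub : fsubset A1 Bx.
  apply/fsubsetP => al hal.
  have hlt i : (al i < N)%N.
    apply: leq_trans (leq_maxr _ _); rewrite ltnS.
    apply: (@leq_trans (\max_(k < n) al k)); first exact: (leq_bigmax (F := fun k => al k)).
    by rewrite (big_fsetD1 al hal) /=; exact: leq_maxl.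
  apply/imfsetP; exists [ffun i => Ordinal (hlt i)] => //=.
  by apply/ffunP => i; rewrite !ffunE.
have := hA1 _ sub; have := hN0 N (leq_maxl _ _).
set u := partial_sum _ _.
have uE : iota u = evN N (coord (x - q)) G.
  have -> : u = \sum_(al <- Bx) a al * \prod_(i < n) (x 0 i - q 0 i) ^+ al i.
    by rewrite /u /partial_sum big_seq_fsetE.
  rewrite big_imfset /=; last first.
    move=> b1 b2 _ _ /ffunP h; apply/ffunP => i; apply: val_inj.
    by have := h i; rewrite !ffunE.
  rewrite big_enum /= evN_mkser rmorph_sum; apply: eq_bigr => be _.
  rewrite rmorphM rmorph_prod; congr (_ * _).
    rewrite /a'; congr (iota (a _)); apply/ffunP => i; rewrite !ffunE.
    by rewrite ext_ord.
  by apply: eq_bigr => i _; rewrite rmorphXn coord_ord !mxE ffunE.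
rewrite rmorphB /= uE => h1 h2.
rewrite -(subrKA (evN N (coord (x - q)) G)); apply: le_trans (nmD _ _) _.
by rewrite nmC in h2; rewrite [e]splitr; exact: lerD.
Qed.

End MakeSeries.

(** * The implicit function theorem *)

Lemma le_half_le0 (F : realFieldType) (t : F) : t <= 1 / 2 * t -> t <= 0.
Proof. lra. Qed.

Section Implicit.
Variable R : realType.
Local Notation C := (Cplx R).
Local Notation B := (B C).

Lemma sub_ext n m (g g' : nat -> B m) (f : B n) : (forall i, (i < n)%N -> g i = g' i) ->
  sub g f = sub g' f.
Proof.
elim: n f => [|n IH] f h //; rewrite !subE; congr isum; apply/funext => i.
by rewrite h // IH // => j jn; apply: h; exact: ltnW.
Qed.

Variables (n : nat) (P : B n.+1).
Hypothesis Pconv : conv P.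
Hypothesis P0 : cf (fun=> 0%N) P = 0.
Hypothesis Pw : cf (fun=> 0%N) (der n P) != 0.
Let a := cf (fun=> 0%N) (der n P).
(** The equation P = 0 reads w = T, where T contains neither a constant
    term nor a term linear in w alone; so substituting for w in T increases
    orders and the iteration w := T converges. *)
Let T : B n.+1 := var C n.+1 n - cst n.+1 a^-1 * P.

Let cfS k (f : B k.+1) i : cf (upd (fun=> 0%N) k i) f = cf (fun=> 0%N) (f i).
Proof.
rewrite [LHS](_ : _ = cf (upd (fun=> 0%N) k i) (f (upd (fun=> 0%N) k i k))) //.
by rewrite {2}/upd eqxx; apply: cf_ext => j jk; rewrite /upd ltn_eqF.
Qed.

Let derT : cf (fun=> 0%N) (der n T) = 0.
Proof.
rewrite /T derB derM der_cst mul0r add0r der_var // eqxx raddfB /= cf_cst mulVf //.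
have -> : cf (fun=> 0%N) (1 : B n.+1) = 1; last by rewrite subrr.
by rewrite -[1]mulr1 -{1}(rmorph1 (cst n.+1)) cf_cst mul1r -ev_at0 evc1.
Qed.
Let T0 : ord 1 (T 0%N).
Proof.
apply: cf0_ord1; rewrite -cfS (@cf_ext _ _ _ (fun=> 0%N)); last first.
  by move=> i _; rewrite /upd; case: eqP.
rewrite /T raddfB /= cf_cst P0 mulr0 subr0 -ev_at0 ev_var //.
Qed.
Let T1 : ord 1 (T 1%N).
Proof.
apply: cf0_ord1; rewrite -[RHS]derT derS eqxx.
by rewrite [RHS](_ : _ = cf (fun=> 0%N) (psder T 0%N)) // /psder mulr1n.
Qed.
Let Tconv : conv T.
Proof. by apply: convB; [exact: conv_var|apply: convM => //; exact: conv_cst]. Qed.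

Let gw (q : B n) (i : nat) : B n := if i == n then q else var C n i.
Let gw_adm q : ord 1 q -> adm n.+1 (gw q).
Proof. by move=> q1 i _; rewrite /gw; case: eqP => // _; exact: ord_var. Qed.
Let gw_id q (f : B n) : sub (gw q) f = f.
Proof.
rewrite -[RHS]sub_id; apply: sub_ext => i ni; by rewrite /gw ltn_eqF.
Qed.
Let Phi q := sub (gw q) T.

Let Phi_ord q : ord 1 q -> ord 1 (Phi q).
Proof.
move=> q1; rewrite -[Phi q](subrK (\sum_(i < 1) sub (gw q) (T i) * gw q n ^+ i)).
apply: ordD; first exact: sub_approx (gw_adm q1).
by rewrite big_ord_recl big_ord0 addr0 expr0 mulr1 gw_id.
Qed.

Let Phi_contr q q' d : ord 1 q -> ord 1 q' -> ord d (q - q') -> ord d.+1 (Phi q - Phi q').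
Proof.
move=> q1 q'1 dq.
have -> : Phi q - Phi q' = (Phi q - \sum_(i < d.+1) sub (gw q) (T i) * gw q n ^+ i)
  - (Phi q' - \sum_(i < d.+1) sub (gw q') (T i) * gw q' n ^+ i)
  + \sum_(i < d.+1) (sub (gw q) (T i) * gw q n ^+ i - sub (gw q') (T i) * gw q' n ^+ i).
  by rewrite sumrB; ring.
apply: ordD; first by apply: ordB; apply: sub_approx; exact: gw_adm.
apply: ord_sum => i _; rewrite !gw_id -mulrBr /gw eqxx.
case: (nat_of_ord i) => [|[|k]]; first by rewrite !expr0 subrr mulr0; exact: ordz.
  by rewrite !expr1; have := ordM T1 dq; rewrite add1n.
apply: ordMl; apply: (expr_diff_ord q1 q'1 dq); lia.
Qed.

Let Qn k := iter k Phi 0.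
Let Qn1 k : ord 1 (Qn k).
Proof. by elim: k => [|k IH]; [exact: ordz|exact: Phi_ord]. Qed.
Let Qn_diff k : ord k.+1 (Qn k.+1 - Qn k).
Proof.
elim: k => [|k IH]; first by rewrite subr0; exact: Phi_ord (ordz _ _ _).
exact: (Phi_contr (Qn1 k.+1) (Qn1 k) IH).
Qed.

Definition implicit : B n := isum (fun k => Qn k.+1 - Qn k).
Local Notation Q := implicit.

Let Q_approx N : ord N (Q - Qn N).
Proof.
have := @isumP _ n (fun k => Qn k.+1 - Qn k) (fun k => ord_le (leqnSn k) (Qn_diff k)) N.
have -> : \sum_(i < N) (Qn i.+1 - Qn i) = Qn N; last by [].
elim: N => [|N IH]; first by rewrite big_ord0.
by rewrite big_ord_recr /= IH addrC subrK.
Qed.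

Lemma implicit_ord1 : ord 1 Q.
Proof.
rewrite -[Q](subrK (Qn 1)); apply: ordD; [exact: Q_approx|exact: Qn1].
Qed.

Lemma implicit_fix : Q = Phi Q.
Proof.
apply: ord_sep => N; have -> : Q - Phi Q = (Q - Qn N.+1) - (Phi Q - Phi (Qn N)).
  by rewrite [Phi (Qn N)](_ : _ = Qn N.+1) //; ring.
apply: ordB; first by apply: ord_le (Q_approx N.+1).
by apply: ord_le (Phi_contr implicit_ord1 (Qn1 N) (Q_approx N)).
Qed.

(** Weighting w by la and the other variables by la ^ 2 makes T small,
    since its terms of weight one vanish. *)
Lemma implicit_conv : conv Q.
Proof.
have [r [c [r0 hT]]] := Tconv.
have c0 : 0 <= c by apply: le_trans (hT 0%N); apply: box_ge0 => i; exact: ltW.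
pose la := Num.min 1 (r / (c + 1)).
have la0 : 0 < la by rewrite lt_min ltr01 divr_gt0 //; lra.
have la1 : la <= 1 by rewrite ge_min lexx.
have lac : la ^+ 2 * c <= la * r.
  rewrite expr2 -mulrA ler_wpM2l ?(ltW la0) //.
  apply: (@le_trans _ _ (r / (c + 1) * c)).
    by rewrite ler_wpM2r // ge_min lexx orbT.
  by rewrite mulrAC ler_pdivrMr ?ler_wpM2l ?(ltW r0) //; lra.
have l20 : 0 < la ^+ 2 by rewrite exprn_gt0.
have l21 : la ^+ 2 <= 1 by rewrite exprn_ile1 // ltW.
pose s i := if i == n then la * r else la ^+ 2 * r.
pose s' (i : nat) := la ^+ 2 * r.
have s0 i : 0 <= s i by rewrite /s; case: eqP => _; rewrite mulr_ge0 // ltW.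
have s'0 i : 0 <= s' i by rewrite mulr_ge0 // ltW.
have r0' (i : nat) : 0 <= (fun _ : nat => r) i by exact: ltW.
have hTs N : box N s T <= la * r.
  apply: le_trans lac; apply: (@le_trans _ _ (la ^+ 2 * box N (fun=> r) T)); last first.
    by rewrite ler_wpM2l // ltW.
  rewrite !boxS mulr_sumr; apply: ler_sum => i _.
  have -> : box N s (T i) = box N (fun j => la ^+ 2 * (fun=> r) j) (T i).
    have : forall k (f : B k), (k <= n)%N -> box N s f = box N (fun j => la ^+ 2 * (fun=> r) j) f.
      elim=> [|k IH] f kn //; rewrite !boxS; apply: eq_bigr => j _.
      by rewrite IH ?(ltnW kn) // /s ltn_eqF.
    exact.
  rewrite {1}/s eqxx exprMn.
  case: (nat_of_ord i) => [|[|k]].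
  - by rewrite !expr0 !mulr1; have := box_scale N r0' (ltW l20) l21 T0; rewrite expr1.
  - rewrite expr1 !mulrA; apply: ler_wpM2r; first exact: r0'.
    have h := box_scale N r0' (ltW l20) l21 T1; rewrite expr1 in h.
    have hb := box_ge0 r0' N (T 1%N).
    apply: (@le_trans _ _ (la ^+ 2 * box N (fun=> r) (T 1%N) * la)).
      by rewrite ler_wpM2r // ltW.
    by rewrite ler_piMr // mulr_ge0 // ltW.
  have h := box_scale N r0' (ltW l20) l21 (ord_ge0 (T k.+2)); rewrite expr0 mul1r in h.
  have hb := box_ge0 r0' N (T k.+2).
  rewrite mulrA [la ^+ 2 * (_ * _)]mulrA; apply: ler_wpM2r; first by rewrite exprn_ge0 // ltW.
  rewrite mulrC; apply: ler_pM => //.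
  - by rewrite exprn_ge0 // ltW.
  - by apply: box_ge0 => j; exact: s'0.
  - by rewrite -addn2 exprD ler_piMl ?exprn_ile1 // ltW.
have nbQ k : nb s' (la * r) (Qn k).
  elim: k => [|k IH] N; first by rewrite box0 mulr_ge0 // ltW.
  apply: le_trans (hTs (n * N).+1); rewrite [Qn k.+1](_ : _ = sub (gw (Qn k)) T) //.
  refine (box_sub (N:=N) _ s0 s'0 (gw_adm (Qn1 k)) _ (ltnSn _)) => i _.
  rewrite /gw /s; case: eqP => _; first exact: IH.
  exact: box_var.
exists (la ^+ 2 * r), (la * r); split; first exact: mulr_gt0.
move=> N; rewrite -[Q](subrK (Qn (n * N).+1)); apply: le_trans (boxD s'0 _ _ _) _.
by rewrite (box_loc s' (ltnSn _) (Q_approx _)) add0r; exact: nbQ.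
Qed.

(** At a zero x of P, both x n and ev x Q are fixed points of w |-> T,
    which contracts distances by a factor 1 / 2 near 0. *)
Lemma implicit_graph : near0 n.+1 (fun x => ev x P = 0 -> x n = ev x Q).
Proof.
have Qc := implicit_conv; have Q1 := implicit_ord1.
have gc i : (i < n.+1)%N -> conv (gw Q i).
  by move=> _; rewrite /gw; case: eqP => // _; exact: conv_var.
have [_ hE] := near_sub Tconv gc (gw_adm Q1).
have d01 : (0 : R) < 1 / 2 by rewrite divr_gt0.
have [d1 [d10 h1]] := conv_strict Tconv d01.
have d20 : 0 < d1 / 2 by rewrite divr_gt0.
have h2 := near_small d20 gc (gw_adm Q1).
have cP : conv (cst n.+1 a^-1 * P) by apply: convM => //; exact: conv_cst.
have h3 := near_ev (conv_var R n.+1 n) cP.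
have h4 := near_ev (@conv_cst R n.+1 a^-1) Pconv.
have h5 : near0 n.+1 (fun x => small n.+1 (d1 / 2) x).
  by exists (d1 / 2); split.
have := near0_and (near0_and (near0_widen hE) (near0_widen h2)) (near0_and (near0_and h3 h4) h5).
apply: near0_imp => x [[eE e2] [[[_ e3 _] [_ _ e4]] e5]] Px.
have xT : ev x T = x n by rewrite /T e3 e4 Px mulr0 subr0 ev_var.
have QT : ev x Q = ev (fun i => ev x (gw Q i)) T by rewrite {1}implicit_fix.
pose x' i := ev x (gw Q i).
have x'n : x' n = ev x Q by rewrite /x' /gw eqxx.
have x'i i : (i < n)%N -> x' i = x i.
  by move=> ni; rewrite /x' /gw ltn_eqF // ev_var.
pose k i := x i - x' i.
pose eta := nm (x n - ev x Q).
have hk : small n.+1 eta k.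
  move=> i; rewrite ltnS leq_eqVlt => /orP [/eqP ->|ni]; first by rewrite /k x'n.
  by rewrite /k x'i // subrr nm0 nm_ge0.
have ed : eta <= d1.
  have -> : d1 = d1 / 2 + d1 / 2 by field.
  apply: le_trans (nmB _ _) _; apply: lerD; first exact: e5.
  by rewrite -x'n; exact: e2.
have x'd : small n.+1 d1 x'.
  by move=> i ni; apply: le_trans (e2 i ni) _; rewrite ler_pdivrMr // ler_pMr // ler1n.
have := h1 x' k eta x'd hk (nm_ge0 _) ed.
rewrite (_ : ev (fun i => x' i + k i) T = x n); last first.
  by rewrite -xT; apply: ev_ext => i _; rewrite /k addrC subrK.
rewrite -QT big_ord_recr /= derT mul0r addr0 big1 => [|i _]; last first.
  by rewrite /k x'i // subrr mulr0.
rewrite subr0 -/eta => h; have e0 : eta = 0.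
  have := nm_ge0 (x n - ev x Q); rewrite -/eta => h0; apply/eqP; rewrite eq_le h0 andbT.
  exact: le_half_le0 h.
by apply/eqP; rewrite -subr_eq0; apply/eqP; exact: nm_eq0.
Qed.

(** Since Q is a fixed point of w := T = w - P / a, substituting Q for w in
    P gives 0. *)
Lemma implicit_zero : near0 n.+1 (fun x => x n = ev x Q -> ev x P = 0).
Proof.
have gc i : (i < n.+1)%N -> conv (gw Q i).
  by move=> _; rewrite /gw; case: eqP => // _; [exact: implicit_conv|exact: conv_var].
have ga := gw_adm implicit_ord1.
have s0 : sub (gw Q) P = 0.
  have E : Q = Q - cst n a^-1 * sub (gw Q) P.
    rewrite {1}implicit_fix /Phi /T (sub_zmod ga) (sub_var ga) // /gw eqxx -/gw.
    by have [_ ->] := sub_monoid ga; rewrite (sub_cst _ ga).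
  have {E} : cst n a^-1 * sub (gw Q) P = 0 by rewrite -[LHS](subKr Q) -E subrr.
  have aa : cst n a * cst n a^-1 = 1 by rewrite -rmorphM divff // rmorph1.
  by move=> E; rewrite -[LHS]mul1r -aa -mulrA E mulr0.
have [_ [d [d0 hE]]] := near_sub Pconv gc ga.
exists d; split=> // x hx xn; rewrite -(ev0 n x) -s0.
rewrite hE; last by move=> i ni; apply: hx; exact: ltnW.
apply: ev_ext => i; rewrite ltnS leq_eqVlt /gw => /orP [/eqP ->|ni]; first by rewrite eqxx.
by rewrite ltn_eqF // ev_var.
Qed.

End Implicit.

(** * Functions near a point of C^2 *)

Section Conj.
Variable R : realType.
Local Notation C := (Cplx R).

Definition cnj (x : C) : C := conjc (x : R[i]).

Lemma cnj_zmod : zmod_morphism cnj.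
Proof. by move=> x y; rewrite /cnj -rmorphB. Qed.
Lemma cnj_monoid : monoid_morphism cnj.
Proof. by split=> [|x y]; rewrite /cnj ?rmorphM //; exact: (rmorph1 (@conjc R)). Qed.
HB.instance Definition _ := GRing.isZmodMorphism.Build C C cnj cnj_zmod.
HB.instance Definition _ := GRing.isMonoidMorphism.Build C C cnj cnj_monoid.

Lemma cnjM x y : cnj (x * y) = cnj x * cnj y. Proof. exact: rmorphM. Qed.
Lemma cnjD x y : cnj (x + y) = cnj x + cnj y. Proof. exact: rmorphD. Qed.
Lemma cnj0 : cnj 0 = 0. Proof. exact: rmorph0. Qed.
Lemma cnj1 : cnj 1 = 1. Proof. exact: rmorph1. Qed.
Lemma cnjK x : cnj (cnj x) = x. Proof. exact: conjcK. Qed.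
Lemma cnj_real (t : R) : cnj (t%:C)%C = (t%:C)%C.
Proof. by rewrite /cnj /= oppr0. Qed.
Lemma nm_cnj x : nm (cnj x) = nm x. Proof. exact: nm_conj. Qed.
Lemma cnj_imag : cnj (imag R) = - imag R.
Proof. by rewrite /cnj /= /imag; apply/eqP; rewrite eq_complex /= oppr0 !eqxx. Qed.
Lemma imag2 : imag R * imag R = -1.
Proof. by apply/eqP; rewrite eq_complex /= !mulr0 !mul0r mul1r sub0r add0r oppr0 !eqxx. Qed.
Lemma imag_neq0 : imag R != 0.
Proof. by apply/eqP => h; have := imag2; rewrite h mul0r => /eqP; rewrite eq_sym oppr_eq0 oner_eq0. Qed.
Lemma Im0_real (x : C) : complex.Im x = 0 -> x = ((complex.Re x)%:C)%C.
Proof. by case: x => a b /= ->. Qed.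
Lemma Im0_cnj (x : C) : complex.Im x = 0 <-> cnj x = x.
Proof.
case: x => a b; rewrite /cnj /=; split=> [->|[/eqP]]; first by rewrite oppr0.
by rewrite eq_sym -addr_eq0 -mulr2n mulrn_eq0 => /eqP.
Qed.
End Conj.
Arguments cnj : simpl never.

Section Points.
Variables (R : realType) (n : nat) (n3 : n = 3%N) (jz jw : 'I_2) (jzw : jz != jw).
Local Notation C := (Cplx R).
Local Notation B := (B C).
Local Notation V := 'rV[C]_2.

(** The real coordinates of C^2 in complex form: z, its conjugate, the
    conjugate of w, and w. *)
Definition zt (k : V) (i : nat) : C :=
  if i == 0%N then k 0 jz else if i == 1%N then cnj (k 0 jz)
  else if i == 2%N then cnj (k 0 jw) else k 0 jw.

Lemma ztD (k h : V) i : zt (k + h) i = zt k i + zt h i.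
Proof. by rewrite /zt !mxE !cnjD; do 3?case: eqP. Qed.
Lemma ztZ (t : R) (k : V) i : zt (((t%:C)%C : C) *: k) i = (t%:C)%C * zt k i.
Proof.
have hc x : cnj ((t%:C)%C * x : C) = (t%:C)%C * cnj x.
  by rewrite cnjM cnj_real.
by rewrite /zt !mxE !hc; do 3?case: eqP.
Qed.
Lemma zt0 i : zt 0 i = 0.
Proof. by rewrite /zt !mxE !cnj0; do 3?case: eqP. Qed.
Lemma zt_le (k : V) e i : (forall j, nm (k 0 j) <= e) -> nm (zt k i) <= e.
Proof. by move=> h; rewrite /zt; do 3?case: eqP => _; rewrite ?nm_cnj. Qed.

(** Real-linear forms on C^2 with complex values. *)
Definition lin (c : nat -> C) (h : V) : C := \sum_(i < n.+1) c i * zt h i.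

Lemma linE c h : lin c h =
  c 0%N * h 0 jz + c 1%N * cnj (h 0 jz) + c 2%N * cnj (h 0 jw) + c n * h 0 jw.
Proof.
rewrite /lin; move: (n) n3 => m ->.
by rewrite !big_ord_recr big_ord0 /= add0r.
Qed.
Lemma linD c h h' : lin c (h + h') = lin c h + lin c h'.
Proof. by rewrite -big_split; apply: eq_bigr => i _; rewrite ztD mulrDr. Qed.
Lemma linZ c (t : R) h : lin c (((t%:C)%C : C) *: h) = (t%:C)%C * lin c h.
Proof. by rewrite mulr_sumr; apply: eq_bigr => i _; rewrite ztZ mulrCA. Qed.

(** The vectors e and i e, for e in the standard basis, separate the
    coefficient of a coordinate from that of its conjugate. *)
Lemma lin_indep c : (forall h, lin c h = 0) -> forall i, (i < n.+1)%N -> c i = 0.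
Proof.
move=> hl; have key (a b : C) : a + b = 0 -> imag R * (a - b) = 0 -> a = 0 /\ b = 0.
  move=> ab /eqP; rewrite mulf_eq0 (negbTE (imag_neq0 R)) /= subr_eq0 => /eqP e.
  have b0 : b = 0.
    by apply/eqP; have /eqP := ab; rewrite e -mulr2n mulrn_eq0.
  by rewrite e b0.
have [h0 h1] : c 0%N = 0 /\ c 1%N = 0.
  apply: key.
    by have := hl (delta_mx 0 jz); rewrite linE !mxE !eqxx eq_sym (negbTE jzw) /= ?mulr1n ?mulr0n cnj1 cnj0 !mulr1 !mulr0 !addr0.
  have := hl (imag R *: delta_mx 0 jz).
  rewrite linE !mxE !eqxx eq_sym (negbTE jzw) /= ?mulr1n ?mulr0n !mulr1 !mulr0 cnj0 !mulr0 !addr0 cnj_imag => h.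
  by rewrite -[RHS]h; ring.
have [h2 h3] : c n = 0 /\ c 2%N = 0.
  apply: key.
    have := hl (delta_mx 0 jw); rewrite linE !mxE !eqxx (negbTE jzw) /= ?mulr1n ?mulr0n cnj1 cnj0 !mulr1 !mulr0 !add0r => h.
    by rewrite addrC.
  have := hl (imag R *: delta_mx 0 jw).
  rewrite linE !mxE !eqxx (negbTE jzw) /= ?mulr1n ?mulr0n !mulr1 !mulr0 cnj0 !mulr0 !add0r cnj_imag => h.
  by rewrite -[RHS]h; ring.
move=> i; rewrite ltnS leq_eqVlt => /orP [/eqP -> //|]; rewrite n3.
by case: i => [|[|[|i]]].
Qed.

(** A form with real values is its own conjugate, and lin_indep applies. *)
Lemma lin_real c : (forall h, complex.Im (lin c h) = 0) ->
  c 1%N = cnj (c 0%N) /\ c 2%N = cnj (c n).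
Proof.
move=> hr; pose d i := if i == 0%N then c 0%N - cnj (c 1%N) else
  if i == 1%N then c 1%N - cnj (c 0%N) else
  if i == 2%N then c 2%N - cnj (c n) else c n - cnj (c 2%N).
have hd : forall h, lin d h = 0.
  move=> h; have /Im0_cnj := hr h; rewrite !linE !cnjD !cnjM !cnjK /d n3 /= => e.
  rewrite -(subrr (c 0%N * h 0 jz + c 1%N * cnj (h 0 jz) + c 2%N * cnj (h 0 jw) + c 3%N * h 0 jw)).
  rewrite -{2}e; ring.
split; apply/eqP; rewrite -subr_eq0; apply/eqP.
  by have := lin_indep hd (_ : 1 < n.+1)%N; apply; rewrite n3.
by have := lin_indep hd (_ : 2 < n.+1)%N; apply; rewrite n3.
Qed.

Lemma quad_small (a K d : R) : 0 < d -> 0 <= K ->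
  (forall t, 0 < t -> t <= d -> t * a <= K * t ^+ 2) -> a <= 0.
Proof.
move=> d0 K0 h; rewrite leNgt; apply/negP => a0.
pose t := Num.min d (a / (K + K + 1)).
have t0 : 0 < t by rewrite lt_min d0 divr_gt0 //; lra.
have := h t t0; rewrite ge_min lexx => /(_ isT).
rewrite expr2 mulrA mulrC ler_pM2r // => h2.
have : t <= a / (K + K + 1) by rewrite ge_min lexx orbT.
rewrite ler_pdivlMr; last lra.
clear -h2 K0 t0 a0 => h3; nra.
Qed.

(** A Taylor estimate of g with differential dg. Its uniformity in the base
    point z makes it an open condition on q. *)
Definition tay (q : V) (g : V -> C) (dg : nat -> V -> C) := exists d K : R,
  [/\ 0 < d, 0 <= K & forall (z h : V) eta, (forall j, nm (z 0 j - q 0 j) < d) ->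
    (forall j, nm (h 0 j) <= eta) -> eta <= d ->
    [/\ nm (g z) <= K, nm (g (z + h) - g z) <= K * eta &
        nm (g (z + h) - g z - lin (dg^~ z) h) <= K * eta ^+ 2]].

Definition rep (q : V) (g : V -> C) (G : B n.+1) :=
  conv G /\ \forall z \near q, g z = ev (zt (z - q)) G.

Lemma near0_nbhs (q : V) (W : (nat -> C) -> Prop) : near0 n.+1 W ->
  \forall z \near q, W (zt (z - q)).
Proof.
move=> [d [d0 h]]; apply/nbhs_rowC; exists d; split=> // z hz.
by apply: h => i _; apply: zt_le => j; rewrite !mxE; exact: ltW.
Qed.

Lemma tay_near p g dg : tay p g dg -> \forall q \near p, tay q g dg.
Proof.
move=> [d [K [d0 K0 h]]]; apply/nbhs_rowC; exists (d / 2).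
split=> [|q hq]; first exact: divr_gt0.
exists (d / 2), K; split=> // [|z k eta hz hk he]; first exact: divr_gt0.
apply: h => //; last by apply: le_trans he _; rewrite ler_pdivrMr // ler_pMr // ler1n.
move=> j; apply: le_lt_trans (nm_tri _ (q 0 j) _) _; rewrite [d]splitr.
by apply: ltrD.
Qed.

Lemma tay_ext q g g' dg : tay q g dg -> (\forall z \near q, g z = g' z) -> tay q g' dg.
Proof.
move=> [d [K [d0 K0 h]]] /nbhs_rowC [d' [d'0 h']].
pose e := Num.min (d / 2) (d' / 3).
have e0 : 0 < e by rewrite lt_min !divr_gt0.
have ed : e <= d / 2 by rewrite ge_min lexx.
have ed' : e <= d' / 3 by rewrite ge_min lexx orbT.
exists e, K; split=> // z k eta hz hk he.
rewrite -!h'.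
- apply: h => //; last lra.
  by move=> j; apply: lt_le_trans (hz j) _; lra.
- move=> j; rewrite mxE addrAC; apply: le_lt_trans (nmD _ _) _.
  have := hz j; have := hk j; lra.
- by move=> j; apply: lt_le_trans (hz j) _; lra.
Qed.

Lemma tay_rep q g G : rep q g G -> tay q g (fun i z => ev (zt (z - q)) (der i G)).
Proof.
move=> [cG hg].
apply: (@tay_ext q (fun z => ev (zt (z - q)) G)); last first.
  by apply: filterS hg => z ->.
have [d1 [K1 [d10 K10 h1]]] := conv_taylor cG.
have [d2 [K2 [d20 K20 h2]]] := conv_lip cG.
have [d3 [K3 [d30 K30 h3]]] := conv_bound cG.
pose e := Num.min d1 (Num.min d2 d3).
have e0 : 0 < e by rewrite !lt_min d10 d20.
have ed1 : e <= d1 by rewrite ge_min lexx.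
have ed2 : e <= d2 by rewrite !ge_min lexx orbT.
have ed3 : e <= d3 by rewrite !ge_min lexx !orbT.
have k0 : 0 <= K1 + K2 + K3 by clear -K10 K20 K30; lra.
have k1 : K1 <= K1 + K2 + K3 by clear -K10 K20 K30; lra.
have k2 : K2 <= K1 + K2 + K3 by clear -K10 K20 K30; lra.
have k3 : K3 <= K1 + K2 + K3 by clear -K10 K20 K30; lra.
exists e, (K1 + K2 + K3); split=> // z k eta hz hk he.
have zs : small n.+1 e (zt (z - q)).
  by move=> i _; apply: zt_le => j; rewrite !mxE; exact: ltW.
have ks : small n.+1 eta (zt k) by move=> i _; exact: zt_le.
have eta0 : 0 <= eta by apply: le_trans (hk jz); exact: nm_ge0.
have E : ev (zt (z + k - q)) G = ev (fun i => zt (z - q) i + zt k i) G.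
  by apply: ev_ext => i _; rewrite -ztD addrAC.
rewrite E /lin; split.
- by apply: le_trans (h3 _ (small_le ed3 zs)) k3.
- apply: le_trans (h2 _ _ _ (small_le ed2 zs) ks eta0 (le_trans he ed2)) _.
  exact: (ler_wpM2r eta0 k2).
apply: le_trans (h1 _ _ _ (small_le ed1 zs) ks (le_trans he ed1)) _.
exact: (ler_wpM2r (exprn_ge0 2 eta0) k1).
Qed.

Lemma tay_add q f df g dg : tay q f df -> tay q g dg ->
  tay q (fun z => f z + g z) (fun i z => df i z + dg i z).
Proof.
move=> [d1 [K1 [d10 K10 h1]]] [d2 [K2 [d20 K20 h2]]].
exists (Num.min d1 d2), (K1 + K2); split.
- by rewrite lt_min d10.
- exact: addr_ge0.
move=> z h eta hz hh; rewrite le_min => /andP [e1 e2].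
have [|a1 a2 a3] := h1 z h eta _ hh e1.
  by move=> j; apply: lt_le_trans (hz j) _; rewrite ge_min lexx.
have [|b1 b2 b3] := h2 z h eta _ hh e2.
  by move=> j; apply: lt_le_trans (hz j) _; rewrite ge_min lexx orbT.
rewrite !mulrDl; split.
- by apply: le_trans (nmD _ _) _; exact: lerD.
- by rewrite opprD addrACA; apply: le_trans (nmD _ _) _; exact: lerD.
have -> : lin (fun i => df i z + dg i z) h = lin (df^~ z) h + lin (dg^~ z) h.
  by rewrite /lin -big_split; apply: eq_bigr => i _; rewrite mulrDl.
rewrite !opprD addrACA [X in nm X](_ : _ = (f (z + h) - f z - lin (df^~ z) h)
  + (g (z + h) - g z - lin (dg^~ z) h)); last ring.
by apply: le_trans (nmD _ _) _; exact: lerD.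
Qed.

Lemma tay_mul q f df g dg : tay q f df -> tay q g dg ->
  tay q (fun z => f z * g z) (fun i z => df i z * g z + f z * dg i z).
Proof.
move=> [d1 [K1 [d10 K10 h1]]] [d2 [K2 [d20 K20 h2]]].
have KK : 0 <= K1 * K2 by exact: mulr_ge0.
exists (Num.min d1 d2), (K1 * K2 * (3 + d1)); split.
- by rewrite lt_min d10.
- by rewrite mulr_ge0 //; lra.
move=> z h eta hz hh; rewrite le_min => /andP [e1 e2].
have eta0 : 0 <= eta by apply: le_trans (hh jz); exact: nm_ge0.
have [|a1 a2 a3] := h1 z h eta _ hh e1.
  by move=> j; apply: lt_le_trans (hz j) _; rewrite ge_min lexx.
have [|b1 b2 b3] := h2 z h eta _ hh e2.
  by move=> j; apply: lt_le_trans (hz j) _; rewrite ge_min lexx orbT.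
have E : f (z + h) * g (z + h) - f z * g z =
    (f (z + h) - f z) * g z + f z * (g (z + h) - g z)
    + (f (z + h) - f z) * (g (z + h) - g z) by ring.
have b4 : nm ((f (z + h) - f z) * (g (z + h) - g z)) <= K1 * K2 * eta ^+ 2.
  rewrite nmM (_ : _ * _ ^+ 2 = (K1 * eta) * (K2 * eta)); last by rewrite expr2; ring.
  by apply: ler_pM => //; exact: nm_ge0.
split.
- rewrite nmM; apply: (@le_trans _ _ (K1 * K2)); first by apply: ler_pM => //; exact: nm_ge0.
  by rewrite ler_peMr //; lra.
- rewrite E; apply: le_trans (nmD _ _) _; apply: le_trans (lerD (nmD _ _) b4) _.
  have b5 : nm ((f (z + h) - f z) * g z) <= K1 * eta * K2.
    by rewrite nmM; apply: ler_pM => //; exact: nm_ge0.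
  have b6 : nm (f z * (g (z + h) - g z)) <= K1 * (K2 * eta).
    by rewrite nmM; apply: ler_pM => //; exact: nm_ge0.
  apply: le_trans (lerD (lerD b5 b6) (lexx _)) _.
  have -> : K1 * eta * K2 + K1 * (K2 * eta) + K1 * K2 * eta ^+ 2 = K1 * K2 * (2 + eta) * eta.
    by rewrite expr2; ring.
  by rewrite ler_wpM2r // ler_wpM2l //; lra.
have -> : lin (fun i => df i z * g z + f z * dg i z) h =
    lin (df^~ z) h * g z + f z * lin (dg^~ z) h.
  by rewrite /lin mulr_suml mulr_sumr -big_split; apply: eq_bigr => i _ /=; ring.
rewrite E (_ : _ - _ = (f (z + h) - f z - lin (df^~ z) h) * g z
   + f z * (g (z + h) - g z - lin (dg^~ z) h)
   + (f (z + h) - f z) * (g (z + h) - g z)); last ring.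
apply: le_trans (nmD _ _) _; apply: le_trans (lerD (nmD _ _) b4) _.
have b5 : nm ((f (z + h) - f z - lin (df^~ z) h) * g z) <= K1 * eta ^+ 2 * K2.
  by rewrite nmM; apply: ler_pM => //; exact: nm_ge0.
have b6 : nm (f z * (g (z + h) - g z - lin (dg^~ z) h)) <= K1 * (K2 * eta ^+ 2).
  by rewrite nmM; apply: ler_pM => //; exact: nm_ge0.
apply: le_trans (lerD (lerD b5 b6) (lexx _)) _.
have -> : K1 * eta ^+ 2 * K2 + K1 * (K2 * eta ^+ 2) + K1 * K2 * eta ^+ 2 = K1 * K2 * 3 * eta ^+ 2.
  by ring.
by rewrite ler_wpM2r ?exprn_ge0 // ler_wpM2l //; lra.
Qed.

End Points.

(** * The tangent space of a real hypersurface *)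

Section Tangent.
Variables (R : realType) (n : nat) (n3 : n = 3%N) (jz jw : 'I_2) (jzw : jz != jw).
Local Notation C := (Cplx R).
Local Notation V := 'rV[C]_2.
Local Notation lin := (@lin R n jz jw).
Local Notation tay := (@tay R n jz jw).

Definition vn (h : V) : R := \sum_j nm (h 0 j).
Lemma vn_le (h : V) j : nm (h 0 j) <= vn h.
Proof. by rewrite /vn (bigD1 j) //= lerDl sumr_ge0 // => i _; exact: nm_ge0. Qed.
Lemma vn_ge0 h : 0 <= vn h.
Proof. by rewrite sumr_ge0 // => i _; exact: nm_ge0. Qed.
Lemma vnZ (t : R) (h : V) j : nm ((((t%:C)%C : C) *: h) 0 j) <= `|t| * vn h.
Proof. by rewrite mxE nmM nm_real ler_wpM2l // vn_le. Qed.

Lemma tay_dir q g dg h : tay q g dg -> exists d K, [/\ 0 < d, 0 <= K & forall t : R,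
  `|t| <= d -> nm (g (q + ((t%:C)%C : C) *: h) - g q - (t%:C)%C * lin (dg^~ q) h) <= K * t ^+ 2].
Proof.
move=> [d [K [d0 K0 hg]]].
have N0 : 0 < vn h + 1 by rewrite ltr_wpDl // vn_ge0.
exists (d / (vn h + 1)), (K * (vn h + 1) ^+ 2); split.
- exact: divr_gt0.
- by rewrite mulr_ge0 // exprn_ge0 // ltW.
move=> t td; have [|j||_ _] := hg q (((t%:C)%C : C) *: h) (`|t| * (vn h + 1)).
- by move=> j; rewrite subrr nm0.
- by apply: le_trans (vnZ _ _ _) _; rewrite ler_wpM2l // lerDl.
- by rewrite -ler_pdivlMr.
rewrite linZ => h1; apply: le_trans h1 _.
by rewrite exprMn real_normK ?num_real // [t ^+ 2 * _]mulrC mulrA.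
Qed.

Lemma tay_real q (rho : V -> R) drho : tay q (fun z => ((rho z)%:C)%C) drho ->
  forall h, complex.Im (lin (drho^~ q) h) = 0.
Proof.
move=> hr h; have [d [K [d0 K0 H]]] := tay_dir h hr.
set l := lin _ _ in H *.
have ImE (t a b : R) : complex.Im ((a%:C)%C - (b%:C)%C - (t%:C)%C * l) = - (t * complex.Im l).
  by case: (l) => u v /=; ring.
have key t : 0 < t -> t <= d -> t * `|complex.Im l| <= K * t ^+ 2.
  move=> t0 td; have := H t; rewrite ger0_norm ?(ltW t0) // => /(_ td).
  apply: le_trans; apply: le_trans (nm_Im _).
  by rewrite ImE normrN normrM (ger0_norm (ltW t0)).
apply/eqP; rewrite -normr_eq0 eq_le normr_ge0 andbT.
exact: quad_small d0 K0 key.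
Qed.

(** At q + t v + s nu the value of rho is s + O(t ^ 2 + s ^ 2), so by the
    intermediate value theorem rho vanishes for some s = O(t ^ 2). Then g
    vanishes at this point, while its value is t dg(v) + O(t ^ 2); hence
    dg(v) = 0. *)
Lemma tangent_kernel q (rho : V -> R) drho g dg nu v :
  tay q (fun z => ((rho z)%:C)%C) drho -> tay q g dg ->
  rho q = 0 -> lin (drho^~ q) nu = 1 -> lin (drho^~ q) v = 0 ->
  (\forall z \near q, rho z = 0 -> g z = 0) -> lin (dg^~ q) v = 0.
Proof.
move=> [d1 [K1 [d10 K10 h1]]] [d2 [K2 [d20 K20 h2]]] r0 c1 cv /nbhs_rowC [d3 [d30 h3]].
pose N := vn v + vn nu; have N0 : 0 <= N by rewrite addr_ge0 ?vn_ge0.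
pose A := 4 * K1 * N ^+ 2; have A0 : 0 <= A by rewrite !mulr_ge0 // exprn_ge0.
pose e := Num.min d1 (Num.min d2 d3); have e0 : 0 < e by rewrite !lt_min d10 d20.
have ed1 : e <= d1 by rewrite ge_min lexx.
have ed2 : e <= d2 by rewrite !ge_min lexx orbT.
have ed3 : e <= d3 by rewrite !ge_min lexx !orbT.
pose d4 := Num.min (A + 1)^-1 (e / (2 * N + 1)).
have A1 : 0 < A + 1 by rewrite ltr_wpDl.
have N1 : 0 < 2 * N + 1 by rewrite ltr_wpDl // mulr_ge0.
have d40 : 0 < d4 by rewrite lt_min invr_gt0 A1 divr_gt0.
have g0 : g q = 0 by apply: h3 => // j; rewrite subrr nm0.
pose L := nm (lin (dg^~ q) nu).
have L0 : 0 <= L := nm_ge0 _.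
have key t : 0 < t -> t <= d4 -> t * nm (lin (dg^~ q) v) <= (4 * K2 * N ^+ 2 + A * L) * t ^+ 2.
  move=> t0 td; pose sg := A * t ^+ 2.
  have sg0 : 0 <= sg by rewrite mulr_ge0 // exprn_ge0 // ltW.
  have sgt : sg <= t.
    rewrite /sg expr2 mulrA ler_piMl ?(ltW t0) //.
    apply: (@le_trans _ _ (A * (A + 1)^-1)).
      by rewrite ler_wpM2l //; apply: le_trans td _; rewrite ge_min lexx.
    by rewrite ler_pdivrMr // mul1r lerDl.
  pose eta := 2 * N * t.
  have etae : eta < e.
    have : t <= e / (2 * N + 1) by apply: le_trans td _; rewrite ge_min lexx orbT.
    rewrite ler_pdivlMr // => h; apply: lt_le_trans h.
    by rewrite /eta [2 * N * t]mulrC ltr_pM2l // ltrDl.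
  pose pt (s : R) : V := ((t%:C)%C : C) *: v + ((s%:C)%C : C) *: nu.
  have hpt s j : `|s| <= sg -> nm (pt s 0 j) <= eta.
    move=> hs; rewrite mxE; apply: le_trans (nmD _ _) _.
    have := vnZ t v j; have := vnZ s nu j; rewrite (ger0_norm (ltW t0)).
    have h5 : `|s| * vn nu <= t * vn nu by rewrite ler_wpM2r ?vn_ge0 // (le_trans hs).
    move=> h6 h7; apply: le_trans (lerD h7 (le_trans h6 h5)) _.
    rewrite -mulrDr /eta -/N [2 * N * t]mulrC ler_wpM2l ?(ltW t0) //.
    by rewrite mulr_natl mulr2n lerDl.
  pose f s := rho (q + pt s).
  have Aeta K : K * eta ^+ 2 = 4 * K * N ^+ 2 * t ^+ 2.
    by rewrite /eta; ring.
  have fs s : `|s| <= sg -> `|f s - s| <= sg.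
    move=> hs; have [|_ _] := h1 q (pt s) eta _ (fun j => hpt s j hs) (le_trans (ltW etae) ed1).
      by move=> j; rewrite subrr nm0.
    rewrite r0 linD !linZ cv c1 mulr0 add0r mulr1 subr0 Aeta => h.
    by apply: le_trans h; apply: le_trans (nm_Re _).
  have cf s : `|s| <= sg -> {for s, continuous f}.
    move=> hs; apply/cvgrPdist_le => /= ee ee0.
    have N2 : 0 < N + 1 by rewrite ltr_wpDl.
    have K2' : 0 < K1 * (N + 1) + 1 by rewrite ltr_wpDl // mulr_ge0 // ltW.
    apply/nbhs_normP; exists (Num.min (d1 / (N + 1)) (ee / (K1 * (N + 1) + 1))) => /=.
      by rewrite lt_min !divr_gt0.
    move=> s' /=; rewrite lt_min => /andP [].
    rewrite !ltr_pdivlMr // => b1 b2.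
    have [|||_ h _] := h1 (q + pt s) (((s' - s)%:C)%C *: nu) (`|s - s'| * (N + 1)).
    - move=> j; rewrite mxE addrAC subrr add0r.
      apply: le_lt_trans (hpt s j hs) _; exact: lt_le_trans etae ed1.
    - move=> j; apply: le_trans (vnZ _ _ _) _; rewrite distrC ler_wpM2l //.
      by rewrite /N addrAC lerDr addr_ge0 // vn_ge0.
    - exact: ltW.
    have E : q + pt s + ((s' - s)%:C)%C *: nu = q + pt s' :> V.
      by rewrite -!addrA; congr (q + (_ + _)); rewrite rmorphB scalerBl addrC subrK.
    rewrite E in h; rewrite distrC; apply: le_trans (_ : K1 * (`|s - s'| * (N + 1)) <= _).
      by apply: le_trans h; apply: le_trans (nm_Re _).
    by apply: le_trans (ltW b2); rewrite mulrCA ler_wpM2l // lerDl.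
  have [s hs fs0] : exists2 s, s \in `[- sg, sg] & f s = 0.
    apply: IVT; first by apply: (le_trans _ sg0); rewrite oppr_le0.
      apply: continuous_in_subspaceT => s; rewrite inE /= in_itv /= => hs; apply: cf.
      by rewrite ler_norml.
    have a1 := fs sg; have a2 := fs (- sg); rewrite normrN (ger0_norm sg0) in a1 a2.
    have {}a1 := a1 (lexx _); have {}a2 := a2 (lexx _).
    rewrite ler_distl in a1; rewrite ler_distl in a2.
    move: a1 a2 => /andP [a1 _] /andP [_ a2].
    rewrite subrr in a1; rewrite addNr in a2.
    move: (f sg) (f (- sg)) a1 a2 => x y a1 a2.
    apply/andP; split; first by apply: (le_trans _ a2); rewrite ge_min lexx.
    by apply: (le_trans a1); rewrite le_max lexx orbT.
  rewrite in_itv /= -ler_norml in hs.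
  have gs : g (q + pt s) = 0.
    apply: h3 => // j; rewrite mxE addrAC subrr add0r.
    by apply: le_lt_trans (hpt s j hs) _; exact: lt_le_trans etae ed3.
  have [|_ _] := h2 q (pt s) eta _ (fun j => hpt s j hs) (le_trans (ltW etae) ed2).
    by move=> j; rewrite subrr nm0.
  rewrite gs g0 subrr sub0r nmN linD !linZ Aeta => h.
  have -> : t * nm (lin (dg^~ q) v) = nm ((t%:C)%C * lin (dg^~ q) v).
    by rewrite nmM nm_real (ger0_norm (ltW t0)).
  rewrite -[X in nm X](addrK ((s%:C)%C * lin (dg^~ q) nu)).
  apply: le_trans (nmB _ _) _; rewrite mulrDl; apply: lerD => //.
  rewrite nmM nm_real -/L mulrAC ler_wpM2r //.
have h4 : 0 <= 4 * K2 * N ^+ 2 + A * L.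
  by rewrite addr_ge0 ?mulr_ge0 // ?exprn_ge0.
apply: nm_eq0; apply/eqP; rewrite eq_le nm_ge0 andbT.
exact: quad_small d40 h4 key.
Qed.

(** By tangent_kernel the differential of g vanishes on the kernel of the
    real form drho, so it is a multiple of drho. *)
Lemma tangent_at q (rho : V -> R) drho g dg :
  tay q (fun z => ((rho z)%:C)%C) drho -> tay q g dg ->
  rho q = 0 -> (exists nu, lin (drho^~ q) nu != 0) ->
  (\forall z \near q, rho z = 0 -> g z = 0) ->
  exists b, forall i, (i < n.+1)%N -> dg i q = b * drho i q.
Proof.
move=> hr hg r0 [nu cnu] hz.
have lr := tay_real hr.
pose m := complex.Re (lin (drho^~ q) nu).
have mE : lin (drho^~ q) nu = (m%:C)%C by exact: (Im0_real (lr _)).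
have m0 : m != 0 by apply: contraNneq cnu => m0; rewrite mE m0.
pose nu' : V := ((m^-1)%:C)%C *: nu.
have c1 : lin (drho^~ q) nu' = 1.
  by rewrite linZ mE -rmorphM mulVf // rmorph1.
clearbody nu'.
exists (lin (dg^~ q) nu') => i hi; apply/eqP; rewrite -subr_eq0; apply/eqP.
pose d i := dg i q - lin (dg^~ q) nu' * drho i q.
rewrite -[LHS]/(d i); apply: (@lin_indep R n n3 jz jw jzw d _ i hi) => h.
have -> : lin d h = lin (dg^~ q) h - lin (dg^~ q) nu' * lin (drho^~ q) h.
  rewrite [X in _ - _ * X](_ : _ = \sum_(i < n.+1) drho i q * zt jz jw h i) //.
  rewrite mulr_sumr -sumrB; apply: eq_bigr => k _.
  by rewrite /d mulrBl mulrA.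
pose x := complex.Re (lin (drho^~ q) h).
have xE : lin (drho^~ q) h = (x%:C)%C by exact: (Im0_real (lr _)).
have := @tangent_kernel q rho drho g dg nu' (h + ((- x)%:C)%C *: nu') hr hg r0 c1.
rewrite !linD !linZ c1 xE mulr1 rmorphN subrr => /(_ erefl hz) <-.
by rewrite mulNr mulrC.
Qed.

End Tangent.

(** * Derivatives of real-analytic functions on C^2 *)

Lemma derive1_quad (R : realType) (f : R -> R) (l d K : R) : 0 < d -> 0 <= K ->
  (forall t, `|t| <= d -> `|f t - f 0 - t * l| <= K * t ^+ 2) -> derive1 f 0 = l.
Proof.
move=> d0 K0 h; apply: cvg_lim => //; apply/cvgrPdist_le => /= e e0.
rewrite /dnbhs /within /=; near_simpl; apply/nbhs_normP.
have K1 : 0 < K + 1 by rewrite ltr_wpDl.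
exists (Num.min d (e / (K + 1))) => /=; first by rewrite lt_min d0 divr_gt0.
move=> t /=; rewrite sub0r normrN lt_min => /andP [td te] t0.
rewrite addr0 /GRing.scale /= distrC.
have -> : t^-1 * (f t - f 0) - l = t^-1 * (f t - f 0 - t * l).
  by rewrite [RHS]mulrBr mulKf.
rewrite normrM normfV ler_pdivrMl ?normr_gt0 //.
apply: le_trans (h t (ltW td)) _; rewrite -real_normK ?num_real // expr2 mulrCA.
rewrite ler_wpM2l //; rewrite ltr_pdivlMr // in te.
by apply: le_trans (ltW te); rewrite mulrC ler_wpM2l // lerDl.
Qed.

Section Derivatives.
Variables (R : realType) (n : nat) (n3 : n = 3%N) (jz jw : 'I_2) (jzw : jz != jw).
Local Notation C := (Cplx R).
Local Notation V := 'rV[C]_2.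
Local Notation lin := (@lin R n jz jw).
Local Notation tay := (@tay R n jz jw).
Local Notation rep := (@rep R n jz jw).

Lemma tay_rderive q g dg v : tay q g dg ->
  rderive v (fun z => complex.Re (g z)) q = complex.Re (lin (dg^~ q) v) /\
  rderive v (fun z => complex.Im (g z)) q = complex.Im (lin (dg^~ q) v).
Proof.
move=> /(tay_dir v) [d [K [d0 K0 h]]].
split; apply: derive1_quad d0 K0 _ => t td; apply: le_trans (h t td).
  apply: le_trans (nm_Re _); rewrite scale0r addr0.
  move: (g _) (g q) (lin _ _) => [a1 b1] [a2 b2] [a3 b3] /=.
  by rewrite mul0r subr0.
apply: le_trans (nm_Im _); rewrite scale0r addr0.
move: (g _) (g q) (lin _ _) => [a1 b1] [a2 b2] [a3 b3] /=.
by rewrite mul0r addr0.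
Qed.

Lemma tay_cderive q g dg v : tay q g dg -> cderive v g q = lin (dg^~ q) v.
Proof.
move=> h; have [e1 e2] := tay_rderive v h.
by rewrite /cderive e1 e2; case: (lin _ _).
Qed.

Lemma tay_ddz q g dg : tay q g dg ->
  [/\ ddz jz g q = dg 0%N q, ddzbar jz g q = dg 1%N q,
      ddzbar jw g q = dg 2%N q & ddz jw g q = dg n q].
Proof.
move=> h; have i2 := imag2 R.
have n20 : (2 : C) != 0 by rewrite pnatr_eq0.
have ez : cderive (delta_mx 0 jz) g q = dg 0%N q + dg 1%N q.
  rewrite (tay_cderive _ h) (linE n3) !mxE !eqxx eq_sym (negbTE jzw) /= ?mulr1n ?mulr0n.
  by rewrite cnj0 cnj1 !mulr1 !mulr0 !addr0.
have ew : cderive (delta_mx 0 jw) g q = dg 2%N q + dg n q.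
  rewrite (tay_cderive _ h) (linE n3) !mxE !eqxx (negbTE jzw) /= ?mulr1n ?mulr0n.
  by rewrite cnj0 cnj1 !mulr1 !mulr0 !add0r.
have eiz : cderive (imag R *: delta_mx 0 jz) g q = imag R * (dg 0%N q - dg 1%N q).
  rewrite (tay_cderive _ h) (linE n3) !mxE !eqxx eq_sym (negbTE jzw) /= ?mulr1n ?mulr0n.
  by rewrite !mulr1 !mulr0 cnj0 !mulr0 !addr0 cnj_imag; ring.
have eiw : cderive (imag R *: delta_mx 0 jw) g q = imag R * (dg n q - dg 2%N q).
  rewrite (tay_cderive _ h) (linE n3) !mxE !eqxx (negbTE jzw) /= ?mulr1n ?mulr0n.
  by rewrite !mulr1 !mulr0 cnj0 !mulr0 !add0r cnj_imag; ring.
rewrite /ddz /ddzbar ez ew eiz eiw !(mulrA (imag R)) i2.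
by split; field.
Qed.

Lemma sum2 (W : nmodType) (F : 'I_2 -> W) : \sum_k F k = F jz + F jw.
Proof.
rewrite (bigD1 jz) //= (bigD1 jw) 1?eq_sym //= big1 ?addr0 // => i /andP [].
move: jzw; case: i => [[|[|i]] hi] //; case: (jz) => [[|[|a]] ha] //;
  by case: (jw) => [[|[|b]] hb].
Qed.

Lemma rep_der q g G i : rep q g G ->
  rep q (fun z => ev (zt jz jw (z - q)) (der i G)) (der i G).
Proof.
move=> [cG _]; split; first exact: conv_der.
by apply: filterE. Qed.

(** The Wirtinger derivatives are the partial derivatives of the series
    with respect to z, zbar, wbar, w. *)
Lemma levi_series (rho : V -> R) q xi G : rep q (fun z => ((rho z)%:C)%C) G ->
  let L a b := ev (zt jz jw (q - q)) (der a (der b G)) in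
  levi_form rho q xi = L 0%N 1%N * xi 0 jz * cnj (xi 0 jz)
    + L 0%N 2%N * xi 0 jz * cnj (xi 0 jw)
    + L n 1%N * xi 0 jw * cnj (xi 0 jz) + L n 2%N * xi 0 jw * cnj (xi 0 jw).
Proof.
move=> hG L; have tG := tay_rep hG.
have tb k i : (\forall z \near q, ddzbar k (fun z => ((rho z)%:C)%C) z
      = ev (zt jz jw (z - q)) (der i G)) ->
    tay q (ddzbar k (fun z => ((rho z)%:C)%C))
      (fun j z => ev (zt jz jw (z - q)) (der j (der i G))).
  move=> hk; apply: (tay_ext (tay_rep (rep_der i hG))).
  by apply: filterS hk => z ->.
have hz : tay q (ddzbar jz (fun z => ((rho z)%:C)%C))
    (fun j z => ev (zt jz jw (z - q)) (der j (der 1 G))).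
  by apply: tb; apply: filterS (tay_near tG) => z /tay_ddz [].
have hw : tay q (ddzbar jw (fun z => ((rho z)%:C)%C))
    (fun j z => ev (zt jz jw (z - q)) (der j (der 2 G))).
  by apply: tb; apply: filterS (tay_near tG) => z /tay_ddz [].
pose T k j := ddz k (ddzbar j (fun z => ((rho z)%:C)%C)) q * xi 0 k * cnj (xi 0 j).
have -> : levi_form rho q xi = T jz jz + T jz jw + (T jw jz + T jw jw).
  rewrite [LHS](sum2 (fun k => \sum_j T k j)); congr (_ + _); exact: sum2.
have [e1 _ _ e2] := tay_ddz hz; have [e3 _ _ e4] := tay_ddz hw.
by rewrite addrA; congr (_ + _ + _ + _); congr (_ * _ * _); [exact: e1|exact: e3|exact: e2|exact: e4].
Qed.

Lemma not_jz j : j != jz -> j = jw.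
Proof.
move: jzw; case: j => [[|[|i]] hi] //; case: (jz) => [[|[|a]] ha] //;
  case: (jw) => [[|[|b]] hb] // _ _; exact: val_inj.
Qed.

Lemma to_realB (z q : V) : to_real z - to_real q = to_real (z - q).
Proof.
apply/rowP => i; rewrite !mxE; case: (fintype.split i) => j; rewrite !mxE.
  by case: (z 0 j) (q 0 j) => [a b] [a' b'].
by case: (z 0 j) (q 0 j) => [a b] [a' b'].
Qed.
Lemma to_realK (z : V) : of_real (to_real z) = z.
Proof.
apply/rowP => j; rewrite !mxE (unsplitK (inl j)) (unsplitK (inr j)) !mxE.
by case: (z 0 j).
Qed.
Lemma nm_to_real (z : V) i (d : R) : (forall j, nm (z 0 j) < d) -> `|to_real z 0 i| < d.
Proof.
move=> h; rewrite mxE; case: (fintype.split i) => j; rewrite !mxE; apply: le_lt_trans (h j).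
  exact: nm_Re.
exact: nm_Im.
Qed.

Lemma Re_cnj (x : C) : 2^-1 * (x + cnj x) = ((complex.Re x)%:C)%C.
Proof.
have n20 : (2 : C) != 0 by rewrite pnatr_eq0.
apply: (mulfI n20); rewrite mulVKf // mulr_natl mulr2n.
by case: x => a b; rewrite /cnj; apply/eqP; rewrite eq_complex /= addrN addr0 !eqxx.
Qed.
Lemma Im_cnj (x : C) : (2 * imag R)^-1 * (x - cnj x) = ((complex.Im x)%:C)%C.
Proof.
have n20 : 2 * imag R != 0 by rewrite mulf_neq0 ?imag_neq0 // pnatr_eq0.
apply: (mulfI n20); rewrite mulVKf // -mulrA mulr_natl mulr2n.
case: x => a b; rewrite /cnj; apply/eqP; rewrite eq_complex /=.
by apply/andP; split; apply/eqP; ring.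
Qed.

(** A real-analytic function is the sum of a power series in z, w and their
    conjugates, through Re z = (z + zbar) / 2 and Im z = (z - zbar) / 2i. *)
Lemma real_rep (rho : V -> R) q : real_analytic_at rho q ->
  exists G, rep q (fun z => ((rho z)%:C)%C) G.
Proof.
move=> ha.
have htot (T : choiceType) (u : {fset T} -> R) (l : R) :
    (u @ totally --> l)%classic -> forall e : R, 0 < e ->
    exists A, forall A', fsubset A A' -> nm (((u A' - l)%:C)%C : C) <= e.
  move=> hu e e0; have [A hA] := cvg_totR hu e0; exists A => A' AA'.
  by rewrite nm_real; exact: hA.
have hnbhs m (q' : 'rV[R]_m) (A : set 'rV[R]_m) : nbhs q' A -> exists d : R, 0 < d /\
    forall x : 'rV[R]_m, (forall j, nm (((x 0 j - q' 0 j)%:C)%C : C) < d) -> A x.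
  move=> /nbhs_rowR [d [d0 h]]; exists d; split=> // x hx; apply: h => j.
  by have := hx j; rewrite nm_real.
have hreal (r : R) : exists k : R, ((k%:C)%C : C) = (r%:C)%C by exists r.
have := @analytic_series R R (real_complex R : {rmorphism R -> C}) htot hnbhs hreal.
move=> /(_ _ _ _ ha) [G [cG [d [d0 hG]]]].
pose hv (j : 'I_2) : nat := if j == jz then 0%N else n.
pose av (j : 'I_2) : nat := if j == jz then 1%N else 2%N.
pose i2 : C := (2 * imag R)^-1.
pose g (i : nat) : B C n.+1 := if (i < 2)%N then
    cst n.+1 2^-1 * (var C n.+1 (hv (inord i)) + var C n.+1 (av (inord i)))
  else cst n.+1 i2 * (var C n.+1 (hv (inord (i - 2))) - var C n.+1 (av (inord (i - 2)))).
have cg i : conv (g i).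
  rewrite /g; case: ifP => _; apply: convM; try exact: conv_cst.
    by apply: convD; exact: conv_var.
  by apply: convB; exact: conv_var.
have ag : adm (2 + 2) g.
  move=> i _; rewrite /g; case: ifP => _; apply: ordMl; [apply: ordD|apply: ordB];
  exact: ord_var.
have hvn j : (hv j < n.+1)%N by rewrite /hv; case: eqP.
have avn j : (av j < n.+1)%N by rewrite /av; case: eqP; rewrite n3.
have [cs hs] := near_sub cG (fun i _ => cg i) ag.
exists (sub g G); split=> //.
have evg (k : V) (i : 'I_(2 + 2)) :
    ev (zt jz jw k) (g i) = coord (real_complex R) (to_real k) i.
  pose s i := nm (zt jz jw k i).
  have s0 i' : 0 <= s i' := nm_ge0 _.
  have hx : dom n.+1 s (zt jz jw k) by move=> i' _; exact: lexx.
  have hvE j : zt jz jw k (hv j) = k 0 j.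
    rewrite /hv; case: eqP => [->|/eqP /not_jz ->] //.
    by rewrite /zt n3.
  have avE j : zt jz jw k (av j) = cnj (k 0 j).
    by rewrite /av; case: eqP => [->|/eqP /not_jz ->].
  have cv c := cvs_cst n.+1 s c; have cw c := @cvs_var R n.+1 s s0 c.
  rewrite coord_ord /g; case: (split_ordP i) => j ->.
    have -> : inord (lshift 2 j) = j by exact: inord_val.
    rewrite (evcM s0 hx) ?(evcD s0 hx) //; last exact: cvsD.
    by rewrite ev_cst !ev_var // hvE avE Re_cnj row_mxEl mxE.
  have -> : inord (rshift 2 j - 2) = j by rewrite [(_ - _)%N]addKn inord_val.
  rewrite (evcM s0 hx) ?(evcB s0 hx) //; last exact: cvsB.
  by rewrite ev_cst !ev_var // hvE avE Im_cnj row_mxEr mxE.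
have hd : \forall z \near q, (forall j, nm ((z - q) 0 j) < d).
  apply/nbhs_rowC; exists d; split=> // z hz j; rewrite !mxE; exact: hz.
apply: filterS2 hd (near0_nbhs jz jw q hs) => z zd ->.
have := hG (to_real z) _; rewrite /= to_realK => -> => [|j].
  rewrite to_realB; apply: ev_ext => i i4.
  by have := evg (z - q) (Ordinal i4).
have := nm_to_real j zd; rewrite -to_realB [X in `|X|]mxE [X in _ + X]mxE => h.
suff: nm (((to_real z 0 j - to_real q 0 j)%:C)%C : C) < d by [].
by rewrite nm_real.
Qed.

End Derivatives.

(** * Conjugation of power series *)

Section ConjSeries.
Variable R : realType.
Local Notation C := (Cplx R).
Local Notation B := (B C).

(** Conjugating the coefficients conjugates the values at conjugate points,
    see near_cj. *)
Fixpoint cj n : B n -> B n :=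
  if n is m.+1 then fun f => (fun i => @cj m (f i)) else @cnj R.

Lemma cf_cj n al (f : B n) : cf al (cj f) = cnj (cf al f).
Proof. by elim: n f => [|n IH] f //; exact: (IH (f (al n))). Qed.
Lemma ord_cj n d (f : B n) : ord d f -> ord d (cj f).
Proof. by move=> /ord_cf h; apply/ord_cf => al hal; rewrite cf_cj h // cnj0. Qed.
Lemma cj_zmod n : zmod_morphism (@cj n).
Proof.
elim: n => [|n IH] f g; first exact: cnj_zmod.
by apply/funext => i; exact: IH.
Qed.
Lemma cj_cst n c : cj (cst n c : B n) = cst n (cnj c).
Proof.
elim: n => [|n IH] //; apply/funext => i; rewrite cstS [LHS]/(cj _).
rewrite !cstS; case: i => [|i]; first exact: IH.
by have := cj_zmod (0 : B n) 0; rewrite !subrr.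
Qed.
Lemma cj_var n i : cj (var C n i) = var C n i.
Proof.
have c0 m : cj (0 : B m) = 0 by have := cj_zmod (0 : B m) 0; rewrite !subrr.
have c1 m : cj (1 : B m) = 1.
  by rewrite -(rmorph1 (cst m)) cj_cst; congr (cst _ _); exact: cnj1.
elim: n => [|n IH]; first exact: c0.
rewrite varS; case: (i =P n) => _; apply/funext => k; rewrite [LHS]/(cj _).
  by rewrite /psX /=; case: (k == 1%N); [exact: c1|exact: c0].
by case: k => [|k] /=; [exact: IH|exact: c0].
Qed.
Lemma box_cj n N s (f : B n) : box N s (cj f) = box N s f.
Proof.
elim: n f => [|n IH] f; first exact: nm_cnj.
by rewrite !boxS; apply: eq_bigr => i _; congr (_ * _); exact: IH.
Qed.
Lemma conv_cj n (f : B n) : conv f -> conv (cj f).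
Proof. by move=> [r [c [r0 h]]]; exists r, c; split=> // N; rewrite box_cj. Qed.
Lemma evN_cj n N x (f : B n) : evN N (fun i => cnj (x i)) (cj f) = cnj (evN N x f).
Proof.
elim: n f => [|n IH] f //; rewrite !evNS rmorph_sum; apply: eq_bigr => i _.
by rewrite [RHS]cnjM -IH; congr (_ * _); rewrite [RHS]rmorphXn.
Qed.
Lemma near_cj n (f : B n) : conv f ->
  near0 n (fun x => ev (fun i => cnj (x i)) (cj f) = cnj (ev x f)).
Proof.
move=> [r [c [r0 h]]]; exists r; split=> // x hx; apply: ev_uniq => e e0.
have [|N0 hN] := ev_lim _ hx h e0; first by move=> _; exact: ltW.
exists N0 => N NN; rewrite evN_cj.
by have := hN N NN; rewrite -nm_cnj (cnj_zmod _ _).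
Qed.

End ConjSeries.
Arguments cj : simpl never.

(** * Holomorphic functions and their jets *)

Section Holomorphic.
Variables (R : realType) (jz jw : 'I_2) (jzw : jz != jw).
Local Notation C := (Cplx R).
Local Notation B := (B C).
Local Notation V := 'rV[C]_2.

Definition zc (k : V) (i : nat) : C := if i == 0%N then k 0 jz else k 0 jw.
(** The index of the series variable for the j-th coordinate. *)
Definition ci (j : 'I_2) : nat := if j == jz then 0%N else 1%N.

Lemma zcD (k h : V) i : zc (k + h) i = zc k i + zc h i.
Proof. by rewrite /zc !mxE; case: eqP. Qed.
Lemma zc_le (k : V) e i : (forall j, nm (k 0 j) <= e) -> nm (zc k i) <= e.
Proof. by move=> h; rewrite /zc; case: eqP. Qed.
Lemma zc_ci (k : V) j : zc k (ci j) = k 0 j.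
Proof. by rewrite /ci /zc; case: (j =P jz) => [->|/eqP /(not_jz jzw) ->]. Qed.
Lemma ci2 j : (ci j < 2)%N. Proof. by rewrite /ci; case: eqP. Qed.

Definition hrep (q : V) (f : V -> C) (G : B 2) :=
  conv G /\ \forall z \near q, f z = ev (zc (z - q)) G.

Lemma near0_nbhsc (q : V) (W : (nat -> C) -> Prop) : near0 2 W ->
  \forall z \near q, W (zc (z - q)).
Proof.
move=> [d [d0 h]]; apply/nbhs_rowC; exists d; split=> // z hz.
by apply: h => i _; apply: zc_le => j; rewrite !mxE; exact: ltW.
Qed.

Lemma hol_rep (f : V -> C) q : analytic_at f q -> exists G, hrep q f G.
Proof.
move=> ha.
have hnbhs m (q' : 'rV[C]_m) (A : set 'rV[C]_m) : nbhs q' A -> exists d : R, 0 < d /\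
    forall x : 'rV[C]_m, (forall j, nm (x 0 j - q' 0 j) < d) -> A x.
  by move=> /nbhs_rowC.
have hreal (r : R) : exists k : C, k = (r%:C)%C by exists (r%:C)%C.
have := @analytic_series R C (idfun : {rmorphism C -> C}) (@cvg_totC R) hnbhs hreal.
move=> /(_ _ _ _ ha) [G [cG [d [d0 hG]]]].
pose g (i : nat) : B 2 := var C 2 (ci (inord i)).
have cg i : (i < 2)%N -> conv (g i) by move=> _; exact: conv_var.
have ag : adm 2 g by move=> i _; exact: ord_var.
have [cs hs] := near_sub cG cg ag.
exists (sub g G); split=> //.
have hd : \forall z \near q, (forall j, nm ((z - q) 0 j) < d).
  by apply/nbhs_rowC; exists d; split=> // z hz j; rewrite !mxE; exact: hz.
apply: filterS2 hd (near0_nbhsc q hs) => z zd ->.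
have := hG z _; rewrite /= => -> => [|j]; last by have := zd j; rewrite !mxE.
apply: ev_ext => i i2; have := coord_ord idfun (z - q) (Ordinal i2); rewrite /= => ->.
rewrite /g ev_var ?ci2 // zc_ci; congr ((z - q) 0 _).
by apply: val_inj; rewrite /= inordK.
Qed.

Lemma derive_hrep (F : V -> V) p (G : 'I_2 -> B 2) i :
  (forall j, hrep p (fun z => F z 0 j) (G j)) ->
  forall j, hrep p (fun z => ('D_(delta_mx 0 i) F z) 0 j) (der (ci i) (G j)).
Proof.
move=> hF.
have key : \forall z \near p, 'D_(delta_mx 0 i) F z = \row_j ev (zc (z - p)) (der (ci i) (G j)).
  have hj j : exists d K, [/\ 0 < d, 0 <= K & forall (z h : V) eta,
      (forall l, nm (z 0 l - p 0 l) < d) -> (forall l, nm (h 0 l) <= eta) -> eta <= d ->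
      nm (F (z + h) 0 j - F z 0 j - \sum_(l < 2) ev (zc (z - p)) (der l (G j)) * zc h l)
        <= K * eta ^+ 2].
    have [cG /nbhs_rowC [d [d0 hd]]] := hF j.
    have [d1 [K1 [d10 K10 h1]]] := conv_taylor cG.
    pose e := Num.min d1 (d / 2).
    have e0 : 0 < e by rewrite lt_min d10 divr_gt0.
    have ed1 : e <= d1 by rewrite ge_min lexx.
    have ed2 : e + e <= d.
      by rewrite [leRHS]splitr; apply: lerD; rewrite ge_min lexx orbT.
    exists e, K1; split=> // z h eta hz hh he.
    have hz2 l : nm (z 0 l - p 0 l) < d.
      by apply: lt_le_trans (hz l) _; apply: le_trans ed2; rewrite lerDl ltW.
    have hz3 l : nm ((z + h) 0 l - p 0 l) < d.
      rewrite mxE addrAC; apply: le_lt_trans (nmD _ _) _; apply: lt_le_trans ed2.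
      by apply: ltr_leD (hz l) _; exact: le_trans (hh l) he.
    rewrite (hd _ hz2) (hd _ hz3).
    have E : ev (zc (z + h - p)) (G j) = ev (fun i => zc (z - p) i + zc h i) (G j).
      by apply: ev_ext => l _; rewrite -zcD addrAC.
    rewrite E; apply: h1; last exact: le_trans he ed1.
      move=> l _; apply: le_trans ed1; apply: zc_le => l'; rewrite !mxE; exact: ltW.
    by move=> l _; exact: zc_le.
  have hall : exists d K, [/\ 0 < d, 0 <= K & forall j (z h : V) eta,
      (forall l, nm (z 0 l - p 0 l) < d) -> (forall l, nm (h 0 l) <= eta) -> eta <= d ->
      nm (F (z + h) 0 j - F z 0 j - \sum_(l < 2) ev (zc (z - p)) (der l (G j)) * zc h l)
        <= K * eta ^+ 2].
    have [d1 [K1 [d10 K10 h1]]] := hj jz; have [d2 [K2 [d20 K20 h2]]] := hj jw.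
    exists (Num.min d1 d2), (K1 + K2); split; [by rewrite lt_min d10|exact: addr_ge0|].
    move=> j z h eta hz hh; rewrite le_min => /andP [e1 e2]; rewrite mulrDl.
    case: (j =P jz) => [->|/eqP /(not_jz jzw) ->].
      apply: le_trans (h1 z h eta _ hh e1) _.
        by move=> l; apply: lt_le_trans (hz l) _; rewrite ge_min lexx.
      by rewrite lerDl mulr_ge0 // exprn_even_ge0.
    apply: le_trans (h2 z h eta _ hh e2) _.
      by move=> l; apply: lt_le_trans (hz l) _; rewrite ge_min lexx orbT.
    by rewrite lerDr mulr_ge0 // exprn_even_ge0.
  have [d [K [d0 K0 hT]]] := hall.
  apply/nbhs_rowC; exists d; split=> // z hz.
  apply: cvg_lim; first exact: norm_hausdorff.
  move=> A /nbhs_rowC [e [e0 hA]].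
  have K1 : 0 < K + 1 by rewrite ltr_wpDl.
  pose d2 := Num.min d (e / (K + 1)).
  have d20 : 0 < d2 by rewrite lt_min d0 divr_gt0.
  apply/nbhs_ballP; exists ((d2%:C)%C : C) => /=; first by rewrite ltcR.
  move=> t; rewrite ball_cE sub0r nmN => td t0; apply: hA => j.
  have tj l : nm ((t *: (delta_mx 0 i : V)) 0 l) <= nm t.
    rewrite mxE nmM mxE; case: (_ && _); last by rewrite nm0 mulr0 nm_ge0.
    by rewrite nm1 mulr1.
  have td1 : nm t <= d by apply: le_trans (ltW td) _; rewrite ge_min lexx.
  have {}hT := hT j z (t *: delta_mx 0 i) (nm t) hz tj td1.
  rewrite !mxE /=.
  have S : \sum_(l < 2) ev (zc (z - p)) (der l (G j)) * zc (t *: delta_mx 0 i) l =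
      t * ev (zc (z - p)) (der (ci i) (G j)).
    rewrite !big_ord_recr big_ord0 /= add0r /zc /= !mxE !eqxx /=.
    rewrite /ci; case: (i =P jz) => [->|/eqP].
      by rewrite eqxx eq_sym (negbTE jzw) /= mulr0n mulr1n mulr1 mulr0 mulr0 addr0 mulrC.
    move=> ij; rewrite eq_sym (negbTE ij) (not_jz jzw ij) eqxx /=.
    by rewrite mulr0n mulr1n mulr0 mulr0 mulr1 add0r mulrC.
  rewrite S in hT.
  have -> : t^-1 * (F (t *: delta_mx 0 i + z) 0 j - F z 0 j) - ev (zc (z - p)) (der (ci i) (G j))
    = t^-1 * (F (z + t *: delta_mx 0 i) 0 j - F z 0 j - t * ev (zc (z - p)) (der (ci i) (G j))).
    by rewrite [RHS]mulrBr mulKf // [_ + z]addrC.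
  have nt : 0 < nm t by rewrite nm_gt0.
  rewrite nmM nmV mulrC ltr_pdivrMr //.
  apply: le_lt_trans hT _; rewrite expr2 mulrA ltr_pM2r //.
  have : nm t < e / (K + 1) by apply: lt_le_trans td _; rewrite ge_min lexx orbT.
  rewrite ltr_pdivlMr // => h; apply: le_lt_trans h.
  by rewrite mulrC ler_wpM2l ?nm_ge0 // lerDl.
move=> j; have [cG _] := hF j; split; first exact: conv_der.
by apply: filterS key => z ->; rewrite mxE.
Qed.

Lemma iter_hrep (F : V -> V) p (G : 'I_2 -> B 2) s :
  (forall j, hrep p (fun z => F z 0 j) (G j)) ->
  forall j, hrep p (fun z => (iter_partial s F z) 0 j)
    (foldr (fun i => der (ci i)) (G j) s).
Proof. by move=> hF; elim: s => [|i s IH] //=; exact: derive_hrep IH. Qed.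

Lemma hrep_val p f G : hrep p f G -> cf (fun=> 0%N) G = f p.
Proof.
move=> [_ /nbhs_singleton ->]; rewrite -ev_at0; apply: ev_ext => i _.
by rewrite subrr /zc !mxE; case: eqP.
Qed.

(** The components of the iterated partial derivatives are given by the
    iterated derivatives of the series, whose constant terms are the
    coefficients up to factorials. *)
Lemma jet_ord (F F' : V -> V) p G G' k : jet k p F = jet k p F' ->
  (forall j, hrep p (fun z => F z 0 j) (G j)) ->
  (forall j, hrep p (fun z => F' z 0 j) (G' j)) ->
  forall j, ord k.+1 (G j - G' j).
Proof.
move=> hj hF hF' j.
pose it s (f : B 2) := foldr (fun i => der (ci i)) f s.
have itB s f g : it s (f - g) = it s f - it s g by elim: s => [|i s IH] //=; rewrite IH derB.
apply: (@der_graded_ord R 2 (fun m f => forall s, (size s <= m)%N -> cf (fun=> 0%N) (it s f) = 0)).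
- move=> m f i i2 h s hs.
  have -> : it s (der i f) = it (rcons s (if i == 0%N then jz else jw)) f.
    rewrite /it -cats1 foldr_cat /=; congr foldr; rewrite /ci.
    case: i i2 => [|[|i]] //= _; first by rewrite eqxx.
    by rewrite eq_sym (negbTE jzw).
  by apply: h; rewrite size_rcons.
- by move=> m f h; exact: (h [::]).
move=> s hs; rewrite itB; have := congr1 (fun J : k.-bseq 'I_2 -> V => J (Bseq hs) 0 j) hj.
rewrite /jet /= -(hrep_val (iter_hrep s hF j)) -(hrep_val (iter_hrep s hF' j)) => e.
have := raddfB (@cf C 2 (fun=> 0%N)) (it s (G j)) (it s (G' j)) => ->.
by apply/eqP; rewrite subr_eq0; apply/eqP.
Qed.

End Holomorphic.

(** * Graphs: the hypersurface w = Q(z, zbar, wbar) *)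

(** psC regards a series in n variables as one in n.+1 variables that does
    not contain the last one. *)
Lemma evN_psC (R : realType) n N x (D : B (Cplx R) n) :
  evN N.+1 x (psC D : B (Cplx R) n.+1) = evN N.+1 x D.
Proof.
rewrite evNS big_ord_recl big1 => [|i _]; first by rewrite addr0 expr0 mulr1 psCE.
by rewrite psCE /= raddf0 mul0r.
Qed.
Lemma ev_psC (R : realType) n x (D : B (Cplx R) n) :
  ev x (psC D : B (Cplx R) n.+1) = ev x D.
Proof.
rewrite /ev; congr xget; apply/predeqP => y; split=> hy e e0;
  have [N0 hN] := hy e e0; exists (maxn N0 1) => -[|N] NN;
  by [move: NN; rewrite geq_max andbF|have := hN N.+1 (leq_trans (leq_maxl _ _) NN);
      rewrite evN_psC].
Qed.
Lemma conv_psC (R : realType) n (D : B (Cplx R) n) : conv D ->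
  conv (psC D : B (Cplx R) n.+1).
Proof.
move=> [r [c [r0 h]]]; exists r, c; split=> // N.
case: N => [|N]; first by rewrite boxS big_ord0; apply: le_trans (h 0%N); apply: box_ge0 => i; exact: ltW.
rewrite boxS big_ord_recl big1 => [|i _]; first by rewrite addr0 expr0 mulr1 psCE; exact: h.
by rewrite psCE /= box0 mul0r.
Qed.
Lemma der_psC (F : numFieldType) n i (D : B F n) : (i < n)%N ->
  der i (psC D : B F n.+1) = psC (der i D).
Proof.
move=> ni; rewrite derS ltn_eqF //; apply/funext => k; rewrite !psCE.
by case: eqP => // _; rewrite raddf0.
Qed.
Lemma dern_psC (F : numFieldType) n (D : B F n) : der n (psC D : B F n.+1) = 0.
Proof. by rewrite derS eqxx; apply: psP => k; rewrite /psder psCE /= mul0rn. Qed.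

Lemma ev_opp (R : realType) n (x : nat -> Cplx R) (f : B (Cplx R) n) : ev x (- f) = - ev x f.
Proof.
have hN N (g : B (Cplx R) n) : evN N x (- g) = - evN N x g by exact: raddfN.
have lim (g : B (Cplx R) n) y : (forall e : R, 0 < e -> exists N0, forall N, (N0 <= N)%N ->
    nm (evN N x g - y) <= e) -> ev x (- g) = - y.
  move=> hy; apply: ev_uniq => e e0; have [N0 h] := hy e e0; exists N0 => N /h.
  by rewrite (hN N g) -opprD nmN.
case: (pselect (exists y, forall e : R, 0 < e -> exists N0, forall N, (N0 <= N)%N ->
    nm (evN N x f - y) <= e)) => [[y hy]|hno].
  by rewrite (lim f y hy) (ev_uniq hy).
rewrite {1}/ev xgetPN => [|y hy].
  by rewrite /ev xgetPN ?oppr0 // => y hy; apply: hno; exists y.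
apply: hno; exists (- y) => e e0; have [N0 h] := hy e e0; exists N0 => N /h.
by rewrite (hN N f) -opprD nmN opprK.
Qed.

Section Graph.
Variables (R : realType) (n : nat) (n3 : n = 3%N) (jz jw : 'I_2) (jzw : jz != jw).
Local Notation C := (Cplx R).
Local Notation B := (B C).
Local Notation V := 'rV[C]_2.
Local Notation lin := (@lin R n jz jw).
Local Notation tay := (@tay R n jz jw).
Local Notation rep := (@rep R n jz jw).
Local Notation zt := (@zt R jz jw).

Let lt0n : (0 < n)%N. Proof. by rewrite n3. Qed.
Let lt1n : (1 < n)%N. Proof. by rewrite n3. Qed.
Let lt2n : (2 < n)%N. Proof. by rewrite n3. Qed.

Lemma tay_ser q (G : B n.+1) : conv G ->
  tay q (fun z => ev (zt (z - q)) G) (fun i z => ev (zt (z - q)) (der i G)).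
Proof. by move=> cG; apply: tay_rep; split=> //; apply: filterE. Qed.

Lemma ev_center (q : V) m (G : B m) : ev (zt (q - q)) G = cf (fun=> 0%N) G.
Proof. by rewrite -ev_at0; apply: ev_ext => i _; rewrite subrr zt0. Qed.

Lemma tay_neq0 q g dg : tay q g dg -> g q != 0 -> \forall z \near q, g z != 0.
Proof.
move=> [d [K [d0 K0 h]]] gq; have g0 : 0 < nm (g q) by rewrite nm_gt0.
pose e := Num.min d (nm (g q) / (K + 1)).
have K1 : 0 < K + 1 by rewrite ltr_wpDl.
have e0 : 0 < e by rewrite lt_min d0 divr_gt0.
apply/nbhs_rowC; exists e; split=> // z hz; apply/eqP => gz.
pose eta := Num.max (nm (z 0 jz - q 0 jz)) (nm (z 0 jw - q 0 jw)).
have etae : eta < e by rewrite gt_max !hz.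
have [|||_ + _] := h q (z - q) eta.
- by move=> j; rewrite subrr nm0.
- move=> j; rewrite !mxE le_max.
  by case: (j =P jz) => [->|/eqP /(not_jz jzw) ->]; rewrite lexx ?orbT.
- by apply: le_trans (ltW etae) _; rewrite ge_min lexx.
rewrite [q + _]addrC subrK gz sub0r nmN leNgt => /negP; apply.
have : eta < nm (g q) / (K + 1) by apply: lt_le_trans etae _; rewrite ge_min lexx orbT.
rewrite ltr_pdivlMr // => h1; apply: le_lt_trans h1; rewrite mulrC ler_wpM2l ?lerDl //.
by rewrite le_max nm_ge0.
Qed.

Lemma lin_neq0 c i : (i < n.+1)%N -> c i != 0 -> exists nu, lin c nu != 0.
Proof.
move=> ni ci0; apply: contrapT => hno; move/eqP: ci0; apply.
apply: (lin_indep n3 jzw) ni => h; apply/eqP; apply: contrapT => hn.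
by apply: hno; exists h; apply/negP.
Qed.

Variables (p : V) (rho : V -> R) (P : B n.+1).
Hypothesis hP : rep p (fun z => ((rho z)%:C)%C) P.
Hypothesis rho0 : rho p = 0.
Hypothesis Pw : cf (fun=> 0%N) (der n P) != 0.

Lemma defining_cf0 : cf (fun=> 0%N) P = 0.
Proof.
have [_ /nbhs_singleton] := hP.
by rewrite ev_center rho0 => <-.
Qed.
Let P0 := defining_cf0.
Let Pc : conv P. Proof. by case: hP. Qed.
Definition graphQ : B n := implicit P.
Local Notation Q := graphQ.

Lemma graphQ_conv : conv Q. Proof. exact: implicit_conv. Qed.
Lemma graphQ_ord1 : ord 1 Q. Proof. exact: implicit_ord1. Qed.

Lemma graphP : \forall z \near p, rho z = 0 <-> zt (z - p) n = ev (zt (z - p)) Q.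
Proof.
have h1 := near0_nbhs jz jw p (implicit_graph Pc P0 Pw).
have h2 := near0_nbhs jz jw p (implicit_zero Pc P0 Pw).
have [_ h3] := hP.
apply: filterS3 h1 h2 h3 => z g1 g2 e; split=> [r0|/g2].
  by apply: g1; rewrite -e r0.
by rewrite -e => -[].
Qed.

Definition graphS : B n.+1 := var C n.+1 n - psC Q.
Local Notation S := graphS.
Lemma graphS_conv : conv S.
Proof. by apply: convB; [exact: conv_var|apply: conv_psC; exact: graphQ_conv]. Qed.
Lemma graphS_der i : (i < n)%N -> der i S = - psC (der i Q).
Proof.
move=> ni; rewrite /S derB der_psC // der_var // eq_sym ltn_eqF //.
exact: sub0r.
Qed.
Lemma graphS_dern : der n S = 1.
Proof. by rewrite /S derB dern_psC der_var // eqxx subr0. Qed.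

Lemma graphS_zero : \forall z \near p, rho z = 0 -> ev (zt (z - p)) S = 0.
Proof.
have h := near0_nbhs jz jw p (near_ev (conv_var R n.+1 n) (conv_psC graphQ_conv)).
apply: filterS2 graphP h => z g [_ e _] /g e2.
by rewrite e ev_var // e2 ev_psC subrr.
Qed.

(** Let D vanish on the hypersurface. Its differential is there a multiple
    b drho, and comparing the coefficients of dw gives b = 0. So the
    derivatives of D vanish on the hypersurface too, and all coefficients
    of D vanish. *)
Lemma graph_vanish (D : B n) : conv D ->
  (\forall z \near p, rho z = 0 -> ev (zt (z - p)) D = 0) -> D = 0.
Proof.
move=> cD hD; apply: (@der_closed_eq0 R n (fun D => conv D /\
  \forall z \near p, rho z = 0 -> ev (zt (z - p)) D = 0)) => // {D cD hD} D; last first.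
  by move=> [_ /nbhs_singleton /(_ rho0)]; rewrite ev_center.
move=> i ni [cD hD]; split; first exact: conv_der.
have tP := tay_near (tay_rep hP).
have tD := tay_near (tay_ser p (conv_psC cD)).
have hw : \forall z \near p, ev (zt (z - p)) (der n P) != 0.
  by apply: (tay_neq0 (tay_ser p (conv_der n Pc))); rewrite ev_center.
have hD' := nbhs_interior hD.
apply: filterS2 (filterI tP tD) (filterI hw hD') => z [tPz tDz] [wz Dz] rz.
have [||b hb] := tangent_at n3 jzw tPz tDz rz.
- exact: lin_neq0 (ltnSn n) wz.
- by apply: filterS Dz => y + ry; rewrite ev_psC; apply.
have := hb n (ltnSn n); rewrite dern_psC ev0 => /esym /eqP.
rewrite mulf_eq0 (negbTE wz) orbF => /eqP b0.
by have := hb i (leqW ni); rewrite b0 mul0r der_psC // ev_psC.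
Qed.

(** The differential of w - Q is a nonzero multiple of that of rho, which
    is real: its coefficients at wbar and w are conjugate, hence both
    nonzero. *)
Lemma graphQ_tau : cf (fun=> 0%N) (der 2 Q) != 0.
Proof.
have tP := tay_rep hP.
have [||b hb] := tangent_at n3 jzw tP (tay_ser p graphS_conv) rho0.
- by apply: (lin_neq0 (ltnSn n)); rewrite ev_center.
- exact: graphS_zero.
have := hb n (ltnSn n); rewrite graphS_dern evc1 => b1.
have := hb 2%N (leqW lt2n); rewrite graphS_der // !ev_center.
have [_] := lin_real n3 jzw (tay_real tP); rewrite !ev_center => ->.
rewrite raddfN /= => e; have {}e : cf (fun=> 0%N) (der 2 Q) = - (b * cnj (cf (fun=> 0%N) (der n P))).
  by rewrite -e opprK.
rewrite e oppr_eq0 mulf_neq0 //.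
  by apply: contraPneq b1 => ->; rewrite mul0r => /eqP; rewrite oner_eq0.
by rewrite -nm_gt0 nm_cnj nm_gt0.
Qed.

End Graph.

(** * The Levi determinant *)

(** The computation at one point, in which the c's and l's are the first
    and second derivatives of a defining function, the q's those of Q, and
    (xz, xw), (x, y) a complex tangent vector and its conjugate. *)
Lemma levi_algebra (F : fieldType)
    (c0 c1 c2 c3 qz q1 q2 qz1 qz2 b b' l01 l02 l31 l32 x y xz xw : F) :
  c0 * xz + c3 * xw = 0 -> c1 * x + c2 * y = 0 ->
  1 = b * c3 -> - qz = b * c0 -> - q1 = b * c1 -> - q2 = b * c2 -> q2 != 0 ->
  q1 * qz2 - q2 * qz1 = 0 ->
  l01 + (qz1 * c3 + qz * l31) = b' * c1 -> l02 + (qz2 * c3 + qz * l32) = b' * c2 ->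
  l01 * xz * x + l02 * xz * y + l31 * xw * x + l32 * xw * y = 0.
Proof.
move=> A1 A2 B3 B0 B1 B2 q20 D E1 E2.
have xwE : xw = qz * xz.
  have e : xw = b * c3 * xw by rewrite -B3 mul1r.
  have e' : b * c3 * xw = b * (c0 * xz + c3 * xw) - b * c0 * xz by ring.
  by rewrite e e' A1 -B0; ring.
have K : qz1 * x + qz2 * y = 0.
  apply: (mulfI q20); rewrite mulr0.
  have -> : q2 * (qz1 * x + qz2 * y) =
     - qz2 * (- q1 * x + - q2 * y) - x * (q1 * qz2 - q2 * qz1) by ring.
  rewrite D B1 B2.
  have -> : b * c1 * x + b * c2 * y = b * (c1 * x + c2 * y) by ring.
  by rewrite A2; ring.
have e1 : l01 = b' * c1 - (qz1 * c3 + qz * l31) by rewrite -E1 addrK.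
have e2 : l02 = b' * c2 - (qz2 * c3 + qz * l32) by rewrite -E2 addrK.
rewrite e1 e2 xwE [LHS](_ : _ = xz * (b' * (c1 * x + c2 * y) - c3 * (qz1 * x + qz2 * y))).
  by rewrite A2 K !mulr0 subrr mulr0.
by ring.
Qed.

Section Levi.
Variables (R : realType) (n : nat) (n3 : n = 3%N) (jz jw : 'I_2) (jzw : jz != jw).
Local Notation C := (Cplx R).
Local Notation B := (B C).
Local Notation V := 'rV[C]_2.
Local Notation lin := (@lin R n jz jw).
Local Notation tay := (@tay R n jz jw).
Local Notation rep := (@rep R n jz jw).
Local Notation zt := (@zt R jz jw).

Let lt0n : (0 < n)%N. Proof. by rewrite n3. Qed.
Let lt1n : (1 < n)%N. Proof. by rewrite n3. Qed.
Let lt2n : (2 < n)%N. Proof. by rewrite n3. Qed.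

(** Both xi and - i xi are tangent, so the parts of drho(xi) linear and
    antilinear in xi vanish separately. *)
Lemma ctangent_split (rho : V -> R) drho q xi :
  tay q (fun z => ((rho z)%:C)%C) drho -> ctangent rho q xi ->
  drho 0%N q * xi 0 jz + drho n q * xi 0 jw = 0 /\
  drho 1%N q * cnj (xi 0 jz) + drho 2%N q * cnj (xi 0 jw) = 0.
Proof.
move=> ht [t1 [v t2 e]].
have l0 u : tangent rho q u -> lin (drho^~ q) u = 0.
  move=> tu; have [hr _] := tay_rderive u ht.
  have e1 : rderive u (fun z => complex.Re (((rho z)%:C)%C : C)) q = rderive u rho q by [].
  rewrite e1 tu in hr.
  by rewrite (Im0_real (tay_real ht u)) -hr.
have h1 := l0 _ t1; have h2 := l0 _ t2.
move: h1; rewrite -e !(linE n3) in h2 *; rewrite !mxE !cnjM cnj_imag => h1.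
have h3 := congr1 ( *%R (imag R)) h2; rewrite mulr0 in h3.
have n20 : (2 : C) != 0 by rewrite pnatr_eq0.
split; apply: (mulfI n20); rewrite mulr0; [rewrite -[RHS](addr0 0) -{1}h1 -h3|
  rewrite -[RHS](subr0 0) -{1}h1 -h3]; ring.
Qed.

Variables (p : V) (rho : V -> R) (P : B n.+1).
Hypothesis hP : rep p (fun z => ((rho z)%:C)%C) P.
Hypothesis rho0 : rho p = 0.
Hypothesis Pw : cf (fun=> 0%N) (der n P) != 0.
Local Notation Q := (graphQ P).
Local Notation S := (graphS P).

(** On the hypersurface, rho'_z + Q_z rho'_w = 0 for every defining
    function rho'. Differentiating this along an antiholomorphic tangent
    vector expresses the Levi form of rho' by the determinant of Q. *)
Lemma levi_degenerate (M : set V) :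
  (\forall z \near p, M z -> rho z = 0) -> levi_det Q = 0 ->
  exists U : set V, open_nbhs p U /\ levi_flat (M `&` U)%classic.
Proof.
move=> hM Q0.
have Qc := graphQ_conv hP rho0 Pw; have Sc := graphS_conv hP rho0 Pw.
have cQ i : conv (der i Q) by exact: conv_der.
have cQ2 i j : conv (der i (der j Q)) by apply: conv_der.
have cz : conv (psC (der 0 Q) : B n.+1) by exact: conv_psC.
have a1 := tay_near (tay_ser jz jw p Sc).
have a2 := tay_near (tay_ser jz jw p cz).
have a3 : \forall z \near p, ev (zt (z - p)) (der 2 Q) != 0.
  have := tay_neq0 (jz := jz) (jw := jw) jzw (tay_ser jz jw p (conv_psC (cQ 2%N))).
  rewrite ev_psC ev_center => /(_ (graphQ_tau n3 jzw hP rho0 Pw)).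
  by apply: filterS => z; rewrite ev_psC.
have a4 : \forall z \near p, ev (zt (z - p)) (der 1 Q) * ev (zt (z - p)) (der 2 (der 0 Q))
    - ev (zt (z - p)) (der 2 Q) * ev (zt (z - p)) (der 1 (der 0 Q)) = 0.
  have e1 := near_ev (cQ 1%N) (cQ2 2%N 0%N); have e2 := near_ev (cQ 2%N) (cQ2 1%N 0%N).
  have e3 := near_ev (convM (cQ 1%N) (cQ2 2%N 0%N)) (convM (cQ 2%N) (cQ2 1%N 0%N)).
  have := near0_nbhs jz jw p (near0_widen (near0_and e1 (near0_and e2 e3))).
  apply: filterS => z [[_ _ f1] [[_ _ f2] [_ f3 _]]]; rewrite -f1 -f2 -f3.
  by rewrite (derC 2 0) (derC 1 0) -/(levi_det Q) Q0 ev0.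
have a5 : \forall z \near p, M z -> ev (zt (z - p)) S = 0.
  apply: filterS2 hM (graphS_zero hP rho0 Pw) => z h1 h2 Mz; exact: h2 (h1 Mz).
have hA := filterI (filterI a1 a2) (filterI a3 (filterI a4 a5)).
set A := (X in nbhs p X) in hA.
exists (interior A); split.
  by split; [exact: open_interior|exact: hA].
move=> U rho' [Uo ra rd hU] q [Mq Aq] Uq xi hxi.
have [[t1 t2] [n2 [Dq _]]] := nbhs_singleton Aq.
have nU : \forall z \near q, U z by exact: open_nbhs_nbhs.
have nA : nbhs q (interior A) by apply: open_nbhs_nbhs; split=> //; exact: open_interior.
have [G hG] := real_rep n3 jzw (ra q Uq).
have [cG _] := hG.
have rq : rho' q = 0.
  have : ((M `&` interior A) `&` U)%classic q by [].
  by rewrite hU => -[].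
have hz : \forall z \near q, rho' z = 0 -> ev (zt (z - p)) S = 0.
  apply: filterS2 nU nA => z Uz Az rz.
  have : (U `&` [set z | rho' z = 0])%classic z by [].
  rewrite -hU => -[[Mz _] _].
  by have [_ [_ [_ h]]] := nbhs_singleton Az; exact: h.
have nu z dr : tay z (fun z => ((rho' z)%:C)%C) dr -> U z -> exists nu, lin (dr^~ z) nu != 0.
  move=> ht Uz; have [v hv] := rd z Uz; exists v; apply: contraNneq hv => l0.
  have [hr _] := tay_rderive v ht; rewrite l0 in hr.
  by apply/eqP; exact: hr.
have tG := tay_rep hG.
pose c i := ev (zt (q - q)) (der i G).
pose dS z i := ev (zt (z - p)) (der i S).
have step z : tay z (fun z => ((rho' z)%:C)%C) (fun i z => ev (zt (z - q)) (der i G)) ->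
    tay z (fun z => ev (zt (z - p)) S) (fun i z => ev (zt (z - p)) (der i S)) ->
    U z -> rho' z = 0 -> (\forall y \near z, rho' y = 0 -> ev (zt (y - p)) S = 0) ->
    exists b, forall i, (i < n.+1)%N -> dS z i = b * ev (zt (z - q)) (der i G).
  by move=> h1 h2 Uz rz hy; exact: (tangent_at n3 jzw h1 h2 rz (nu _ _ h1 Uz) hy).
have dSi z i : (i < n)%N -> dS z i = - ev (zt (z - p)) (der i Q).
  by move=> ni; rewrite /dS graphS_der // ev_opp ev_psC.
have dSn z : dS z n = 1 by rewrite /dS graphS_dern evc1.
pose e z := ev (zt (z - q)) (der 0 G) +
  ev (zt (z - p)) (psC (der 0 Q) : B n.+1) * ev (zt (z - q)) (der n G).
have te := tay_add (tay_ser jz jw q (conv_der 0 cG))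
  (tay_mul t2 (tay_ser jz jw q (conv_der n cG))).
have he : \forall z \near q, rho' z = 0 -> e z = 0.
  have hz' := nbhs_interior hz.
  apply: filterS2 (filterI (tay_near tG) (tay_near t1)) (filterI nU hz') => z [u1 u2] [Uz hy] rz.
  have [b hb] := step z u1 u2 Uz rz hy.
  have b1 := hb n (ltnSn n); rewrite dSn in b1.
  have b0 : b != 0.
    by apply: contraPneq b1 => ->; rewrite mul0r => /eqP; rewrite oner_eq0.
  apply: (mulfI b0); rewrite mulr0 /e mulrDr mulrCA -b1 mulr1 ev_psC.
  by rewrite -(hb 0%N) ?(leqW lt0n) // dSi // addNr.
have [b hb] := step q tG t1 Uq rq hz.
have [b' hb'] := tangent_at n3 jzw tG te rq (nu _ _ tG Uq) he.
rewrite (levi_series n3 jzw xi hG).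
have [x1 x2] := ctangent_split tG hxi.
have b1 := hb n (ltnSn n); rewrite dSn in b1.
have h0 := hb 0%N (leqW lt0n); have h1 := hb 1%N (leqW lt1n); have h2 := hb 2%N (leqW lt2n).
rewrite dSi // in h0; rewrite dSi // in h1; rewrite dSi // in h2.
have k1 := hb' 1%N (leqW lt1n); have k2 := hb' 2%N (leqW lt2n).
rewrite !der_psC // !ev_psC in k1 k2.
rewrite (derC 0 1) (derC 0 2) (derC n 1) (derC n 2).
exact: (levi_algebra x1 x2 b1 h0 h1 h2 n2 Dq k1 k2).
Qed.

End Levi.

(** * Holomorphic maps and hypersurfaces *)

Section Maps.
Variables (R : realType) (n : nat) (n3 : n = 3%N) (jz jw : 'I_2) (jzw : jz != jw).
Local Notation C := (Cplx R).
Local Notation B := (B C).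
Local Notation V := 'rV[C]_2.
Local Notation lin := (@lin R n jz jw).
Local Notation tay := (@tay R n jz jw).
Local Notation rep := (@rep R n jz jw).
Local Notation hrep := (@hrep R jz jw).
Local Notation zt := (@zt R jz jw).
Local Notation zc := (@zc R jz jw).

Definition hmap (p : V) (H : V -> V) (Phi : nat -> B 2) :=
  [/\ forall i, (i < 2)%N -> conv (Phi i), adm 2 Phi &
      \forall z \near p, forall i, (i < 2)%N -> zc (H z - H p) i = ev (zc (z - p)) (Phi i)].

Lemma hmap_of (p : V) (H : V -> V) (G : 'I_2 -> B 2) :
  (forall j, hrep p (fun z => H z 0 j) (G j)) ->
  hmap p H (fun i => G (if i == 0%N then jz else jw) - cst 2 (zc (H p) i)).
Proof.
move=> hG; have cG j : conv (G j) by case: (hG j).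
have h1 j : \forall z \near p, ev (zc (z - p)) (G j - cst 2 (H p 0 j)) = H z 0 j - H p 0 j.
  have [_ h] := hG j.
  have h2 := near0_nbhsc jz jw p (near_ev (cG j) (@conv_cst R 2 (H p 0 j))).
  by apply: filterS2 h h2 => z -> [_ -> _]; rewrite ev_cst.
split=> [i _|i _|]; first by apply: convB => //; exact: conv_cst.
  apply: cf0_ord1; rewrite raddfB /= -[cf _ (cst 2 _)]ev_at0 ev_cst (hrep_val (hG _)).
  by rewrite /zc; case: (i == 0%N); rewrite subrr.
apply: filterS2 (h1 jz) (h1 jw) => z e1 e2 [|[|i]] // _.
  by transitivity (H z 0 jz - H p 0 jz); [rewrite /zc /= !mxE|exact: esym e1].
by transitivity (H z 0 jw - H p 0 jw); [rewrite /zc /= !mxE|exact: esym e2].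
Qed.

Lemma nbhs_zc (q : V) (W : set V) : nbhs q W <->
  exists d, 0 < d /\ forall z : V, (forall i, (i < 2)%N -> nm (zc (z - q) i) < d) -> W z.
Proof.
split=> [/nbhs_rowC [d [d0 h]]|[d [d0 h]]]; [|apply/nbhs_rowC]; exists d; split=> // z hz; apply: h.
  by move=> j; have := hz (ci jz j) (ci2 jz j); rewrite (zc_ci jzw) !mxE.
by move=> i _; rewrite /zc !mxE; case: (i == 0%N); exact: hz.
Qed.

Lemma hmap_cont p H Phi (W : set V) : hmap p H Phi -> nbhs (H p) W ->
  \forall z \near p, W (H z).
Proof.
move=> [cP aP hP] /nbhs_zc [d [d0 hd]].
have d20 : 0 < d / 2 by rewrite divr_gt0.
apply: filterS2 hP (near0_nbhsc jz jw p (near_small d20 cP aP)) => z e s.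
apply: hd => i i2; rewrite e //; apply: le_lt_trans (s i i2) _.
by rewrite ltr_pdivrMr // ltr_pMr // ltr1n.
Qed.

Lemma hmap_comp p H G Phi Gam : hmap p H Phi -> hmap (H p) G Gam ->
  hmap p (fun z => G (H z)) (fun i => sub Phi (Gam i)).
Proof.
move=> hH [cG aG hG]; have [cP aP hP] := hH.
have hs i (i2 : (i < 2)%N) := near_sub (cG i i2) cP aP.
split=> [i i2|i i2|]; first by have [] := hs i i2.
  exact: sub_ord (aG i i2).
have hc : \forall z \near p, forall i, (i < 2)%N ->
    ev (zc (z - p)) (sub Phi (Gam i)) = ev (fun j => ev (zc (z - p)) (Phi j)) (Gam i).
  have h0 := near0_nbhsc jz jw p (hs 0%N isT).2.
  have h1 := near0_nbhsc jz jw p (hs 1%N isT).2.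
  apply: filterS2 h0 h1 => z e0 e1.
  case=> [_|[_|i i2]].
  - exact: e0.
  - exact: e1.
  exfalso; exact: (notF i2).
apply: filterS3 hP hc (hmap_cont hH hG) => z e1 e2 e3 i i2.
rewrite (e3 i i2) (e2 i i2); apply: ev_ext => j j2; exact: e1.
Qed.

Definition ofc (x : nat -> C) : V := \row_j x (ci jz j).
Lemma zc_ofc x i : (i < 2)%N -> zc (ofc x) i = x i.
Proof.
have jwz : jw == jz = false by rewrite eq_sym (negbTE jzw).
by case: i => [|[|i]] // _; rewrite /zc /ofc !mxE /ci ?eqxx ?jwz.
Qed.

Lemma nbhs_near0c (p : V) (W : set V) : nbhs p W -> near0 2 (fun x => W (p + ofc x)).
Proof.
move=> /nbhs_zc [d [d0 hd]]; exists (d / 2); split=> [|x hx]; first exact: divr_gt0.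
apply: hd => i i2; rewrite addrC addKr zc_ofc //; apply: le_lt_trans (hx i i2) _.
by rewrite ltr_pdivrMr // ltr_pMr // ltr1n.
Qed.

Lemma hmap_id p H Phi : hmap p H Phi -> (\forall z \near p, H z = z) ->
  forall i, (i < 2)%N -> Phi i = var C 2 i.
Proof.
move=> [cP aP hP] hid i i2; apply/eqP; rewrite -subr_eq0; apply/eqP.
have cv := conv_var R 2 i.
apply: conv_eq0; first exact: convB (cP i i2) cv.
have Hp := nbhs_singleton hid.
have := near0_and (nbhs_near0c hP) (near0_and (nbhs_near0c hid) (near_ev (cP i i2) cv)).
apply: near0_imp => x [e1 [e2 [_ e3 _]]]; rewrite e3 ev_var //.
have := e1 i i2; rewrite e2 Hp addrC addKr zc_ofc // => ->.
by rewrite (@ev_ext R 2 _ x) ?subrr // => j j2; rewrite zc_ofc.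
Qed.

Definition pull m (a b : nat) (f : B 2) : B m := sub (pair (var C m a) (var C m b)) f.

Lemma pull_adm m a b : adm 2 (pair (var C m a) (var C m b)).
Proof. by move=> i _; rewrite /pair; case: eqP => _; exact: ord_var. Qed.
Lemma conv_pull m a b (f : B 2) : conv f -> conv (pull m a b f).
Proof.
move=> cf; have [|h _] := near_sub cf _ (@pull_adm m a b) => //.
by move=> i _; rewrite /pair; case: eqP => _; exact: conv_var.
Qed.
Lemma near_pull m a b (f : B 2) : (a < m)%N -> (b < m)%N -> conv f ->
  near0 m (fun x => ev x (pull m a b f) = ev (fun i => if i == 0%N then x a else x b) f).
Proof.
move=> am bm cf; have [|_] := near_sub cf _ (@pull_adm m a b).
  by move=> i _; rewrite /pair; case: eqP => _; exact: conv_var.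
apply: near0_imp => x ->; apply: ev_ext => i _.
by rewrite /pair; case: eqP => _; rewrite ev_var.
Qed.

Lemma zc_zt (k : V) : zc k = fun i => if i == 0%N then zt k 0%N else zt k n.
Proof. by apply/funext => i; rewrite /zc /zt n3. Qed.
Lemma cnj_zc (k : V) : (fun i => cnj (zc k i)) = fun i => if i == 0%N then zt k 1%N else zt k 2%N.
Proof. by apply/funext => i; rewrite /zc /zt; case: (i == 0%N). Qed.

Let lt0 : (0 < n.+1)%N. Proof. by []. Qed.
Let lt1 : (1 < n)%N. Proof. by rewrite n3. Qed.
Let lt2 : (2 < n)%N. Proof. by rewrite n3. Qed.

Lemma near_pull_hol (p : V) (f : B 2) : conv f ->
  \forall z \near p, ev (zt (z - p)) (pull n.+1 0 n f) = ev (zc (z - p)) f.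
Proof.
move=> cf; apply: filterS (near0_nbhs jz jw p (near_pull lt0 (ltnSn n) cf)) => z ->.
by rewrite zc_zt.
Qed.
Lemma near_pull_conj m (p : V) (f : B 2) : (m <= n.+1)%N -> (2 < m)%N -> conv f ->
  \forall z \near p, ev (zt (z - p)) (pull m 1 2 (cj f)) = cnj (ev (zc (z - p)) f).
Proof.
move=> mn m2 cf; have [d [d0 h]] := near_pull (ltnW m2) m2 (conv_cj cf).
have h1 : near0 n.+1 (fun x => ev x (pull m 1 2 (cj f)) =
    ev (fun i => if i == 0%N then x 1%N else x 2%N) (cj f)).
  by exists d; split=> // x hx; apply: h => i im; apply: hx; exact: leq_trans im mn.
have h2 := near0_nbhsc jz jw p (near_cj cf).
by apply: filterS2 (near0_nbhs jz jw p h1) h2 => z ->; rewrite cnj_zc => ->.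
Qed.

(** A holomorphic map acts on series in z, zbar, wbar, w through its own
    series and their conjugates. *)
Definition lift (Phi : nat -> B 2) (i : nat) : B n.+1 :=
  if i == 0%N then pull n.+1 0 n (Phi 0%N) else if i == 1%N then pull n.+1 1 2 (cj (Phi 0%N))
  else if i == 2%N then pull n.+1 1 2 (cj (Phi 1%N)) else pull n.+1 0 n (Phi 1%N).

Lemma lift_adm Phi : adm 2 Phi -> adm n.+1 (lift Phi).
Proof.
move=> aP i _; rewrite /lift; do 3?case: eqP => _;
  apply: (sub_ord (@pull_adm _ _ _)); try apply: ord_cj; exact: aP.
Qed.

Lemma lift_map p H Phi : hmap p H Phi ->
  \forall z \near p, forall i, ev (zt (z - p)) (lift Phi i) = zt (H z - H p) i.
Proof.
move=> [cP aP hP].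
have a0 := near_pull_hol p (cP 0%N isT); have a1 := near_pull_hol p (cP 1%N isT).
have b0 := near_pull_conj p (leqnn n.+1) (leqW lt2) (cP 0%N isT).
have b1 := near_pull_conj p (leqnn n.+1) (leqW lt2) (cP 1%N isT).
apply: filterS3 hP (filterI a0 a1) (filterI b0 b1) => z e [e0 e1] [f0 f1] i.
have g0 := e 0%N isT; have g1 := e 1%N isT.
rewrite /lift /zt; case: (i == 0%N); first by rewrite e0 -g0.
case: (i == 1%N); first by rewrite f0 -g0.
by case: (i == 2%N); [rewrite f1 -g1|rewrite e1 -g1].
Qed.

Lemma rep_pull p H Phi g G : hmap p H Phi -> rep (H p) g G ->
  rep p (fun z => g (H z)) (sub (lift Phi) G).
Proof.
move=> hH [cG hG]; have [cP aP hP] := hH.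
have cL i : (i < n.+1)%N -> conv (lift Phi i).
  by move=> _; rewrite /lift; do 3?case: eqP => _; apply: conv_pull; try apply: conv_cj; exact: cP.
have [cs hs] := near_sub cG cL (lift_adm aP).
split; first exact: cs.
apply: filterS3 (hmap_cont hH hG) (lift_map hH) (near0_nbhs jz jw p hs) => z -> e ->.
by apply: ev_ext => i _; rewrite e.
Qed.

(** If the series of g has no terms of degree 0 and 1, neither has its
    composition with the series of H, which have no constant term. *)
Lemma pull_crit p H Phi g G y dr : hmap p H Phi -> rep (H p) g G ->
  (forall i, (i < n.+1)%N -> cf (fun=> 0%N) (der i G) = 0) -> g (H p) = 0 ->
  (\forall z \near p, g (H z) = y z) -> tay p y dr -> forall nu, lin (dr^~ p) nu = 0.
Proof.
move=> hH hG d0 g0 hy ty nu; have [_ aP _] := hH.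
have G0 : cf (fun=> 0%N) G = 0.
  by have [_ /nbhs_singleton] := hG; rewrite g0 ev_center => <-.
have G2 : ord 2 G.
  pose T k (f : B n.+1) := [/\ (k <= 1)%N, cf (fun=> 0%N) f = 0 &
    k = 1%N -> forall i, (i < n.+1)%N -> cf (fun=> 0%N) (der i f) = 0].
  apply: (@der_graded_ord R n.+1 T) => [[|m] f i ni [h1 h2 h3]|m f [] //|//].
    by split=> //; exact: h3.
  by [].
have hr := rep_pull hH hG.
have h1 := tay_cderive nu (tay_ext (tay_rep hr) hy).
rewrite (tay_cderive nu ty) in h1; rewrite h1.
apply: big1 => i _; rewrite ev_center ord1_cf0 ?mul0r //.
exact: (der_ord i (sub_ord (lift_adm aP) G2)).
Qed.

Variables (M : set V) (p : V) (rho : V -> R) (P : B n.+1).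
Hypothesis hP : rep p (fun z => ((rho z)%:C)%C) P.
Hypothesis rho0 : rho p = 0.
Hypothesis Pw : cf (fun=> 0%N) (der n P) != 0.
Hypothesis hM : \forall z \near p, M z <-> rho z = 0.
Local Notation Q := (graphQ P).

(** phi := rho' o H vanishes on M, so its differential at p is b drho; b is
    not zero, for otherwise rho' = phi o G would be critical at H p. Hence
    the zeros of phi form a graph as well, which is that of rho by
    graph_vanish, and phi = 0 implies membership in M. *)
Lemma map_onto H G Phi Gam (rho' : V -> R) P' :
  hmap p H Phi -> hmap (H p) G Gam ->
  (\forall z \near p, G (H z) = z) -> (\forall y \near H p, H (G y) = y) ->
  rep (H p) (fun z => ((rho' z)%:C)%C) P' -> rho' (H p) = 0 ->
  (exists v, rderive v rho' (H p) != 0) ->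
  (\forall z \near p, rho z = 0 -> rho' (H z) = 0) ->
  \forall y \near H p, rho' y = 0 -> M (G y).
Proof.
move=> hH hG GH HG hP' r0' [v hv] hr.
have Gp : G (H p) = p := nbhs_singleton GH.
pose phi z := rho' (H z).
have hp : rep p (fun z => ((phi z)%:C)%C) (sub (lift Phi) P') := rep_pull hH hP'.
move: (sub (lift Phi) P') hp => Pf hp.
have hr' : \forall z \near p, rho z = 0 -> ((phi z)%:C)%C = 0 :> C.
  by apply: filterS hr => z h /h; rewrite /phi => ->.
have nu0 : exists nu, lin (fun i => ev (zt (p - p)) (der i P)) nu != 0.
  by apply: (lin_neq0 n3 jzw (ltnSn n)); rewrite ev_center.
have [b hb] := tangent_at n3 jzw (tay_rep hP) (tay_rep hp) rho0 nu0 hr'.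
have b0 : b != 0.
  apply/eqP => b0; move/eqP: hv; apply.
  have tr := tay_rep hP'; have [e1 _] := tay_rderive v tr.
  apply: etrans; first exact: e1.
  have hG' : hmap (H p) G Gam := hG.
  rewrite -Gp in hp.
  have hy : \forall y \near H p, ((phi (G y))%:C)%C = ((rho' y)%:C)%C :> C.
    by apply: filterS HG => y; rewrite /phi => ->.
  rewrite (pull_crit hG hp _ _ hy tr v) //; last by rewrite /phi Gp r0'.
  move=> i ni; have := hb i ni; rewrite b0 mul0r.
  by rewrite ev_center.
have Pfw : cf (fun=> 0%N) (der n Pf) != 0.
  by have := hb n (ltnSn n); rewrite !ev_center => ->; rewrite mulf_neq0.
have f0 : phi p = 0 by [].
have Qc := graphQ_conv hP rho0 Pw; have Qfc := graphQ_conv hp f0 Pfw.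
have gP := graphP hP rho0 Pw; have gf := graphP hp f0 Pfw.
have QQ : Q - graphQ Pf = 0.
  apply: (graph_vanish n3 jzw hP rho0 Pw (convB Qc Qfc)).
  have he := near0_nbhs jz jw p (near0_widen (near_ev Qc Qfc)).
  apply: filterS2 (filterI gP gf) (filterI hr he) => z [g1 g2] [h1 [_ e2 _]] rz.
  have fz : phi z = 0 := h1 rz.
  by rewrite e2 -(g1.1 rz) -(g2.1 fz) subrr.
have Qf : graphQ Pf = Q by apply/eqP; rewrite eq_sym -subr_eq0 QQ.
have hz : \forall z \near p, phi z = 0 -> M z.
  apply: filterS3 gP gf hM => z g1 g2 g3 /g2; rewrite Qf => e.
  exact: g3.2 (g1.2 e).
rewrite -Gp in hz.
by apply: filterS2 (hmap_cont hG hz) HG => y h e ry; apply: h; rewrite /phi e.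
Qed.

(** The invariance of M under F is a relation between series on M; it holds
    identically by graph_vanish, and formal_rigidity applies to it. *)
Lemma map_rigid : levi_det Q != 0 -> exists k, forall F Phi, hmap p F Phi -> F p = p ->
  (forall i, (i < 2)%N -> ord k (Phi i - var C 2 i)) ->
  (\forall z \near p, M z -> M (F z)) -> \forall z \near p, F z = z.
Proof.
move=> Q0; have Q1 := graphQ_ord1 hP rho0 Pw; have Qc := graphQ_conv hP rho0 Pw.
have [k hk] := formal_rigidity n3 Q1 (graphQ_tau n3 jzw hP rho0 Pw) Q0.
exists k => F Phi hF Fp hord FM.
have [cP aP hPhi] := hF.
have c0 := cP 0%N isT; have c1 := cP 1%N isT.
have cjord i : (i < 2)%N -> ord k (cj (Phi i) - var C 2 i).
  by move=> i2; rewrite -(cj_var R 2 i) -cj_zmod; apply: ord_cj; exact: hord.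
have cgZ i : (i < 2)%N -> conv (gZ Q i).
  by move=> _; rewrite /gZ /pair; case: eqP => _ //; exact: conv_var.
have sZ (f : B 2) (cf : conv f) := near_sub cf cgZ (gZ_adm Q1).
have cC (f : B 2) : conv f -> conv (sub (gC C n) (cj f)).
  by move=> cf; exact: (@conv_pull n 1 2 _ (conv_cj cf)).
have cgH i : (i < n)%N -> conv (gH Q (Phi 0%N) (cj (Phi 0%N)) (cj (Phi 1%N)) i).
  move=> _; rewrite /gH; case: eqP => _; first exact: (sZ _ c0).1.
  by case: eqP => _; exact: cC.
have agH : adm n (gH Q (Phi 0%N) (cj (Phi 0%N)) (cj (Phi 1%N))).
  move=> i _; rewrite /gH; case: eqP => _.
    exact: sub_ord (gZ_adm Q1) (aP 0%N isT).
  by case: eqP => _; apply: (sub_ord (@gC_adm _ _)); apply: ord_cj; exact: aP.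
have [cQH sQH] := near_sub Qc cgH agH.
have nb0 := near0_nbhs jz jw p (near0_widen (sZ _ c0).2).
have nb1 := near0_nbhs jz jw p (near0_widen (sZ _ c1).2).
have nbc0 := near_pull_conj p (leqnSn n) lt2 c0.
have nbc1 := near_pull_conj p (leqnSn n) lt2 c1.
have nbQ := near0_nbhs jz jw p (near0_widen sQH).
have gP := graphP hP rho0 Pw.
rewrite -Fp in gP.
have gPF := hmap_cont hF gP.
rewrite Fp in gP gPF.
have hMF : \forall z \near p, M (F z) -> rho (F z) = 0.
  have hM' := hM; rewrite -Fp in hM'.
  by apply: filterS (hmap_cont hF hM') => z [].
have inv : sub (gH Q (Phi 0%N) (cj (Phi 0%N)) (cj (Phi 1%N))) Q = sub (gZ Q) (Phi 1%N).
  apply/eqP; rewrite -subr_eq0; apply/eqP.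
  apply: (graph_vanish n3 jzw hP rho0 Pw (convB cQH (sZ _ c1).1)).
  have he := near0_nbhs jz jw p (near0_widen (near_ev cQH (sZ _ c1).1)).
  have hFM : \forall z \near p, rho z = 0 -> zt (F z - p) n = ev (zt (F z - p)) Q.
    apply: filterS3 (filterI hM gPF) FM hMF => z [m1 m2] m3 m4 rz.
    by apply: m2.1; apply: m4; apply: m3; exact: m1.2.
  apply: filterS3 (filterI (filterI nb0 nb1) (filterI nbc0 nbc1))
    (filterI (filterI nbQ he) (filterI gP hPhi)) hFM => z [[e0 e1] [f0 f1]] [[eQ ee] [g hz]] hFz rz.
  have [_ ee' _] := ee; rewrite ee' eQ e1.
  have ez : forall f : B 2, ev (fun i => ev (zt (z - p)) (gZ Q i)) f = ev (zc (z - p)) f.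
    move=> f; apply: ev_ext => i _; rewrite zc_zt /gZ /pair; case: (i == 0%N).
      by rewrite ev_var ?(ltnW lt1).
    by rewrite -(g.1 rz).
  rewrite ez; rewrite ez in e0.
  have z0 := hz 0%N isT; have z1 := hz 1%N isT; rewrite Fp in z0 z1.
  have En : zt (F z - p) n = ev (zc (z - p)) (Phi 1%N) by rewrite -z1 /zt n3.
  rewrite -En hFz //; apply/eqP; rewrite subr_eq0; apply/eqP.
  apply: ev_ext; move=> [|[|[|i]]] ni.
  - exact: etrans e0 (esym z0).
  - exact: etrans f0 (congr1 (@cnj R) (esym z0)).
  - exact: etrans f1 (congr1 (@cnj R) (esym z1)).
  by rewrite n3 in ni; exfalso; exact: (notF ni).
have [E1 E2] := hk _ _ _ _ (hord 0%N isT) (cjord 0%N isT) (cjord 1%N isT) inv.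
apply: filterS3 nbc0 nbc1 hPhi => z f0 f1 hz.
have z0 := hz 0%N isT; have z1 := hz 1%N isT; rewrite Fp in z0 z1.
have k0 : zc (F z - p) 0%N = zc (z - p) 0%N.
  rewrite z0 -[LHS]cnjK -f0 -[RHS]cnjK; congr cnj.
  by rewrite [pull _ _ _ _]E1 ev_var.
have k1 : zc (F z - p) 1%N = zc (z - p) 1%N.
  rewrite z1 -[LHS]cnjK -f1 -[RHS]cnjK; congr cnj.
  by rewrite [pull _ _ _ _]E2 ev_var.
apply/rowP => j; apply: (addIr (- p 0 j)).
have E (u : V) : u 0 j - p 0 j = (u - p) 0 j by rewrite !mxE.
rewrite !E -!(zc_ci jzw).
by rewrite /ci; case: (j == jz).
Qed.

End Maps.

(** * The finite jet determination *)

Section Main.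
Variables (R : realType) (n : nat) (n3 : n = 3%N).
Local Notation C := (Cplx R).
Local Notation V := 'rV[C]_2.

(** If the derivatives with respect to both coordinates vanished, so would
    those with respect to their conjugates, and drho. *)
Lemma good_coordinates (rho : V -> R) p : real_analytic_at rho p ->
  (exists v, rderive v rho p != 0) ->
  exists jz jw : 'I_2, jz != jw /\ exists P, rep jz jw p (fun z => ((rho z)%:C)%C) P /\
    cf (fun=> 0%N) (der n P : B C n.+1) != 0.
Proof.
move=> ra [v hv]; have o01 : (ord0 : 'I_2) != ord_max by [].
have [P hP] := real_rep n3 o01 ra; have tP := tay_rep hP.
have [d0 _ _ dn] := tay_ddz n3 o01 tP.
have [r1 r2] := lin_real n3 o01 (tay_real tP).
have [e0|] := eqVneq (cf (fun=> 0%N) (der n P)) 0; last first.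
  by exists ord0, ord_max; split=> //; exists P.
have o10 : (ord_max : 'I_2) != ord0 by [].
have [P' hP'] := real_rep n3 o10 ra; have tP' := tay_rep hP'.
have [_ _ _ dn'] := tay_ddz n3 o10 tP'.
exists ord_max, ord0; split=> //; exists P'; split=> //.
apply/eqP => e0'; move/eqP: hv; apply.
have [h _] := tay_rderive v tP; apply: etrans; first exact: h.
rewrite !ev_center e0 in r1 r2 dn d0.
rewrite ev_center in dn'; rewrite dn' e0' in d0.
by rewrite (linE n3) !ev_center e0 r1 r2 -d0 cnj0 !mul0r !addr0.
Qed.

(** F = G2 o H1, with G2 the inverse of H2, preserves M by map_onto and is
    tangent to the identity to order k at p, hence is the identity by
    map_rigid. *)
Lemma jet_determination (M : set V) (p : V) :
  real_analytic_hypersurface M -> M p -> not_levi_flat_near M p ->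
  exists k : nat, forall H1 H2 : V -> V,
    local_biholomorphism_at H1 p -> local_biholomorphism_at H2 p ->
    sends_into_itself_at M H1 p -> sends_into_itself_at M H2 p ->
    jet k p H1 = jet k p H2 -> germ_eq p H1 H2.
Proof.
move=> hM Mp flat.
have defining q : M q -> exists rho : V -> R, [/\ rho q = 0,
    real_analytic_at rho q, exists v, rderive v rho q != 0 &
    \forall z \near q, M z <-> rho z = 0].
  move=> Mq; have [U [rho [Uq [Uo ra rd e]]]] := hM q Mq.
  exists rho; split.
  - by have : (M `&` U)%classic q by []; rewrite e => -[].
  - exact: ra.
  - exact: rd.
  have nU : nbhs q U by exact: open_nbhs_nbhs.
  apply: filterS nU => z Uz; split=> h.
    by have : (M `&` U)%classic z by []; rewrite e => -[].
  by have : (U `&` [set z | rho z = 0])%classic z by []; rewrite -e => -[].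
have [rho [rho0 ra rd hrho]] := defining p Mp.
have [jz [jw [jzw [P [hP Pw]]]]] := good_coordinates ra rd.
have Q0 : levi_det (graphQ P) != 0.
  apply/eqP => Q0; apply: flat.
  apply: (levi_degenerate n3 jzw hP rho0 Pw) Q0.
  by apply: filterS hrho => z [].
have [k hk] := map_rigid n3 jzw hP rho0 Pw hrho Q0.
exists k => H1 H2 [U1 [V1 [G1 [[nU1 _] _ _ hol1 _]]]]
  [U2 [V2 [G2 [[nU2 V2o] [fun2 inj2 sur2] can2 hol2 holG]]]] s1 s2 jets.
have U1p : U1 p by case: nU1.
have U2p : U2 p by case: nU2.
have hs j : exists G, hrep jz jw p (fun z => H1 z 0 j) G by exact: (hol_rep jzw (hol1 p U1p j)).
have hs2 j : exists G, hrep jz jw p (fun z => H2 z 0 j) G by exact: (hol_rep jzw (hol2 p U2p j)).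
have V2q : V2 (H2 p) by apply: fun2.
have hsG j : exists G, hrep jz jw (H2 p) (fun z => G2 z 0 j) G.
  exact: (hol_rep jzw (holG _ V2q j)).
have [S1 hS1] := choice hs; have [S2 hS2] := choice hs2; have [SG hSG] := choice hsG.
have m1 := hmap_of hS1; have m2 := hmap_of hS2; have mG := hmap_of hSG.
have H12 : H1 p = H2 p.
  by have := congr1 (fun J : k.-bseq 'I_2 -> V => J (Bseq (isT : (size [::] <= k)%N))) jets.
have jo := jet_ord jzw jets hS1 hS2.
set Phi1 := (fun _ => _) in m1; set Phi2 := (fun _ => _) in m2.
set Gam := (fun _ => _) in mG.
have P12 i : ord k.+1 (Phi1 i - Phi2 i).
  rewrite /Phi1 /Phi2 H12 opprB addrA subrK; exact: jo.
have GH : \forall z \near p, G2 (H2 z) = z.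
  have n2 : nbhs p U2 by exact: open_nbhs_nbhs.
  by apply: filterS n2 => z Uz; apply: can2; rewrite inE.
have HG y : V2 y -> H2 (G2 y) = y.
  by move=> /sur2 [z Uz <-]; rewrite can2 // inE.
have nV : nbhs (H2 p) V2 by apply: open_nbhs_nbhs.
have HGn : \forall y \near H2 p, H2 (G2 y) = y by apply: filterS nV.
have Mq : M (H2 p) := nbhs_singleton s2 Mp.
have [rho' [r0' ra' rd' hrho']] := defining _ Mq.
have [P' hP'] := real_rep n3 jzw ra'.
have onto : \forall y \near H2 p, rho' y = 0 -> M (G2 y).
  apply: (map_onto n3 jzw hP rho0 Pw hrho m2 mG GH HGn hP' r0' rd').
  apply: filterS3 hrho s2 (hmap_cont jzw m2 hrho') => z a b c rz.
  by apply: c.1; apply: b; exact: a.2.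
rewrite -H12 in mG onto hrho' nV.
have mF := hmap_comp jzw m1 mG.
have id2 i (i2 : (i < 2)%N) : sub Phi2 (Gam i) = var C 2 i.
  have mG2 := mG; rewrite H12 in mG2.
  exact: (hmap_id jzw (hmap_comp jzw m2 mG2) GH i2).
have Fp : G2 (H1 p) = p by rewrite H12; exact: (nbhs_singleton GH).
have hF : \forall z \near p, G2 (H1 z) = z.
  apply: (hk _ _ mF Fp) => [i i2|].
    rewrite -id2 //; have [_ a1 _] := m1; have [_ a2 _] := m2.
    by apply: sub_diff => // j _; apply: ord_le (P12 j).
  apply: filterS3 s1 (hmap_cont jzw m1 onto) (hmap_cont jzw m1 hrho') => z a b c Mz.
  by apply: b; apply: c.1; exact: a.
have hV := hmap_cont jzw m1 nV.
by apply: filterS2 hF hV => z e Vz; rewrite -{2}e HG.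
Qed.

End Main.

Theorem theorem1p1 (R : realType) (M : set 'rV[Cplx R]_2) (p : 'rV[Cplx R]_2)
    (hM : real_analytic_hypersurface M) (hp : M p)
    (hflat : not_levi_flat_near M p) :
  exists k : nat, forall H1 H2 : 'rV[Cplx R]_2 -> 'rV[Cplx R]_2,
    local_biholomorphism_at H1 p -> local_biholomorphism_at H2 p ->
    sends_into_itself_at M H1 p -> sends_into_itself_at M H2 p ->
    jet k p H1 = jet k p H2 ->
    germ_eq p H1 H2.
Proof. exact: (jet_determination (erefl 3%N) hM hp hflat). Qed.
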